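(* Let $L\subset\mathbf{R}^n$ be an $n$-dimensional lattice, let $H$ be a hyperplane spanning an $(n-1)$-dimensional sub-lattice of $L$ (i.e. $H\cap L$ is an $(n-1)$-dimensional sub-lattice of $L$ whose affine span is $H$), and let $e\in\mathbf{R}^n$ be a unit vector orthogonal to $H$. Let $\{b_i:1\le i\le n\}$ be a basis of $L$, let $f(x)=(\sum_{i=1}^n b_ix_i)^2$ be the corresponding quadratic form, and let $D(f)$ be the $L$-type domain of $f$. Then the following assertions are equivalent: (i) $H$ is a lamina of the Delaunay partition of $L$; (ii) the Voronoi polytope $P_V$ of $L$ has a closed zone $Z_e$ of edges parallel to the vector $e$; (iii) for every $\epsilon>0$, the $\epsilon$-extended along $e$ lattice $L^{\epsilon}$ has the same $L$-type as $L$; (iv) the rank 1 form $f_e(x)=(e,\sum_{i=1}^n b_ix_i)^2$ lies on an extreme ray of the closure of $D(f)$, i.e. $f+\lambda f_e\in D(f)$ for all $\lambda\ge 0$.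
   Context: $(p,q)$ denotes the standard scalar product and $p^2=(p,p)$. The Voronoi polytope $P_V$ of $L$ is the set of points of $\mathbf{R}^n$ at least as close to $0$ as to any other lattice point; its translates by lattice vectors form the Voronoi partition. A sphere is empty if no lattice point lies in its interior; a Delaunay polytope is the convex hull of all lattice points lying on an empty sphere, when this hull is $n$-dimensional; the Delaunay polytopes form the Delaunay partition of $\mathbf{R}^n$, dual to the Voronoi partition (a $k$-face of one is orthogonal to an $(n-k)$-face of the other). The star is the set of Delaunay polytopes having $0$ as a vertex. Two lattices have the same $L$-type if the face posets (faces of all dimensions ordered by inclusion) of their Voronoi polytopes are isomorphic, i.e. their Voronoi (equivalently Delaunay) partitions are combinatorially and topologically equivalent. A quadratic form $g(x)=(\sum b'_ix_i)^2$ (Gram matrix of a basis $b'_i$) is said to be of the $L$-type of its lattice; the $L$-type domain $D(f)$ is the set of positive definite quadratic forms of the same $L$-type as $f$ (with correspondence via the basis), which is an open polyhedral cone in the space of symmetric $n\times n$ matrices. Zones: the edges of $P_V$ are partitioned into classes of mutually parallel edges, called zones; a zone is closed if every two-dimensional face of $P_V$ contains either exactly two edges of the zone or none. Lamina: for a hyperplane $H$ with $H\cap L$ an $(n-1)$-dimensional sub-lattice, $H$ is a lamina of $L$ if every $(n-1)$-dimensional Delaunay polytope of the lattice $L\cap H$ (within $H$) is a facet of a Delaunay polytope of $L$, i.e. $H$ is partitioned into facets of Delaunay polytopes of $L$. $\epsilon$-extension along a unit vector $e$: the linear map sending $v\in\mathbf{R}^n$ to $v'=v+\epsilon(e,v)e$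 (so ${v'}^2=v^2+\epsilon(2+\epsilon)(e,v)^2$); $L^{\epsilon}$ is the image of $L$ under this map. *)

(* Defs.v *)
From HB Require Import structures.
From mathcomp Require Import all_boot all_order all_algebra.
From mathcomp Require Import boolp classical_sets reals.
Set Implicit Arguments. Unset Strict Implicit. Unset Printing Implicit Defensive.
Import Order.TTheory GRing.Theory Num.Theory.
Local Open Scope ring_scope.
Local Open Scope classical_set_scope.

Section Defs.
Variables (R : realType) (n : nat).
Local Notation V := 'rV[R]_n.

Definition dot (u v : V) : R := (u *m v^T) 0 0.
Definition norm2 (v : V) : R := dot v v.

Definition integral (z : V) : Prop := forall i, z 0 i \is a Num.int.
Definition lattice_of (B : 'M[R]_n) : set V :=
  [set x | exists z, integral z /\ x = z *m B].

Definition affine_hull (S : set V) : set V :=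
  [set x | exists k (p : 'I_k -> V) (w : 'I_k -> R),
     (forall i, S (p i)) /\ \sum_(i < k) w i = 1 /\ x = \sum_(i < k) w i *: p i].
Definition conv (S : set V) : set V :=
  [set x | exists k (p : 'I_k -> V) (w : 'I_k -> R),
     (forall i, S (p i)) /\ (forall i, 0 <= w i) /\
     \sum_(i < k) w i = 1 /\ x = \sum_(i < k) w i *: p i].

Definition affdim (S : set V) (k : nat) : Prop :=
  exists (p : V) (w : 'I_k -> V),
    (forall t : 'I_k -> R, \sum_(i < k) t i *: w i = 0 -> forall i, t i = 0) /\
    affine_hull S = [set x | exists t : 'I_k -> R, x = p + \sum_(i < k) t i *: w i].

(* faces (of all dimensions, including the empty face and P itself) of a
   convex polytope P: intersections with supporting hyperplanes *)
Definition is_face (P F : set V) : Prop :=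
  exists (a : V) (c : R), (forall x, P x -> dot a x <= c) /\
    F = P `&` [set x | dot a x = c].
Definition segment (p q : V) : set V :=
  [set x | exists t : R, 0 <= t <= 1 /\ x = (1 - t) *: p + t *: q].
Definition is_edge (P E : set V) : Prop :=
  is_face P E /\ exists p q : V, p != q /\ E = segment p q.
Definition is_2face (P G : set V) : Prop := is_face P G /\ affdim G 2.
Definition is_facet (P F : set V) : Prop := is_face P F /\ affdim F n.-1.

Definition voronoi (L : set V) : set V :=
  [set x | forall v, L v -> norm2 x <= norm2 (x - v)].

Definition parallel_to (e : V) (E : set V) : Prop :=
  exists (p q : V) (t : R), p != q /\ E = segment p q /\ q - p = t *: e.
Definition zone (P : set V) (e : V) : set (set V) :=
  [set E | is_edge P E /\ parallel_to e E].
Definition closed_zone (P : set V) (Z : set (set V)) : Prop :=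
  forall G, is_2face P G ->
    (forall E, Z E -> ~ (E `<=` G)) \/
    exists E1 E2, E1 <> E2 /\
      forall E, (Z E /\ E `<=` G) <-> (E = E1 \/ E = E2).
Definition has_closed_zone (P : set V) (e : V) : Prop :=
  (exists E, zone P e E) /\ closed_zone P (zone P e).

Definition same_Ltype (L1 L2 : set V) : Prop :=
  exists phi : set V -> set V,
    (forall F, is_face (voronoi L1) F -> is_face (voronoi L2) (phi F)) /\
    (forall G, is_face (voronoi L2) G ->
       exists F, is_face (voronoi L1) F /\ phi F = G) /\
    (forall F1 F2, is_face (voronoi L1) F1 -> is_face (voronoi L1) F2 ->
       (F1 `<=` F2 <-> phi F1 `<=` phi F2)).

Definition delaunay_in (A Lam : set V) (k : nat) (P : set V) : Prop :=
  exists (c : V) (r : R), A c /\ (forall v, Lam v -> r <= norm2 (v - c)) /\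
    P = conv (Lam `&` [set v | norm2 (v - c) = r]) /\
    affdim (Lam `&` [set v | norm2 (v - c) = r]) k.

Definition is_lamina (L H : set V) : Prop :=
  forall P, delaunay_in H (L `&` H) n.-1 P ->
    exists D, delaunay_in setT L n D /\ is_facet D P.

(* epsilon-extension along e: v |-> v + eps (e,v) e, acting on row vectors *)
Definition ext_mx (e : V) (eps : R) : 'M[R]_n := 1%:M + eps *: (e^T *m e).

Definition qf (G : 'M[R]_n) (x : V) : R := (x *m G *m x^T) 0 0.
Definition posdef (G : 'M[R]_n) : Prop := forall x : V, x != 0 -> 0 < qf G x.
(* vertex sets (integer coordinates) of the Delaunay polytopes of Z^n for
   the metric qf G *)
Definition del_sets (G : 'M[R]_n) : set (set V) :=
  [set S | exists (c : V) (r : R),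
     (forall z, integral z -> r <= qf G (z - c)) /\
     S = [set z | integral z /\ qf G (z - c) = r] /\ affdim S n].
(* L-type domain D(F): positive definite forms of the same L-type as F,
   with the correspondence given by the basis (same Delaunay partition
   in coordinates) *)
Definition Ldomain (F : 'M[R]_n) : set 'M[R]_n :=
  [set G | G^T = G /\ posdef G /\ del_sets G = del_sets F].

End Defs.

(* Main.v *)
(* Write q z = |zB|^2 and l z = (e, zB) on integral vectors z. A Delaunay cell is the zero
   set of a nonnegative function Q differing from q by an affine function; dually, the
   points x of the Voronoi polytope are those Q with Q 0 = 0, and the face of x is
   determined by the zeros of Q. All assertions are equivalent to the property "allgood":
   every cell Q of the layer l = 0 becomes, after adding a multiple of l, nonnegative on the
   whole lattice with no new zeros.

   Lamina and "allgood" are related by tilting Q by multiples of l up to the next zeros.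
   If all is good, no lattice layer lies strictly between two vertices of a Delaunay cell,
   so on each cell l^2 agrees with an affine function that is below l^2 on the lattice;
   adding lam times the difference shows that q + lam l^2 has the same cells. Conversely,
   if these cells are the same for all lam, a cell of the layer is a facet of a cell for
   large lam, hence for lam = 0.

   Equal cells give equal face posets of Voronoi polytopes. Conversely, if the L-type is
   constant then so is the number of vertices of the Voronoi polytope; were l^2 not affine
   on some cell, then that cell would break, and a star would gain a cell, as lam grows.

   An edge parallel to e is a good cell of the layer through 0. Consider a 2-face
   containing such an edge. Modulo e it is a segment, whose ends yield cells of the layer:
   if all cells are good, exactly these two give zone edges. If the zone is closed and P is
   a bad cell, take the good Q with the least sum over P; crossing the 2-face given by an
   extreme ray towards P yields a zone edge with a smaller sum, a contradiction. *)
Require Import Defs.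
From HB Require Import structures.
From mathcomp Require Import all_boot all_order all_algebra.
From mathcomp Require Import boolp classical_sets reals.
From mathcomp Require Import zify ring lra.
Set Implicit Arguments. Unset Strict Implicit. Unset Printing Implicit Defensive.
Import Order.TTheory GRing.Theory Num.Theory.
Local Open Scope ring_scope.
Local Open Scope classical_set_scope.

(** No theory of polyhedra or linear programming is used; its duality arguments are replaced by one
    device. Sublevel sets of the functions Q on the lattice are finite, so Q + t b, with b affine,
    can be followed until a new zero appears ([hit]), and a direction nonnegative at the zeros of Q
    can be followed a little ([perturb]). Repeating [hit] leads from any supporting function to a
    cell, without increasing a prescribed sum of values. To compare cells, one takes a cell for
    which such a sum is least, perturbs it towards a competitor and walks on to a cell with a
    smaller sum. The least sum exists because only finitely many cells have a bounded value at a
    given point of the span. The obstacle in (iii) is that an isomorphism of face posets need not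
    respect lattice coordinates, so the cells of two lattices cannot be matched through it. Only the
    number of cells at 0 survives, and it is compared by injections: if a star grew, these would
    compose to an injection of a finite set into itself that misses an element. *)

Section Dot.
Variables (R : realType) (n : nat).
Implicit Types (u v w x y z : 'rV[R]_n) (k : R).

Lemma dotE u v : dot u v = \sum_i u 0 i * v 0 i.
Proof. by rewrite /dot mxE; apply: eq_bigr => i _; rewrite mxE. Qed.

Lemma dotC u v : dot u v = dot v u.
Proof. by rewrite !dotE; apply: eq_bigr => i _; rewrite mulrC. Qed.

Lemma dotDl u v w : dot (u + v) w = dot u w + dot v w.
Proof. by rewrite /dot mulmxDl mxE. Qed.

Lemma dotZl k u w : dot (k *: u) w = k * dot u w.
Proof. by rewrite /dot -scalemxAl mxE. Qed.

Lemma dotNl u w : dot (- u) w = - dot u w.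
Proof. by rewrite -scaleN1r dotZl mulN1r. Qed.

Lemma dotBl u v w : dot (u - v) w = dot u w - dot v w.
Proof. by rewrite dotDl dotNl. Qed.

Lemma dot0l w : dot 0 w = 0.
Proof. by rewrite /dot mul0mx mxE. Qed.

Lemma dotDr u v w : dot w (u + v) = dot w u + dot w v.
Proof. by rewrite dotC dotDl !(dotC w). Qed.

Lemma dotZr k u w : dot w (k *: u) = k * dot w u.
Proof. by rewrite dotC dotZl (dotC w). Qed.

Lemma dotNr u w : dot w (- u) = - dot w u.
Proof. by rewrite dotC dotNl (dotC w). Qed.

Lemma dotBr u v w : dot w (u - v) = dot w u - dot w v.
Proof. by rewrite dotDr dotNr. Qed.

Lemma dot0r w : dot w 0 = 0.
Proof. by rewrite dotC dot0l. Qed.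

Lemma dot_suml (I : Type) (r : seq I) (P : pred I) (F : I -> 'rV[R]_n) w :
  dot (\sum_(i <- r | P i) F i) w = \sum_(i <- r | P i) dot (F i) w.
Proof.
by elim/big_rec2: _ => [|i x y _ <-]; rewrite ?dot0l // dotDl.
Qed.

Lemma norm2_ge0 u : 0 <= norm2 u.
Proof. by rewrite /norm2 dotE sumr_ge0 // => i _; rewrite -expr2 sqr_ge0. Qed.

Lemma norm2D u v : norm2 (u + v) = norm2 u + 2 * dot u v + norm2 v.
Proof. by rewrite /norm2 !dotDl !dotDr (dotC v u); ring. Qed.

Lemma norm2B u v : norm2 (u - v) = norm2 u - 2 * dot u v + norm2 v.
Proof. by rewrite norm2D dotNr /norm2 dotNl dotNr; ring. Qed.

Lemma norm2_eq0 u : (norm2 u == 0) = (u == 0).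
Proof.
apply/eqP/eqP => [|->]; last by rewrite /norm2 dot0l.
rewrite /norm2 dotE => /eqP; rewrite psumr_eq0; last first.
  by move=> i _; rewrite -expr2 sqr_ge0.
move=> /allP u0; apply/rowP => i; rewrite mxE; apply/eqP.
by have := u0 i; rewrite mem_index_enum mulf_eq0 orbb => /(_ isT).
Qed.

End Dot.

Lemma dot_mulmxl (R : realType) (m n : nat) (u : 'rV[R]_m) (M : 'M_(m, n)) (v : 'rV_n) :
  dot (u *m M) v = dot u (v *m M^T).
Proof. by rewrite /dot trmx_mul trmxK mulmxA. Qed.

(** * Affine functions and affine hulls, by duality *)

Section Affine.
Variables (R : realType) (n : nat).
Local Notation V := 'rV[R]_n.
Implicit Types (b c : V -> R) (S T X : set V).

Definition affine b := exists (a : V) (c : R), forall z, b z = dot z a + c.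

Definition kills T b := forall z, T z -> b z = 0.

(** [X] lies in the affine hull of [T], stated by duality so that neither points of the hull nor
    dimensions are mentioned. *)
Definition full X T := forall b, affine b -> kills T b -> kills X b.

Lemma affine_cst k : affine (fun=> k).
Proof. by exists 0, k => z; rewrite dot0r add0r. Qed.

Lemma affine_dot a : affine (fun z => dot z a).
Proof. by exists a, 0 => z; rewrite addr0. Qed.

Lemma affineD b c : affine b -> affine c -> affine (fun z => b z + c z).
Proof.
move=> [a1 [c1 e1]] [a2 [c2 e2]]; exists (a1 + a2), (c1 + c2) => z.
by rewrite e1 e2 dotDr addrACA.
Qed.

Lemma affineZ k b : affine b -> affine (fun z => k * b z).
Proof.
by move=> [a [c e1]]; exists (k *: a), (k * c) => z; rewrite e1 dotZr mulrDr.
Qed.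

Lemma affineN b : affine b -> affine (fun z => - b z).
Proof.
by move=> /(affineZ (-1)) [a [c e]]; exists a, c => z; rewrite -e mulN1r.
Qed.

Lemma affineB b c : affine b -> affine c -> affine (fun z => b z - c z).
Proof. by move=> hb /affineN; apply: affineD. Qed.

Lemma affine_shift b v : affine b -> affine (fun z => b (z + v)).
Proof.
by move=> [a [c e]]; exists a, (dot v a + c) => z; rewrite e dotDl addrA.
Qed.

Lemma eq_affine b c : affine b -> (forall z, c z = b z) -> affine c.
Proof. by move=> [a [k e]] h; exists a, k => z; rewrite h. Qed.

Lemma affine_comb b k (p : 'I_k -> V) (w : 'I_k -> R) : affine b ->
  \sum_(i < k) w i = 1 ->
  b (\sum_(i < k) w i *: p i) = \sum_(i < k) w i * b (p i).
Proof.
move=> [a [c e]] w1; rewrite e dot_suml -[c in LHS]mul1r -w1 mulr_suml -big_split /=.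
by apply: eq_bigr => i _; rewrite dotZl e mulrDr.
Qed.

Lemma affine_mid b (s : R) x y : affine b ->
  b ((1 - s) *: x + s *: y) = (1 - s) * b x + s * b y.
Proof. by move=> [a [c e]]; rewrite !e dotDl !dotZl; ring. Qed.

(** Homogeneous coordinates: affine functions become linear functionals, affine independence becomes
    row freeness, and the last entry records the sum of the weights. *)
Definition key (z : V) : 'rV[R]_(n + 1) := row_mx z 1%:M.

Lemma affine_key b : affine b -> exists g : 'cV_(n + 1), forall z, b z = (key z *m g) 0 0.
Proof.
move=> [a [c e]]; exists (col_mx a^T c%:M) => z.
by rewrite /key mul_row_col mul1mx mxE e /dot [c%:M]mx11_scalar !mxE eqxx mulr1n.
Qed.

Lemma key_affine (g : 'cV[R]_(n + 1)) : affine (fun z => (key z *m g) 0 0).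
Proof.
exists (usubmx g)^T, (dsubmx g 0 0) => z.
rewrite -[g in LHS]vsubmxK /key mul_row_col mul1mx mxE /dot trmxK; congr (_ + _).
Qed.

Definition indep k (p : 'I_k -> V) := row_free (\matrix_i key (p i)).

Lemma indep_le k (p : 'I_k -> V) : indep p -> (k <= n + 1)%N.
Proof. by move=> /eqP <-; apply: rank_leq_col. Qed.

Lemma indep_nil (p : 'I_0 -> V) : indep p.
Proof. by rewrite /indep /row_free -leqn0 rank_leq_row. Qed.

(** Applying the functional [b] to a linear relation leaves only the coefficient of [z]. *)
Lemma indep_extend k (p : 'I_k -> V) z : indep p ->
  (exists2 b, affine b & (forall i, b (p i) = 0) /\ b z <> 0) ->
  indep (fun i : 'I_k.+1 => if unlift ord_max i is Some j then p j else z).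
Proof.
move=> fp [b /affine_key[g bg] [bp /eqP bz]].
apply: inj_row_free => u.
rewrite mulmx_sum_row (bigD1_ord ord_max) //= rowK unlift_none.
under eq_bigr do rewrite rowK liftK.
move=> u0; have um0 : u 0 ord_max = 0.
  have := congr1 (fun M => (M *m g) 0 0) u0.
  rewrite mulmxDl mulmx_suml -scalemxAl mul0mx mxE [in RHS]mxE.
  rewrite [X in X + _]mxE -bg summxE big1 => [|i _].
    by move/eqP; rewrite addr0 mulf_eq0 (negPf bz) orbF => /eqP.
  by rewrite -scalemxAl mxE -bg bp mulr0.
move: u0; rewrite um0 scale0r add0r => u0.
have : (\row_i u 0 (lift ord_max i)) *m \matrix_i key (p i) = 0.
  rewrite mulmx_sum_row -[RHS]u0; apply: eq_bigr => i _; by rewrite rowK mxE.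
move/eqP; rewrite mulmx_free_eq0 // => /eqP/rowP w0.
apply/rowP => i; rewrite mxE; case: (unliftP ord_max i) => [j|] -> //.
by have := w0 j; rewrite !mxE.
Qed.

Lemma max_indep S : exists k (p : 'I_k -> V), [/\ forall i, S (p i), indep p &
  forall b, affine b -> (forall i, b (p i) = 0) -> kills S b].
Proof.
pose free k := exists2 p : 'I_k -> V, (forall i, S (p i)) & indep p.
have [k [p Sp fA] kmax] : exists2 k, free k & ~ free k.+1.
  apply: contrapT => h; have fr k : free k.
    elim: k => [|k IH].
      by exists (fun _ => 0); [case|exact: indep_nil].
    by apply: contrapT => nf; apply: h; exists k.
  by have [p _ /indep_le] := fr (n + 2)%N; rewrite leq_add2l.
exists k, p; split=> // b hb bp z Sz; apply: contrapT => bz; apply: kmax.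
exists (fun i => if unlift ord_max i is Some j then p j else z).
  by move=> i; case: unliftP.
by apply: indep_extend => //; exists b.
Qed.

(** For the converse, each column of the cokernel of a maximal independent family is an affine
    function that vanishes on [S], hence at [x]; so the key of [x] lies in the row space. *)
Lemma hullP S x :
  affine_hull S x <-> forall b, affine b -> kills S b -> b x = 0.
Proof.
split=> [[k [p [w [Sp [w1 ->]]]]] b hb bS|H].
  rewrite affine_comb //; apply: big1 => i _; by rewrite bS ?mulr0.
have [k [p [Sp fA killS]]] := max_indep S; set A := \matrix_i key (p i) in fA.
have xA : (key x <= A)%MS.
  rewrite submxE; apply/eqP/rowP => j; rewrite [RHS]mxE.
  have mul_colE m (u : 'rV[R]_(n + 1)) (C : 'M_(n + 1, m)) i :
    (u *m C) 0 i = (u *m col i C) 0 0 by rewrite colE mulmxA -colE [RHS]mxE.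
  rewrite mul_colE.
  apply: (H (fun z => (key z *m _) 0 0)); first exact: key_affine.
  apply: killS => [|i]; first exact: key_affine.
  have -> : key (p i) = row i A by rewrite rowK.
  by rewrite -mul_colE -row_mul mulmx_coker !mxE.
have [w xw] := submxP xA; exists k, p, (fun i => w 0 i); split=> //.
have wA : w *m A = row_mx (\sum_i w 0 i *: p i) (\sum_i w 0 i)%:M.
  rewrite mulmx_sum_row; under eq_bigr do rewrite rowK /key scale_row_mx.
  apply/rowP => j; rewrite summxE -(splitK j); case: (split j) => i /=.
    by rewrite row_mxEl summxE; apply: eq_bigr => a _; rewrite row_mxEl.
  rewrite row_mxEr mxE ord1 eqxx mulr1n; apply: eq_bigr => a _.
  by rewrite row_mxEr !mxE eqxx mulr1.
move: xw; rewrite wA /key => /eq_row_mx [-> /matrixP/(_ 0 0)].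
by rewrite !mxE eqxx !mulr1n => ->.
Qed.

End Affine.

Arguments affine_cst {R n} k.

(** * Following an affine perturbation until it creates zeros *)

Section Sublevel.
Variables (R : realType) (n : nat).
Local Notation V := 'rV[R]_n.
Implicit Types (b c g h q Q : V -> R) (S T X : set V).

Definition sublevel_finite X h := exists s : seq V, forall z, X z -> h z <= 0 -> z \in s.

Lemma sublevel_finite_le X g h :
  (forall z, X z -> g z <= h z) -> sublevel_finite X g -> sublevel_finite X h.
Proof. by move=> gh [s hs]; exists s => z Xz hz; apply: hs (le_trans (gh z Xz) hz). Qed.

Lemma sublevel_finite_sub X Y h :
  X `<=` Y -> sublevel_finite Y h -> sublevel_finite X h.
Proof. by move=> XY [s hs]; exists s => z /XY; apply: hs. Qed.

Definition supports X Q := forall z, X z -> 0 <= Q z.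

Definition zeros X Q := [set z | X z /\ Q z = 0].

Lemma seq_min (T : eqType) (s : seq T) (P : T -> Prop) (f : T -> R) :
  (exists2 x, x \in s & P x) ->
  exists x, [/\ x \in s, P x & forall y, y \in s -> P y -> f x <= f y].
Proof.
elim: s => [[x]//|a s IH] ex.
have [[x xs Px]|nex] := pselect (exists2 x, x \in s & P x).
  have [x0 [x0s Px0 m]] := IH (ex_intro2 _ _ x xs Px).
  have [[Pa lea]|na] := pselect (P a /\ f a <= f x0).
    exists a; rewrite mem_head; split=> // y; rewrite inE => /orP[/eqP->//|ys Py].
    exact: le_trans lea (m _ ys Py).
  exists x0; rewrite inE x0s orbT; split=> // y; rewrite inE => /orP[/eqP->|]; last exact: m.
  by move=> Pa; rewrite leNgt; apply/negP => l; apply: na; split=> //; apply: ltW.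
case: ex => x; rewrite inE => /orP[/eqP-> Pa|xs Px]; last by case: nex; exists x.
exists a; rewrite mem_head; split=> // y; rewrite inE => /orP[/eqP->//|ys Py].
by case: nex; exists y.
Qed.

(** The ratio test of linear programming: [t] is the least [Q z / - g z] over the points with
    [g z < 0]. The ratio [t1] of one such point restricts the competition to a finite sublevel
    set. *)
Lemma hit X Q g : supports X Q ->
  (forall t, 0 <= t -> sublevel_finite X (fun z => Q z + t * g z)) ->
  (exists2 x, X x & g x < 0) ->
  exists t, [/\ 0 <= t, supports X (fun z => Q z + t * g z) &
    exists2 z, X z & g z < 0 /\ Q z + t * g z = 0].
Proof.
move=> sQ fin [x1 Xx1 gx1]; pose t1 := Q x1 / - g x1.
have t1_ge0 : 0 <= t1 by rewrite divr_ge0 ?sQ // oppr_ge0 ltW.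
have [s hs] := fin _ t1_ge0.
have [|x [xs [Xx gx] m]] := @seq_min _ s (fun z => X z /\ g z < 0) (fun z => Q z / - g z).
  exists x1 => //; apply: hs => //; rewrite /t1 invrN mulrN mulNr divfK ?subrr //.
  by rewrite lt_eqF.
exists (Q x / - g x); split.
- by rewrite divr_ge0 ?sQ // oppr_ge0 ltW.
- move=> z Xz; have [gz|gz] := leP 0 (g z).
    by rewrite addr_ge0 ?sQ // mulr_ge0 // divr_ge0 ?sQ // oppr_ge0 ltW.
  suff : Q x / - g x <= Q z / - g z.
    rewrite [X in _ <= X -> _](_ : _ = - (Q z / g z)) ?invrN ?mulrN //.
    move=> h; have : - (Q x / g x) * g z >= - (Q z / g z) * g z.
      by rewrite ler_nM2r.
    by rewrite [X in X <= _]mulNr divfK ?lt_eqF //; lra.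
  have [le|lt] := leP (Q z / - g z) t1; last first.
    by apply: le_trans (ltW lt); apply: m; [apply: hs => //|split=> //];
    rewrite /t1 invrN mulrN mulNr divfK ?subrr // lt_eqF.
  apply: m; last by split.
  apply: hs => //; have : t1 * g z <= Q z / - g z * g z by rewrite ler_nM2r.
  by rewrite invrN mulrN [X in _ <= X -> _]mulNr divfK ?lt_eqF //; lra.
- exists x => //; split=> //.
  by rewrite invrN mulrN mulNr divfK ?subrr // lt_eqF.
Qed.

(** Where [Q] and [Q + g] are positive, so is [Q + t g] for t <= 1, by convexity. The finitely many
    other points with [Q] positive impose a least ratio, halved to keep the inequality strict. *)
Lemma perturb X Q g : supports X Q -> sublevel_finite X (fun z => Q z + g z) ->
  (forall z, X z -> Q z = 0 -> 0 <= g z) ->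
  exists2 t0, 0 < t0 & forall t, 0 < t <= t0 ->
    supports X (fun z => Q z + t * g z) /\
    (forall z, X z -> Q z + t * g z = 0 -> Q z = 0 /\ g z = 0).
Proof.
move=> sQ [s hs] g0.
suff [t0 t00 pos] : exists2 t0, 0 < t0 & forall t, 0 < t <= t0 ->
    forall z, X z -> 0 < Q z -> 0 < Q z + t * g z.
  exists t0 => // t ht; have t_gt0 : 0 < t by case/andP: ht.
  split=> [z Xz|z Xz].
    have [Qz|] := ltP 0 (Q z); first exact/ltW/(pos t).
    move=> Q0; have Qz : Q z = 0 by apply/eqP; rewrite eq_le Q0 sQ.
    by rewrite Qz add0r mulr_ge0 ?g0 // ltW.
  have [Qz e|] := ltP 0 (Q z); first by have := pos t ht z Xz Qz; rewrite e ltxx.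
  move=> Q0; have Qz : Q z = 0 by apply/eqP; rewrite eq_le Q0 sQ.
  rewrite Qz add0r => /eqP; rewrite mulf_eq0 gt_eqF //= => /eqP; by split.
have far z t : X z -> 0 < Q z -> 0 < Q z + g z -> 0 < t <= 1 -> 0 < Q z + t * g z.
  move=> Xz Qz Qg /andP[t0 t1].
  have -> : Q z + t * g z = (1 - t) * Q z + t * (Q z + g z) by ring.
  by rewrite ltr_wpDl ?mulr_gt0 // mulr_ge0 ?subr_ge0 // ltW.
have [ex|nex] := pselect (exists2 z, z \in s & [/\ X z, 0 < Q z & g z < 0]).
  have [x [xs [Xx Qx gx] m]] := seq_min (fun z => Q z / - g z) ex.
  have r0 : 0 < Q x / - g x by rewrite divr_gt0 // oppr_gt0.
  exists (Num.min 1 (Q x / - g x / 2)); first by rewrite lt_min ltr01 divr_gt0.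
  move=> t /andP[t0]; rewrite le_min => /andP[t1 tx] z Xz Qz.
  have [Qg|Qg] := ltP 0 (Q z + g z); first by apply: far; rewrite ?t0.
  have gz : g z < 0 by lra.
  have := m z (hs _ Xz Qg) (And3 Xz Qz gz) => le.
  have : t < Q z / - g z by lra.
  by rewrite ltr_pdivlMr ?oppr_gt0 // mulrN; lra.
exists 1 => // t /andP[t0 t1] z Xz Qz.
have [Qg|Qg] := ltP 0 (Q z + g z); first by apply: far; rewrite ?t0.
by case: nex; exists z; [exact: hs|split=> //; lra].
Qed.

(* The rank of the keys of the zeros strictly increases along the walk. *)
Lemma walk X (Inv stop : (V -> R) -> Prop) :
  (forall Q, Inv Q -> supports X Q /\
     forall b, affine b -> sublevel_finite X (fun z => Q z + b z)) ->
  (forall Q, Inv Q -> stop Q \/ exists b, [/\ affine b, kills (zeros X Q) b,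
     exists2 x, X x & b x < 0 & forall t, 0 <= t ->
       supports X (fun z => Q z + t * b z) -> Inv (fun z => Q z + t * b z)]) ->
  forall Q, Inv Q -> exists Q', [/\ Inv Q', stop Q' & zeros X Q `<=` zeros X Q'].
Proof.
move=> hInv step Q0 IQ0.
(* [k] independent zeros are known and at most [n + 1] exist, so [m] bounds the number of steps
   left. *)
suff H m k (p : 'I_k -> V) Q : (n + 1 <= k + m)%N -> Inv Q ->
    (forall i, zeros X Q (p i)) -> indep p ->
    exists Q', [/\ Inv Q', stop Q' & zeros X Q `<=` zeros X Q'].
  apply: (H (n + 1)%N 0%N (fun _ => 0)) => //; [by case|exact: indep_nil].
elim: m k p Q => [|m IH] k p Q le IQ zp ip;
    (case: (step Q IQ) => [sQ|[b [hb kb neg cont]]]; first by exists Q; split);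
    have [sQ fin] := hInv _ IQ;
    have [|t [t0 st [z Xz [bz Qz]]]] := hit sQ _ neg;
    try by move=> t _; apply: fin; apply: affineZ.
  have /indep_le : indep (fun i : 'I_k.+1 => if unlift ord_max i is Some j then p j else z).
    apply: indep_extend => //; exists b => //; split=> [i|]; first exact: kb.
    by apply/eqP; rewrite lt_eqF.
  by rewrite leqNgt ltnS (leq_trans le) // addn0.
have zz : zeros X Q `<=` zeros X (fun z => Q z + t * b z).
  by move=> y zy; split; [case: zy|rewrite (kb y zy) mulr0 addr0; case: zy].
have [||||Q' [IQ' sQ' zQ']] := IH k.+1
    (fun i : 'I_k.+1 => if unlift ord_max i is Some j then p j else z)
    (fun z => Q z + t * b z).
- by rewrite addSnnS.
- exact: cont.
- by move=> i; case: unliftP => [j _|_]; [exact: zz|split].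
- apply: indep_extend => //; exists b => //; split=> [i|]; first exact: kb.
  by apply/eqP; rewrite lt_eqF.
- by exists Q'; split=> //; apply: subset_trans zQ'.
Qed.

End Sublevel.

(** * Growth of the squared length on integer points *)

Section Coercive.
Variables (R : realType) (n : nat).
Local Notation V := 'rV[R]_n.
Implicit Types (b c g h q Q : V -> R) (S T X : set V).

Definition norm1 m (z : 'rV[R]_m) : R := \sum_i `|z 0 i|.

Lemma norm1_ge0 m (z : 'rV[R]_m) : 0 <= norm1 z.
Proof. exact: sumr_ge0. Qed.

Lemma norm1_mulmx m k (M : 'M[R]_(m, k)) :
  exists2 C, 0 <= C & forall z, norm1 (z *m M) <= C * norm1 z.
Proof.
exists (\sum_j \sum_i `|M i j|) => [|z].
  by apply: sumr_ge0 => j _; apply: sumr_ge0.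
rewrite /norm1 mulr_suml; apply: ler_sum => j _.
rewrite mxE (le_trans (ler_norm_sum _ _ _)) // mulr_suml.
apply: ler_sum => i _; rewrite normrM mulrC ler_wpM2l //.
by rewrite (bigD1 i) //= lerDl sumr_ge0.
Qed.

(** Growth faster than every linear function: in this form, finiteness of sublevel sets survives
    adding an affine function. *)
Definition coercive q :=
  forall K, sublevel_finite (@integral R n) (fun z => q z - K * (1 + norm1 z)).

Lemma integral_box (N : nat) :
  exists s : seq V, forall z, integral z -> (forall i, `|z 0 i| <= N%:R) -> z \in s.
Proof.
exists [seq \row_i ((f i)%:R - N%:R) | f : {ffun 'I_n -> 'I_(N + N).+1}].
move=> z iz zN; apply/fintype.imageP.
have fz i : {k : 'I_(N + N).+1 | z 0 i = k%:R - N%:R}.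
  apply: cid; have /intrP [m zm] := iz i; have := zN i; rewrite zm.
  rewrite ler_norml (pmulrn 1 N) -mulrNz !(ler_int R) => /andP[h1 h2].
  have h0 : 0 <= m + N%:Z by lia.
  have h3 : (absz (m + N%:Z)%R < (N + N).+1)%N by lia.
  exists (Ordinal h3) => /=.
  by rewrite /= !pmulrn gez0_abs // mulrzDr mulrNz addrK.
exists [ffun i => sval (fz i)] => //.
by apply/rowP => i; rewrite mxE ffunE; case: (fz i).
Qed.

Lemma affine_norm1 b : affine b -> exists2 K, 0 <= K & forall z, `|b z| <= K * (1 + norm1 z).
Proof.
move=> [a [c e]]; exists (norm1 a + `|c|) => [|z]; first by rewrite addr_ge0 ?norm1_ge0.
rewrite e (le_trans (ler_normD _ _)) // mulrDr mulr1 -addrA.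
have h : `|dot z a| <= norm1 a * norm1 z.
  rewrite dotE (le_trans (ler_norm_sum _ _ _)) // mulr_sumr.
  apply: ler_sum => i _; rewrite normrM mulrC ler_wpM2r //.
  by rewrite /norm1 (bigD1 i) //= lerDl sumr_ge0.
have := mulr_ge0 (normr_ge0 c) (norm1_ge0 z); have := norm1_ge0 a.
rewrite !mulrDl; move: h; move: (`|dot _ _|) (`|c| * _) (norm1 a * _) => x y w; lra.
Qed.

Lemma coercive_norm2 (B : 'M[R]_n) : B \in unitmx -> coercive (fun z => norm2 (z *m B)).
Proof.
move=> uB K; have [C C0 hC] := norm1_mulmx (invmx B).
pose K' := `|K|; pose A := K' * C.
(* [2 t |y_i| <= y_i^2 + t^2] with [t = A + 1] *)
pose D := C * (K' + n%:R * (A + 1) ^+ 2).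
have K0 : 0 <= K' := normr_ge0 K.
have A0 : 0 <= A by rewrite mulr_ge0.
have [N hN] : exists N : nat, D <= N%:R.
  by exists (Num.bound D); apply/ltW/archi_boundP; rewrite !(mulr_ge0, addr_ge0, sqr_ge0).
have [s hs] := integral_box N; exists s => z iz hz; apply: hs => // i.
have zi : `|z 0 i| <= norm1 z by rewrite /norm1 (bigD1 i) //= lerDl sumr_ge0.
apply: le_trans zi (le_trans _ hN).
have le1 : norm1 z <= C * norm1 (z *m B) by have := hC (z *m B); rewrite mulmxK.
apply: (le_trans le1); rewrite ler_wpM2l //.
have amgm : 2 * (A + 1) * norm1 (z *m B) <= norm2 (z *m B) + n%:R * (A + 1) ^+ 2.
  have -> : n%:R * (A + 1) ^+ 2 = \sum_(j < n) (A + 1) ^+ 2.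
    by rewrite sumr_const card_ord mulr_natl.
  rewrite /norm2 dotE -big_split /= /norm1 mulr_sumr; apply: ler_sum => j _.
  have := sqr_ge0 (`|(z *m B) 0 j| - (A + 1)).
  rewrite -[X in _ <= X + _]expr2 -[X in _ <= X + _]real_normK ?num_real //.
  by rewrite !expr2; lra.
have le2 : norm2 (z *m B) <= K' + A * norm1 (z *m B).
  have : norm2 (z *m B) <= K' * (1 + norm1 z).
    have : K * (1 + norm1 z) <= K' * (1 + norm1 z).
      by rewrite ler_wpM2r ?ler_norm // addr_ge0 ?norm1_ge0.
    lra.
  have : K' * norm1 z <= K' * (C * norm1 (z *m B)) by exact: ler_wpM2l K0 _ _ le1.
  rewrite mulrDr mulr1 mulrA -/A; move: (A * _) (norm2 _) (K' * _) => a b c; lra.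
have := norm1_ge0 (z *m B); have := mulr_ge0 A0 (norm1_ge0 (z *m B)); move: amgm.
have -> : 2 * (A + 1) * norm1 (z *m B) = 2 * (A * norm1 (z *m B)) + 2 * norm1 (z *m B).
  by ring.
move: le2; move: (norm1 _) (norm2 _) (_ * _ ^+ 2) (A * _) => b c d a; lra.
Qed.

End Coercive.

(** * Cells of a sublattice: finiteness, minima and walks *)

Section Cells.
Variables (R : realType) (n : nat).
Local Notation V := 'rV[R]_n.
Implicit Types (b c g h q Q : V -> R) (S T X : set V).

Definition sublattice X := [/\ X `<=` @integral R n, X 0 &
  forall x y, X x -> X y -> X (x - y)].

Definition in_span X p := forall b, affine b -> kills X b -> b p = 0.

Definition quad q Q := affine (fun z => Q z - q z).

(* For [q z = |zB|^2], a function [Q] with [quad q Q] is the power of [zB] with respect to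
   a sphere. The sphere is empty when [Q] supports [X], and its Delaunay polytope, the hull
   of the zeros, has the dimension of [X] when the zeros are full. *)
Definition cell q X Q := [/\ quad q Q, supports X Q & full X (zeros X Q)].

(** The rows of [W] belong to [X] and span it, so nonnegativity of a function at their multiples
    controls its affine part along the span of [X]. *)
Lemma sublattice_coords X : sublattice X -> exists m (M : 'M[R]_(n, m)) (W : 'M[R]_(m, n)),
  (forall i, X (row i W)) /\ forall z, X z -> z *m M *m W = z.
Proof.
move=> [_ X0 _]; have [m [p [Xp _ hp]]] := max_indep X.
exists m, (pinvmx (\matrix_i p i)), (\matrix_i p i); split=> [i|z Xz].
  by rewrite rowK.
apply: mulmxKpV; rewrite submxE; apply/eqP/rowP => j; rewrite [RHS]mxE.
have mul_colE m' (u : 'rV[R]_n) (C : 'M_(n, m')) i : (u *m C) 0 i = dot u (col i C)^T.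
  by rewrite /dot trmxK colE mulmxA -colE [RHS]mxE.
rewrite mul_colE; apply: (hp _ (affine_dot _)) => // i.
have -> : p i = row i (\matrix_i p i) by rewrite rowK.
by rewrite -mul_colE -row_mul mulmx_coker !mxE.
Qed.

Lemma sublatticeN X x : sublattice X -> X x -> X (- x).
Proof. by move=> [_ X0 XB] Xx; rewrite -sub0r; apply: XB. Qed.

Lemma sublatticeD X x y : sublattice X -> X x -> X y -> X (x + y).
Proof.
move=> fX Xx Xy; rewrite -[y]opprK; have [_ _ XB] := fX.
by apply: XB => //; apply: sublatticeN.
Qed.

Lemma sublatticeMn X (k : nat) x : sublattice X -> X x -> X (k%:R *: x).
Proof.
move=> fX Xx; elim: k => [|k IH]; first by rewrite scale0r; case: fX.
by rewrite mulrS scalerDl scale1r; apply: sublatticeD.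
Qed.

Lemma in_span_self X x : X x -> in_span X x.
Proof. by move=> Xx b _ kb; apply: kb. Qed.

Lemma quad_refl q : quad q q.
Proof. by apply: (eq_affine (affine_cst 0)) => z; rewrite subrr. Qed.

Lemma quadD q Q b : quad q Q -> affine b -> quad q (fun z => Q z + b z).
Proof. by move=> qQ hb; rewrite /quad; apply: (eq_affine (affineD qQ hb)) => z; ring. Qed.

Lemma quadDZ q Q t b : quad q Q -> affine b -> quad q (fun z => Q z + t * b z).
Proof. by move=> qQ /(affineZ t); apply: quadD. Qed.

Lemma quadB q Q Q' : quad q Q -> quad q Q' -> affine (fun z => Q z - Q' z).
Proof. by move=> h1 h2; apply: (eq_affine (affineB h1 h2)) => z; ring. Qed.

Lemma quad_sublevel q Q b : coercive q -> quad q Q -> affine b ->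
  sublevel_finite (@integral R n) (fun z => Q z + b z).
Proof.
move=> cq qQ hb; have [K K0 hK] := affine_norm1 (affineD qQ hb).
apply: sublevel_finite_le (cq K) => z _.
have := hK z; rewrite ler_norml => /andP[h _]; lra.
Qed.

Lemma cell_unique q X Q Q' : cell q X Q -> quad q Q' -> zeros X Q `<=` zeros X Q' ->
  forall z, X z -> Q z = Q' z.
Proof.
move=> [qQ _ fQ] qQ' sub z Xz; apply/eqP; rewrite -subr_eq0; apply/eqP.
apply: (fQ _ (quadB qQ qQ')) => // y zy.
by rewrite (proj2 zy) (proj2 (sub _ zy)) subrr.
Qed.

Lemma eq_cell q X Q Q' : cell q X Q -> quad q Q' -> (forall z, X z -> Q' z = Q z) ->
  cell q X Q'.
Proof.
move=> [qQ sQ fQ] qQ' e; split=> // [z Xz|b hb kb]; first by rewrite e // sQ.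
by apply: fQ => // z [Xz Qz]; apply: kb; split=> //; rewrite e.
Qed.

(** Write [Q z = q z + dot z a + c]. Nonnegativity at [N] times a row of [W] and at its opposite
    bounds the slope along that row by [(c + D) / N], and [Q p <= C] then bounds [c]. So the affine
    part is bounded linearly on [X], and coercivity confines the zeros to a list independent of
    [Q]. *)
Lemma zeros_bounded q X p C : coercive q -> sublattice X -> in_span X p ->
  exists s : seq V, forall Q, quad q Q -> supports X Q -> Q p <= C ->
    forall z, zeros X Q z -> z \in s.
Proof.
move=> cq fX sp; have [Xi X0 XB] := fX; have [m [M [W [XW MW]]]] := sublattice_coords fX.
have pE : p *m M *m W = p.
  apply/rowP => i; apply/eqP; rewrite -subr_eq0; apply/eqP.
  have := sp (fun z => dot z (((M *m W - 1%:M) *m (delta_mx i 0)))^T) (affine_dot _).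
  have e z : dot z ((M *m W - 1%:M) *m delta_mx i 0)^T = (z *m M *m W) 0 i - z 0 i.
    by rewrite /dot trmxK mulmxA mulmxBr mulmx1 mulmxBl -!colE mulmxA !mxE.
  by rewrite e; apply => z Xz; rewrite e MW // subrr.
pose mu := p *m M.
have s0 := norm1_ge0 mu.
(* With [N] at least twice [norm1 mu], the slopes contribute at most [(c + D) / 2] at [p], so half
   of [c] remains to be bounded. *)
pose N := (Num.bound (2 * norm1 mu)).+1.
have N1 : 1 <= N%:R :> R by rewrite ler1n.
have Ns : 2 * norm1 mu <= N%:R.
  apply/ltW/(@lt_trans _ _ (Num.bound (2 * norm1 mu))%:R); last by rewrite ltr_nat.
  by apply: archi_boundP; rewrite mulr_ge0.
pose w i := N%:R *: row i W.
pose D := \sum_i (`|q (w i)| + `|q (- w i)|) + `|q 0|.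
have [CM CM0 hCM] := norm1_mulmx M.
pose K := 2 * (C - q p + D).
have [s hs] := cq (D + `|K| * CM); exists s => Q qQ sQ Qp z [Xz Qz].
have [a [c e]] := qQ; pose be i := dot (row i W) a.
have dotW u : dot (u *m M *m W) a = \sum_i (u *m M) 0 i * be i.
  by rewrite mulmx_sum_row dot_suml; apply: eq_bigr => i _; rewrite dotZl.
have D0 : 0 <= D by rewrite addr_ge0 // sumr_ge0 // => i _; rewrite addr_ge0.
have qwD i : `|q (w i)| + `|q (- w i)| <= D.
  rewrite /D (bigD1 i) //= -addrA lerDl addr_ge0 // sumr_ge0 // => j _.
  by rewrite addr_ge0.
have beN i : N%:R * `|be i| <= c + D.
  have Xw : X (w i) by apply: sublatticeMn.
  have h1 := sQ _ Xw; have h2 := sQ _ (sublatticeN fX Xw).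
  have e1 := e (w i); have e2 := e (- w i).
  rewrite dotNl in e2; rewrite dotZl -/(be i) in e1 e2.
  have := qwD i; have := ler_norm (q (w i)); have := ler_norm (q (- w i)).
  have := normr_ge0 (q (w i)); have := normr_ge0 (q (- w i)).
  by have [b0|b0] := ger0P (be i); rewrite ?mulrN; move: (N%:R * be i) h1 h2 e1 e2 => x; lra.
have cD : 0 <= c + D.
  have := e 0; rewrite dot0l => e0; have := sQ _ X0.
  have : `|q 0| <= D by rewrite lerDr sumr_ge0 // => i _; rewrite addr_ge0.
  have := ler_norm (q 0); lra.
have sumbe (u : 'rV_m) : N%:R * `|\sum_i u 0 i * be i| <= norm1 u * (c + D).
  rewrite (le_trans (ler_wpM2l _ (ler_norm_sum _ _ _))) //.
  rewrite mulr_sumr /norm1 mulr_suml; apply: ler_sum => i _.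
  by rewrite normrM mulrCA ler_wpM2l.
have cle : c <= 2 * (C - q p) + D.
  have := e p; rewrite -{3}pE dotW => ep.
  have := sumbe mu; rewrite -/mu in ep.
  set S := \sum_i _ in ep *.
  have h1 : - S <= `|S| by rewrite -normrN ler_norm.
  have h2 : 2 * norm1 mu * (c + D) <= N%:R * (c + D) by rewrite ler_wpM2r.
  move=> h3; have : N%:R * (2 * `|S|) <= N%:R * (c + D).
    by apply: le_trans h2; rewrite mulrCA -mulrA ler_wpM2l.
  rewrite ler_pM2l ?(lt_le_trans _ N1) //; lra.
have cK : c + D <= K by rewrite /K; lra.
apply: hs; first exact: Xi.
have := e z; rewrite Qz -{2}(MW z Xz) dotW; set S := \sum_i _ => eS.
have h1 : - S <= `|S| by rewrite -normrN ler_norm.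
have h2 : `|S| <= norm1 (z *m M) * (c + D).
  by apply: le_trans (sumbe _); rewrite ler_peMl.
have h3 : norm1 (z *m M) * (c + D) <= CM * norm1 z * `|K|.
  apply: ler_pM => //; first exact: norm1_ge0.
  exact: le_trans cK (ler_norm _).
have : 0 <= D * norm1 z by rewrite mulr_ge0 ?norm1_ge0.
have : 0 <= `|K| * CM by rewrite mulr_ge0.
have -> : (D + `|K| * CM) * (1 + norm1 z) = D + D * norm1 z + `|K| * CM + CM * norm1 z * `|K|.
  by ring.
by move: (CM * norm1 z * _) (`|K| * CM) (D * norm1 z) h3 => x y t; lra.
Qed.

(** A cell is determined on [X] by its zeros, which [zeros_bounded] confines to one list; the code
    is their characteristic function on it. *)
Lemma cell_code q X p C : coercive q -> sublattice X -> in_span X p ->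
  exists m (code : (V -> R) -> {ffun 'I_m -> bool}), forall Q Q',
    cell q X Q -> cell q X Q' -> Q p <= C -> Q' p <= C -> code Q = code Q' ->
    forall z, X z -> Q z = Q' z.
Proof.
move=> cq fX sp; have [s hs] := zeros_bounded C cq fX sp.
exists (size s), (fun Q => [ffun i => `[< zeros X Q (nth 0 s (val i)) >]]).
move=> Q Q' cQ cQ' Qp Q'p /ffunP e; apply: (cell_unique cQ); first by case: cQ'.
move=> z zz; have zs : z \in s by case: cQ => h1 h2 _; apply: (hs Q).
have si : (index z s < size s)%N by rewrite index_mem.
have := e (Ordinal si); rewrite !ffunE /= nth_index // => eb.
by apply/asboolP; rewrite -eb; apply/asboolP.
Qed.

Lemma min_cell q X p (Inv : (V -> R) -> Prop) (f : (V -> R) -> R) :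
  coercive q -> sublattice X -> in_span X p ->
  (forall Q, Inv Q -> cell q X Q /\ Q p <= f Q) ->
  (forall Q Q', (forall z, X z -> Q z = Q' z) -> quad q Q -> quad q Q' -> f Q = f Q') ->
  (exists Q, Inv Q) -> exists2 Q, Inv Q & forall Q', Inv Q' -> f Q <= f Q'.
Proof.
move=> cq fX sp hI hf [Q0 IQ0].
have [m [code hc]] := cell_code (f Q0) cq fX sp.
pose P k Q := [/\ Inv Q, f Q <= f Q0 & code Q = k].
(* The default 0 is harmless: the minimum is taken only over codes of admissible cells. *)
pose g k := if pselect (exists Q, P k Q) is left h then f (sval (cid h)) else 0.
have gE Q : Inv Q -> f Q <= f Q0 -> g (code Q) = f Q.
  move=> IQ le; rewrite /g; case: pselect => [h|[]]; last by exists Q.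
  case: (cid h) => Q' /= [IQ' le' e].
  have [cQ' lQ'] := hI _ IQ'; have [cQ lQ] := hI _ IQ.
  apply: hf; [|by case: cQ'|by case: cQ].
  by apply: hc e => //; [apply: le_trans le'|apply: le_trans le].
have [|k [_ [Q [IQ le e]] mc]] :=
    @seq_min R _ (enum {ffun 'I_m -> bool}) (fun k => exists Q, P k Q) g.
  by exists (code Q0); rewrite ?mem_enum //; exists Q0.
exists Q => // Q' IQ'; have [le'|/ltW le'] := leP (f Q') (f Q0); last exact: le_trans le'.
rewrite -gE // -(gE Q') // e; apply: mc; first by rewrite mem_enum.
by exists Q'.
Qed.

Lemma touch q X Q : coercive q -> X `<=` @integral R n -> (exists x, X x) ->
  quad q Q -> supports X Q -> exists2 t, 0 <= t &
    supports X (fun z => Q z + t * -1) /\ exists z, zeros X (fun z => Q z + t * -1) z.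
Proof.
move=> cq Xi [x Xx] qQ sQ.
have [||t [t0 st [z Xz [_ e]]]] := @hit R n X Q (fun=> -1) sQ.
- move=> t _; apply: sublevel_finite_sub Xi _; apply: (quad_sublevel cq qQ).
  exact: affine_cst.
- by exists x => //; rewrite ltrN10.
- by exists t => //; split=> //; exists z.
Qed.

(* A function vanishing at [x0] in X and not on X is negative somewhere on X:
   X is symmetric about [x0]. So at each step the sign of the direction of the
   walk can be chosen freely. *)
Lemma walk_lattice q X (ok : (V -> R) -> Prop) (Inv : (V -> R) -> Prop) Q :
  coercive q -> sublattice X -> (forall b, affine b -> ok b \/ ok (fun z => - b z)) ->
  (forall Q b t, Inv Q -> affine b -> ok b -> 0 <= t -> Inv (fun z => Q z + t * b z)) ->
  quad q Q -> supports X Q -> Inv Q -> (exists x, zeros X Q x) ->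
  exists Q', [/\ cell q X Q', Inv Q' & zeros X Q `<=` zeros X Q'].
Proof.
move=> cq fX okN okI qQ sQ IQ ex; have [Xi X0 XB] := fX.
have [|||Q' [[qQ' sQ' IQ' _] fQ' sub]] := @walk R n X
    (fun Q => [/\ quad q Q, supports X Q, Inv Q & exists x, zeros X Q x])
    (fun Q => full X (zeros X Q)) _ _ Q; last by exists Q'; split.
- move=> Q1 [qQ1 sQ1 _ _]; split=> // b hb.
  by apply: sublevel_finite_sub Xi _; apply: quad_sublevel cq qQ1 hb.
- move=> Q1 [qQ1 sQ1 IQ1 [x0 [Xx0 Qx0]]].
  have [fQ1|nf] := pselect (full X (zeros X Q1)); [by left|right].
  have [b [hb kb [x Xx bx]]] : exists b, [/\ affine b, kills (zeros X Q1) b &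
      exists2 x, X x & b x <> 0].
    apply: contrapT => h; apply: nf => b hb kb x Xx; apply: contrapT => bx.
    by apply: h; exists b; split=> //; exists x.
  have [c [hc kc okc cx]] : exists c, [/\ affine c, kills (zeros X Q1) c, ok c & c x <> 0].
    case: (okN b hb) => okb; first by exists b.
    exists (fun z => - b z); split=> //; first exact: affineN.
      by move=> z zz; rewrite kb // oppr0.
    by move=> /eqP; rewrite oppr_eq0 => /eqP.
  exists c; split=> //.
    have [cx0|cx0] := ltP (c x) 0; first by exists x.
    exists (x0 - x + x0); first by apply: sublatticeD => //; apply: XB.
    have [a [k e]] := hc; have := kc x0 (conj Xx0 Qx0); move: cx cx0.
    rewrite !e !dotDl dotNl => /eqP cx cx0.
    have : 0 < dot x a + k by rewrite lt_neqAle eq_sym cx.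
    lra.
  move=> t t0 st; split=> //; [exact: quadDZ|exact: okI|].
  by exists x0; split=> //; rewrite kc ?mulr0 ?addr0.
- by split.
Qed.

Lemma walk_cell q X Q : coercive q -> sublattice X -> quad q Q -> supports X Q ->
  (exists x, zeros X Q x) -> exists2 Q', cell q X Q' & zeros X Q `<=` zeros X Q'.
Proof.
move=> cq fX qQ sQ ex.
have [||Q' [cQ' _ sub]] := @walk_lattice q X (fun=> True) (fun=> True) Q cq fX _ _ qQ sQ I ex.
- by left.
- by [].
- by exists Q'.
Qed.

(** Directions are oriented with [0 <= b v], so [v] never becomes a zero. This yields a cell that
    contains the zeros of [Q] and avoids [v]. *)
Lemma walk_slack q X Q v : coercive q -> sublattice X -> quad q Q -> supports X Q ->
  (exists x, zeros X Q x) -> 0 < Q v ->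
  exists Q', [/\ cell q X Q', zeros X Q `<=` zeros X Q' & 0 < Q' v].
Proof.
move=> cq fX qQ sQ ex Qv.
have [||Q' [cQ' Qv' sub]] := @walk_lattice q X (fun b => 0 <= b v)
    (fun Q => 0 < Q v) Q cq fX _ _ qQ sQ Qv ex.
- by move=> b _; case: (lerP 0 (b v)) => [|/ltW]; [left|right; rewrite oppr_ge0].
- by move=> Q1 b t Qv1 _ bv t0; rewrite ltr_wpDr // mulr_ge0.
- by exists Q'.
Qed.

(** Each direction is oriented so that its sum over [s] is at most 0. With [s] empty this still
    produces a cell. *)
Lemma walk_descend q X Q (s : seq V) : coercive q -> sublattice X -> quad q Q ->
  supports X Q -> exists2 Q', cell q X Q' & \sum_(p <- s) Q' p <= \sum_(p <- s) Q p.
Proof.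
move=> cq fX qQ sQ; have [Xi X0 _] := fX.
have [t t0 [st ex]] := touch cq Xi (ex_intro _ _ X0) qQ sQ.
have sumD Q1 b k : \sum_(p <- s) (Q1 p + k * b p) =
    \sum_(p <- s) Q1 p + k * \sum_(p <- s) b p.
  by rewrite big_split /= mulr_sumr.
have le0 : \sum_(p <- s) (Q p + t * -1) <= \sum_(p <- s) Q p.
  by apply: ler_sum => p _; rewrite gerDl mulrN1 oppr_le0.
have [|||Q' [cQ' le _]] := @walk_lattice q X (fun b => \sum_(p <- s) b p <= 0)
    (fun Q' => \sum_(p <- s) Q' p <= \sum_(p <- s) Q p) (fun z => Q z + t * -1) cq fX _ _ _ st le0 ex.
- move=> b _; case: (lerP (\sum_(p <- s) b p) 0) => [|/ltW h]; [by left|right].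
  by rewrite sumrN oppr_le0.
- move=> Q1 b k le _ b0 k0; rewrite sumD (le_trans _ le) //.
  by rewrite gerDl mulr_ge0_le0.
- exact: quadDZ (affine_cst _).
- by exists Q'.
Qed.

End Cells.

(** * Layers, tilts and stretching *)

Section Layers.
Variables (R : realType) (n : nat).
Local Notation V := 'rV[R]_n.
Implicit Types (b c g q Q : V -> R) (S T X : set V) (h : V).

Lemma sublattice_integral : sublattice (@integral R n).
Proof.
split=> // [i|x y ix iy i]; first by rewrite mxE rpred0.
by rewrite !mxE rpredB ?ix ?iy.
Qed.

Definition layer h : set V := [set z | integral z /\ dot z h = 0].

Lemma sublattice_layer h : sublattice (layer h).
Proof.
have [_ i0 iB] := sublattice_integral.
split=> [z []//||x y [ix lx] [iy ly]]; first by split=> //; rewrite dot0l.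
by split; [apply: iB|rewrite dotBl lx ly subrr].
Qed.

Lemma integral_delta i : @integral R n (delta_mx 0 i).
Proof. by move=> j; rewrite mxE; apply/natr_int. Qed.

Lemma dot_delta i (v : V) : dot (delta_mx 0 i) v = v 0 i.
Proof.
rewrite dotE (bigD1 i) //= big1 => [|j ji]; first by rewrite mxE !eqxx mul1r addr0.
by rewrite mxE (negPf ji) andbF mul0r.
Qed.

Lemma in_span_integral p : in_span (@integral R n) p.
Proof.
move=> b [a [c e]] kb; have [_ i0 _] := sublattice_integral.
have c0 : c = 0 by have := kb 0 i0; rewrite e dot0l add0r.
rewrite e c0 addr0; suff -> : a = 0 by rewrite dot0r.
apply/rowP => i; rewrite mxE -dot_delta.
by have := kb _ (integral_delta i); rewrite e c0 addr0.
Qed.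

Lemma zeros_neq0 q X Q x : X x -> cell q X Q -> exists z, zeros X Q z.
Proof.
move=> Xx [_ _ fQ]; apply: contrapT => nz.
suff : (1 : R) = 0 by move/eqP; rewrite oner_eq0.
by apply: (fQ (fun=> 1) (affine_cst 1) _ x Xx) => z zz; case: nz; exists z.
Qed.

Lemma zeros_seq q X Q : coercive q -> X `<=` @integral R n -> quad q Q ->
  exists s : seq V, forall z, z \in s <-> zeros X Q z.
Proof.
move=> cq Xi qQ; have [s hs] := quad_sublevel cq qQ (affine_cst 0).
exists [seq z <- s | `[< zeros X Q z >]] => z; rewrite mem_filter.
split=> [/andP[/asboolP]//|zz]; apply/andP; split; first exact/asboolP.
by case: zz => Xz Qz; apply: hs; [exact: Xi|rewrite Qz addr0].
Qed.

Lemma sum_gt_term (T : eqType) (s : seq T) (F : T -> R) x :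
  (forall y, 0 <= F y) -> x \in s -> F x <= \sum_(y <- s) F y.
Proof.
move=> F0; elim: s => // a s IH; rewrite inE big_cons => /orP[/eqP->|/IH le].
  by rewrite lerDl sumr_ge0.
by rewrite (le_trans le) // lerDr.
Qed.

(* The cell of [Q] in the layer lies on an empty sphere of the whole lattice that touches
   no lattice point outside the layer: varying [k] moves the center orthogonally to it. *)
Definition good h Q := exists k, supports (@integral R n) (fun z => Q z + k * dot z h) /\
  forall z, integral z -> Q z + k * dot z h = 0 -> dot z h = 0.

Definition allgood q h := forall Q, cell q (layer h) Q -> good h Q.

(** The affine function agreeing with the squared height on the cell is [- a]. *)
Definition parabolic h Q := exists2 a, affine a &
  (forall z, integral z -> 0 <= dot z h ^+ 2 + a z) /\
  (forall z, integral z -> Q z = 0 -> dot z h ^+ 2 + a z = 0).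

Definition del q : set (set V) :=
  [set S | exists2 Q, cell q (@integral R n) Q & S = zeros (@integral R n) Q].

(* The squared length in the extended lattice, with [lam = eps * (2 + eps)]. *)
Definition stretch q h (lam : R) (z : V) := q z + lam * dot z h ^+ 2.

Lemma stretch_coercive q h lam : 0 <= lam -> coercive q -> coercive (stretch q h lam).
Proof.
move=> l0 cq K; apply: sublevel_finite_le (cq K) => z _.
by rewrite lerB // lerDl mulr_ge0 // sqr_ge0.
Qed.

(** All zeros lie on one side of the layer, so a small tilt lifts those outside it. *)
Lemma good_side q h Q s : coercive q -> quad q Q -> supports (@integral R n) Q ->
  s != 0 -> (forall z, integral z -> Q z = 0 -> 0 <= s * dot z h) -> good h Q.
Proof.
move=> cq qQ sQ s0 side.
have [||t t0 /(_ t)[|sup zz]] := @perturb R n (@integral R n) Q (fun z => s * dot z h) sQ.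
- by apply: quad_sublevel cq qQ _; apply/affineZ/affine_dot.
- exact: side.
- by rewrite t0 lexx.
exists (t * s); split=> [z iz|z iz]; first by rewrite -mulrA; apply: sup.
rewrite -mulrA => /(zz z iz)[_ /eqP]; by rewrite mulf_eq0 (negPf s0) => /eqP.
Qed.

Section Fixed.
Variables (q : V -> R) (h : V).
Hypothesis cq : coercive q.
Hypothesis shift_q : forall v, affine (fun z => q (z + v) - q z).
Hypothesis h_neq0 : h != 0.
Hypothesis span_layer : forall x, dot x h = 0 -> in_span (layer h) x.

Lemma quad_shift Q v : quad q Q -> quad q (fun z => Q (z + v)).
Proof.
move=> qQ; apply: (eq_affine (affineD (affine_shift v qQ) (shift_q v))) => z.
by rewrite addrA subrK.
Qed.

(** Functions in [quad q] that agree on the layer differ by a tilt, which [good] leaves free;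
    goodness is thus a property of the cell in the layer. *)
Lemma affine_layer b : affine b -> kills (layer h) b ->
  exists k, forall z, b z = k * dot z h.
Proof.
move=> hb kb; have hh : norm2 h != 0 by rewrite norm2_eq0.
exists (b h / norm2 h) => z.
have := @span_layer (z - (dot z h / norm2 h) *: h); rewrite dotBl dotZl divfK // subrr.
move=> /(_ erefl b hb kb).
have := span_layer (dot0l h) hb kb.
case: hb => a [c e]; rewrite !e dot0l add0r => c0.
rewrite c0 !addr0 dotBl dotZl => /eqP; rewrite subr_eq0 => /eqP ->.
by rewrite mulrAC [RHS]mulrAC (mulrC (dot z h)).
Qed.

Lemma exists_above : exists2 z, integral z & 0 < dot z h.
Proof.
have /rV0Pn [i hi] := h_neq0; have [h0|h0] := ltP 0 (h 0 i).
  by exists (delta_mx 0 i); [exact: integral_delta|rewrite dot_delta].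
exists (- delta_mx 0 i); first exact: sublatticeN sublattice_integral (integral_delta i).
by rewrite dotNl dot_delta oppr_gt0 lt_neqAle hi.
Qed.

(* The Delaunay cell on top of the cell of the layer cut out by [Q]. *)
Lemma tip q' Q : coercive q' -> quad q' Q -> supports (@integral R n) Q ->
  full (layer h) (zeros (layer h) Q) ->
  (forall z, integral z -> Q z = 0 -> dot z h = 0) ->
  exists2 t, 0 <= t & cell q' (@integral R n) (fun z => Q z - t * dot z h) /\
    forall z, integral z -> Q z - t * dot z h = 0 -> 0 <= dot z h.
Proof.
move=> cq' qQ sQ fQ flat; have [w iw hw] := exists_above.
have hl : affine (fun z => - dot z h) by apply/affineN/affine_dot.
have [||t [t0 st [u iu [/= hu Qu]]]] := @hit R n (@integral R n) Q (fun z => - dot z h) sQ.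
- by move=> t _; apply: quad_sublevel cq' qQ _; apply: affineZ.
- by exists w => //; rewrite oppr_lt0.
rewrite oppr_lt0 in hu.
have e z : Q z - t * dot z h = Q z + t * - dot z h by rewrite mulrN.
exists t => //; split.
  split.
  - by apply: (eq_affine (quadDZ t qQ hl)) => z; rewrite e.
  - by move=> z iz; rewrite e; apply: st.
  - move=> b hb kb.
    (* The zeros in the layer leave only multiples of the height, and the zero [u] above the layer
       excludes these. *)
    have [k bk] : exists k, forall z, b z = k * dot z h.
      apply: affine_layer => //; apply: fQ => // z [[iz lz] Qz]; apply: kb; split=> //.
      by rewrite lz Qz mulr0 subr0.
    have : b u = 0 by apply: kb; split=> //; rewrite e.
    move/eqP; rewrite bk mulf_eq0 (gt_eqF hu) orbF => /eqP k0 z _.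
    by rewrite bk k0 mul0r.
move=> z iz Qz; rewrite leNgt; apply/negP => lz.
have Qz0 := sQ z iz; have tl : t * dot z h <= 0 by rewrite mulr_ge0_le0 // ltW.
have Q0 : Q z = 0 by apply/eqP; rewrite eq_le Qz0 andbT; lra.
by have := flat z iz Q0 => l0; rewrite l0 ltxx in lz.
Qed.

(** Translate [v] to 0; the segment from [u] to [w] then crosses the layer's hyperplane at a point
    [x]. Let [P] be the cell of the layer least at [x]. Suitably tilted, it is positive at both ends
    of the segment, where the translated [Q] vanishes, so [Q] lies below [P] at [x]; this
    contradicts minimality. *)
Lemma two_layers Q : allgood q h -> cell q (@integral R n) Q -> forall u v w,
  zeros (@integral R n) Q u -> zeros (@integral R n) Q w -> integral v ->
  dot u h < dot v h -> dot v h < dot w h -> False.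
Proof.
move=> ag cQ u v w [iu Qu] [iw Qw] iv luv lvw.
have [iI i0 iB] := sublattice_integral; have sL := sublattice_layer h.
have [lI l0 _] := sL.
pose Q1 z := Q (z + v).
have qQ1 : quad q Q1 by apply: quad_shift; case: cQ.
have sQ1 : supports (@integral R n) Q1.
  by move=> z iz; case: cQ => _ sQ _; apply/sQ/(sublatticeD sublattice_integral).
pose u1 := u - v; pose w1 := w - v.
have iu1 : integral u1 by apply: iB. have iw1 : integral w1 by apply: iB.
have lu1 : dot u1 h < 0 by rewrite dotBl subr_lt0.
have lw1 : 0 < dot w1 h by rewrite dotBl subr_gt0.
have Qu1 : Q1 u1 = 0 by rewrite /Q1 subrK.
have Qw1 : Q1 w1 = 0 by rewrite /Q1 subrK.
pose s := - dot u1 h / (dot w1 h - dot u1 h); pose x := (1 - s) *: u1 + s *: w1.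
have den : 0 < dot w1 h - dot u1 h by rewrite subr_gt0 (lt_trans lu1).
have s_gt0 : 0 < s by rewrite divr_gt0 // oppr_gt0.
have s_lt1 : s < 1 by rewrite ltr_pdivrMr // mul1r; lra.
have lx : dot x h = 0.
  have : s * (dot w1 h - dot u1 h) = - dot u1 h by rewrite divfK // gt_eqF.
  rewrite mulrBr => e; rewrite /x dotDl !dotZl mulrBl mul1r.
  by move: (s * dot w1 h) (s * dot u1 h) e => a b; lra.
have [P cP minP] : exists2 P, cell q (layer h) P &
    forall P', cell q (layer h) P' -> P x <= P' x.
  apply: (min_cell (p := x) (Inv := cell q (layer h)) (f := fun P => P x) cq sL).
  - exact: span_layer.
  - by move=> P cP.
  - move=> P P' e qP qP'; apply/eqP; rewrite -subr_eq0; apply/eqP.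
    by apply: (span_layer lx (quadB qP qP')) => z lz; rewrite e // subrr.
  - have [|P cP _] := walk_descend [::] cq sL qQ1; last by exists P.
    by move=> z /lI; apply: sQ1.
have [qP sP _] := cP.
have [k [sk zk]] := ag P cP.
pose b z := Q1 z - (P z + k * dot z h).
have hb : affine b.
  by apply: (quadB qQ1); apply: quadDZ qP _; apply: affine_dot.
have bneg z : integral z -> dot z h != 0 -> Q1 z = 0 -> b z < 0.
  move=> iz lz Q1z; rewrite /b Q1z sub0r oppr_lt0 lt_neqAle sk // andbT.
  by apply/eqP => /esym /(zk z iz) /eqP; rewrite (negPf lz).
have bu : b u1 < 0 by apply: bneg => //; rewrite lt_eqF.
have bw : b w1 < 0 by apply: bneg => //; rewrite gt_eqF.
have bx : b x < 0.
  have -> : b x = (1 - s) * b u1 + s * b w1 by exact: affine_mid.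
  by rewrite -[ltRHS]addr0 ltrD // pmulr_rlt0 // subr_gt0.
(* On the zeros of [P], [b] equals [Q1] and is nonnegative, so [P] can be moved towards [Q1]; this
   lowers its value at [x]. *)
have [||t t0 /(_ t)[|st _]] := @perturb R n (layer h) P b sP.
- by apply: sublevel_finite_sub lI _; apply: quad_sublevel cq qP hb.
- by move=> z lz Pz; rewrite /b Pz (proj2 lz) mulr0 addr0 subr0; apply/sQ1/lI.
- by rewrite t0 lexx.
have [P' cP'] := walk_descend [:: x] cq sL (quadDZ t qP hb) st.
rewrite !big_seq1; apply/negP; rewrite -ltNge.
by apply: lt_le_trans (minP _ cP'); rewrite gtrDl pmulr_rlt0.
Qed.

(** The quadratic is the product of [dot z h - dot u h] and [dot z h - dot w h] for a lowest vertex
    [u] and a highest vertex [w] of the cell. By [two_layers] no lattice height lies strictly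
    between theirs, which gives the signs. *)
Lemma allgood_parabolic Q : allgood q h -> cell q (@integral R n) Q -> parabolic h Q.
Proof.
move=> ag cQ; have [iI i0 iB] := sublattice_integral.
have tl := two_layers ag cQ.
have [s hs] := zeros_seq cq iI (let: And3 x _ _ := cQ in x).
have [z0 /hs z0s] := zeros_neq0 i0 cQ.
have [|u [us _ umin]] := @seq_min R _ s (fun=> True) (fun z => dot z h); first by exists z0.
have [|w [ws _ wmax]] := @seq_min R _ s (fun=> True) (fun z => - dot z h); first by exists z0.
have zu := proj1 (hs u) us; have zw := proj1 (hs w) ws.
pose a z := - (dot u h + dot w h) * dot z h + dot u h * dot w h.
have e z : dot z h ^+ 2 + a z = (dot z h - dot u h) * (dot z h - dot w h).
  by rewrite /a; ring.
exists a; first exact: affineD (affineZ _ (affine_dot h)) (affine_cst _).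
have pos z : integral z -> 0 <= dot z h ^+ 2 + a z.
  move=> iz; rewrite e; have [lu|lu] := leP (dot z h) (dot u h).
    have uw : dot u h <= dot w h by have := wmax u us I; rewrite lerN2.
    by rewrite mulr_le0 ?subr_le0 // (le_trans lu).
  rewrite mulr_ge0 ?subr_ge0 ?(ltW lu) // leNgt; apply/negP => lw.
  exact: tl zu zw iz lu lw.
split=> // z iz Qz; apply/eqP; rewrite eq_le pos // andbT e.
have zs : z \in s by apply/hs.
rewrite mulr_ge0_le0 ?subr_ge0 ?subr_le0 ?umin //.
by have := wmax z zs I; rewrite lerN2.
Qed.

(** Adding [lam] times the parabolic function lifts a cell of [q] without changing its zeros.
    Conversely, a cell [Q] of the stretched form is matched with the cell [D] of [q] whose sum over
    the zeros of [Q] is least: unless the lift [D'] vanishes on these zeros, moving [D] along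
    [Q - D'] would lower the sum. *)
Lemma del_stretch lam : (forall Q, cell q (@integral R n) Q -> parabolic h Q) ->
  0 <= lam -> del (stretch q h lam) = del q.
Proof.
move=> par lam0; have [iI i0 iB] := sublattice_integral.
have sI := sublattice_integral.
have lift Q : cell q (@integral R n) Q -> exists Q', [/\ quad (stretch q h lam) Q',
    supports (@integral R n) Q', forall z, integral z -> Q' z = 0 <-> Q z = 0 &
    forall z, integral z -> Q z <= Q' z].
  move=> cQ; have [a ha [pos zer]] := par Q cQ; have [qQ sQ fQ] := cQ.
  have pos' z : integral z -> 0 <= lam * (dot z h ^+ 2 + a z).
    by move=> iz; rewrite mulr_ge0 // pos.
  exists (fun z => Q z + lam * (dot z h ^+ 2 + a z)); split.
  - by apply: (eq_affine (affineD qQ (affineZ lam ha))) => z; rewrite /stretch; ring.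
  - by move=> z iz; rewrite addr_ge0 ?sQ ?pos'.
  - move=> z iz; split=> [/eqP|Qz]; last by rewrite Qz zer // mulr0 addr0.
    by rewrite paddr_eq0 ?sQ ?pos' // => /andP[/eqP].
  - by move=> z iz; rewrite lerDl pos'.
apply/seteqP; split=> S [Q cQ ->]; last first.
  have [Q' [qQ' sQ' zQ' _]] := lift Q cQ.
  have zz : zeros (@integral R n) Q = zeros (@integral R n) Q'.
    by apply/seteqP; split=> z [iz /(zQ' z iz)].
  by exists Q' => //; split=> //; rewrite -zz; case: cQ.
have cl := stretch_coercive h lam0 cq.
have [qQ sQ fQ] := cQ.
have [s hs] := zeros_seq cl iI qQ.
have [p zp] := zeros_neq0 i0 cQ.
have ps : p \in s by apply/hs.
have [D cD minD] : exists2 D, cell q (@integral R n) D &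
    forall D', cell q (@integral R n) D' -> \sum_(z <- s) D z <= \sum_(z <- s) D' z.
  apply: (min_cell (p := p) (f := fun D => \sum_(z <- s) D z) cq sI).
  - exact: in_span_integral.
  - move=> D cD; split=> //; have [_ sD _] := cD.
    have -> : \sum_(z <- s) D z = \sum_(z <- s) `|D z|.
      by apply: eq_big_seq => z /hs [iz _]; rewrite ger0_norm // sD.
    by apply: le_trans (ler_norm _) (@sum_gt_term _ s (fun z => `|D z|) p _ ps).
  - by move=> D D' e _ _; apply: eq_big_seq => z /hs [iz _]; apply: e.
  - have [D cD _] : exists2 D, cell q (@integral R n) D & True; last by exists D.
    have [s0 hs0] := quad_sublevel cq (quad_refl q) (affine_cst 0).
    have [||D cD _] := walk_descend (Q := fun z => q z + \sum_(y <- s0) `|q y|) [::] cq sI.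
    + exact: quadD (quad_refl q) (affine_cst _).
    + move=> z iz; have [qz|qz] := ltP (q z) 0; last by rewrite addr_ge0 ?sumr_ge0.
      have zs0 : z \in s0 by apply: hs0; rewrite ?addr0 ?(ltW qz).
      have := @sum_gt_term _ s0 (fun y => `|q y|) z (fun y => normr_ge0 _) zs0.
      by rewrite /= ltr0_norm //; lra.
    + by exists D.
have [D' [qD' sD' zD' leD']] := lift D cD; have [qD sD fD] := cD.
pose b z := Q z - D' z; have hb : affine b by apply: quadB qQ qD'.
have [||t t0 /(_ t)[|st _]] := @perturb R n (@integral R n) D b sD.
- exact: quad_sublevel cq qD hb.
- by move=> z iz Dz; rewrite /b (proj2 (zD' z iz) Dz) subr0 sQ.
- by rewrite t0 lexx.
have [D2 cD2] := walk_descend s cq sI (quadDZ t qD hb) st.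
move/(le_trans (minD _ cD2)); rewrite big_split /= lerDl -mulr_sumr pmulr_rge0 //.
have -> : \sum_(z <- s) b z = - \sum_(z <- s) `|D' z|.
  rewrite -sumrN; apply: eq_big_seq => z /hs [iz Qz].
  by rewrite /b Qz sub0r ger0_norm // sD'.
rewrite oppr_ge0 => le0; exists D => //.
have sub : zeros (@integral R n) Q `<=` zeros (@integral R n) D'.
  move=> z zz; split; first by case: zz.
  apply/eqP; rewrite -normr_le0; apply: le_trans le0.
  by apply: (@sum_gt_term _ s (fun z => `|D' z|)) => //; apply/hs.
have e := cell_unique cQ qD' sub.
apply/seteqP; split=> z [iz Qz]; split=> //; first by apply/(zD' z iz); rewrite -e.
by rewrite e //; apply/(zD' z iz).
Qed.

(** For large [lam] the stretched [Q] is positive off the layer, so [tip] puts a full cell on one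
    side of the layer. Its zeros also form a cell of [q], which makes [Q] good by [good_side]. *)
Lemma del_stretch_allgood :
  (forall lam, 0 <= lam -> del (stretch q h lam) = del q) -> allgood q h.
Proof.
move=> dl Q cQ; have [iI i0 iB] := sublattice_integral.
have sL := sublattice_layer h; have [lI l0 _] := sL.
have [qQ sQ fQ] := cQ.
have [s hs] := quad_sublevel cq qQ (affine_cst 0).
(* [F z] is the amount needed at [z]; the sum covers the finitely many points with [Q z <= 0], and
   the extra 1 makes the inequality strict. *)
pose F z := `|Q z| / dot z h ^+ 2; pose lam := \sum_(z <- s) F z + 1.
have F0 z : 0 <= F z by rewrite divr_ge0 // sqr_ge0.
have lam0 : 0 <= lam by rewrite addr_ge0 // sumr_ge0.
pose Q1 z := Q z + lam * dot z h ^+ 2.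
have pos z : integral z -> dot z h != 0 -> 0 < Q1 z.
  move=> iz lz; have l2 : 0 < dot z h ^+ 2 by rewrite exprn_even_gt0.
  have [Qz|Qz] := ltP 0 (Q z); first by rewrite ltr_pwDl // mulr_ge0 // ltW.
  have zs : z \in s by apply: hs; rewrite ?addr0.
  have := sum_gt_term F0 zs; rewrite /F ler_pdivrMr // ler0_norm // => le.
  by rewrite /Q1 mulrDl mul1r; lra.
have onl z : dot z h = 0 -> Q1 z = Q z by move=> lz; rewrite /Q1 lz expr0n mulr0 addr0.
have zl : zeros (layer h) Q1 = zeros (layer h) Q.
  by apply/seteqP; split=> z [[iz lz] e]; split=> //; rewrite -e onl.
have cl := stretch_coercive h lam0 cq.
have [||||t t0 [cQ2 side]] := @tip (stretch q h lam) Q1 cl.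
- by apply: (eq_affine qQ) => z; rewrite /stretch /Q1; ring.
- move=> z iz; have [lz|lz] := eqVneq (dot z h) 0; last exact/ltW/pos.
  by rewrite onl //; apply: sQ.
- by rewrite zl.
- by move=> z iz Qz; apply/eqP/negPn/negP => /(pos z iz); rewrite Qz ltxx.
have : del q (zeros (@integral R n) (fun z => Q1 z - t * dot z h)).
  by rewrite -(dl lam lam0); exists (fun z => Q1 z - t * dot z h).
move=> [Q3 [qQ3 sQ3 fQ3] zQ3].
have z3 z : integral z -> Q3 z = 0 -> Q1 z - t * dot z h = 0.
  by move=> iz Qz; have : zeros (@integral R n) Q3 z by []; rewrite -zQ3 => -[].
have [k ek] : exists k, forall z, Q3 z - Q z = k * dot z h.
  apply: affine_layer; first exact: quadB qQ3 qQ.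
  apply: fQ; first exact: quadB qQ3 qQ.
  move=> z [[iz lz] Qz]; rewrite Qz subr0.
  suff : zeros (@integral R n) Q3 z by case.
  by rewrite -zQ3; split=> //; rewrite onl // lz Qz mulr0 subr0.
have [|k' [sk zk]] := good_side (h := h) cq qQ3 sQ3 (oner_neq0 R).
  by move=> z iz Q3z; rewrite mul1r; apply: side => //; apply: z3.
have e z : Q z + (k + k') * dot z h = Q3 z + k' * dot z h.
  by rewrite mulrDl -ek; ring.
by exists (k + k'); split=> z iz; rewrite e; [apply: sk|apply: zk].
Qed.

End Fixed.
End Layers.

(** * Dimension, convex hulls and faces *)

Section Dimension.
Variables (R : realType) (n : nat).
Local Notation V := 'rV[R]_n.
Implicit Types (b c g q Q : V -> R) (S T X : set V) (p x : V).

Lemma affdim_rank S p m (A : 'M[R]_(m, n)) k :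
  affine_hull S = [set x | (x - p <= A)%MS] -> affdim S k <-> \rank A = k.
Proof.
move=> hS; split=> [[p' [w [free e]]]|<-].
  pose W := \matrix_i w i.
  have WE t : \sum_i t i *: w i = (\row_i t i) *m W.
    by rewrite mulmx_sum_row; apply: eq_bigr => i _; rewrite rowK mxE.
  have rW : \rank W = k.
    apply/eqP; apply: inj_row_free => v vW; apply/rowP => i; rewrite mxE.
    apply: (free (fun i => v 0 i)); rewrite WE -[RHS]vW; congr (_ *m _).
    by apply/rowP => j; rewrite mxE.
  have hE x : (x - p <= A)%MS <-> (x - p' <= W)%MS.
    have -> : (x - p <= A)%MS = affine_hull S x :> Prop by rewrite hS.
    rewrite e; split=> [[t ->]|/submxP[t xt]].
      by rewrite addrAC subrr add0r WE submxMl.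
    exists (fun i => t 0 i); rewrite WE -[LHS](subrK p') xt addrC; congr (_ + _ *m _).
    by apply/rowP => j; rewrite mxE.
  have ppA : (p' - p <= A)%MS by apply/hE; rewrite subrr sub0mx.
  rewrite -rW; apply/eqP; rewrite eqn_leq; apply/andP; split; apply: mxrankS;
    apply/row_subP => i.
    have h1 : (p + row i A - p' <= W)%MS by apply/hE; rewrite addrAC subrr add0r row_sub.
    have h2 : (p - p' <= W)%MS by apply/hE; rewrite subrr sub0mx.
    have -> : row i A = (p + row i A - p') + (-1) *: (p - p').
      by rewrite scaleN1r opprB addrA subrK addrAC subrr add0r.
    by rewrite addmx_sub // scalemx_sub.
  have h1 : (p' + row i W - p <= A)%MS by apply/hE; rewrite addrAC subrr add0r row_sub.
  have -> : row i W = (p' + row i W - p) + (-1) *: (p' - p).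
    by rewrite scaleN1r opprB addrA subrK addrAC subrr add0r.
  by rewrite addmx_sub // scalemx_sub.
exists p, (fun i => row i (row_base A)).
have WE t : \sum_i t i *: row i (row_base A) = (\row_i t i) *m row_base A.
  by rewrite mulmx_sum_row; apply: eq_bigr => i _; rewrite mxE.
split=> [t|].
  rewrite WE => /eqP; rewrite mulmx_free_eq0 ?row_base_free // => /eqP/rowP t0 i.
  by have := t0 i; rewrite !mxE.
rewrite hS; apply/seteqP; split=> x /=.
  rewrite -(eq_row_base A) => /submxP [t xt]; exists (fun i => t 0 i).
  rewrite WE -[LHS](subrK p) xt addrC; congr (_ + _ *m _).
  by apply/rowP => j; rewrite mxE.
move=> [t ->]; rewrite addrAC subrr add0r WE -(eq_row_base A); exact: submxMl.
Qed.

Lemma eq_affdim S T k : affine_hull S = affine_hull T -> affdim S k -> affdim T k.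
Proof. by rewrite /affdim => ->. Qed.

Lemma sub_hull S : S `<=` affine_hull S.
Proof. by move=> x Sx; apply/hullP => b _ kb; apply: kb. Qed.

Lemma affdim_full S : affdim S n <-> affine_hull S = setT.
Proof.
split=> [[p [w [free ->]]]|e]; last first.
  apply/(@affdim_rank S 0 _ (1%:M : 'M[R]_n)); last exact: mxrank1.
  by rewrite e; apply/seteqP; split=> x //= _; rewrite submx1.
pose W := \matrix_i w i.
have WE t : \sum_i t i *: w i = (\row_i t i) *m W.
  by rewrite mulmx_sum_row; apply: eq_bigr => i _; rewrite rowK mxE.
have uW : W \in unitmx.
  rewrite -row_free_unit; apply: inj_row_free => v vW; apply/rowP => i; rewrite mxE.
  apply: (free (fun i => v 0 i)); rewrite WE -[RHS]vW; congr (_ *m _).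
  by apply/rowP => j; rewrite mxE.
apply/seteqP; split=> x //= _; exists (fun i => ((x - p) *m invmx W) 0 i); rewrite WE.
rewrite (_ : (\row_i _) = (x - p) *m invmx W); first by rewrite mulmxKV // addrC subrK.
by apply/rowP => j; rewrite mxE.
Qed.

Lemma conv_self S : S `<=` conv S.
Proof.
move=> x Sx; exists 1%N, (fun=> x), (fun=> 1); split=> //; split=> // .
by rewrite !big_ord1 scale1r.
Qed.

Lemma conv_mono S T : S `<=` T -> conv S `<=` conv T.
Proof. by move=> ST x [k [p [w [Sp h]]]]; exists k, p, w; split=> // i; apply: ST. Qed.

Lemma conv_sub_hull S : conv S `<=` affine_hull S.
Proof. by move=> x [k [p [w [Sp [_ h]]]]]; exists k, p, w. Qed.

Lemma hull_conv S : affine_hull (conv S) = affine_hull S.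
Proof.
apply/seteqP; split=> x /hullP h; apply/hullP => b hb kb; apply: h => // z Sz.
  by move/conv_sub_hull: Sz => /hullP; apply.
exact/kb/conv_self.
Qed.

(** The weighted sum of the squared distances from the points to their combination [m] is
    [r - norm2 (m - o)], and it is nonnegative. *)
Lemma conv_ball S (o : V) r : (forall y, S y -> norm2 (y - o) = r) ->
  forall y, conv S y -> norm2 (y - o) <= r.
Proof.
move=> sph _ [k [p [w [Sp [w0 [w1 ->]]]]]].
pose m := \sum_i w i *: p i.
have e : \sum_i w i * norm2 ((p i - o) - (m - o)) = r - norm2 (m - o).
  under eq_bigr do rewrite norm2B sph // mulrDr mulrBr.
  rewrite big_split /= sumrB -!mulr_suml w1 !mul1r.
  have -> : \sum_i w i * (2 * dot (p i - o) (m - o)) = 2 * dot (m - o) (m - o).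
    have -> : dot (m - o) (m - o) = \sum_i w i * dot (p i - o) (m - o).
      rewrite [X in dot X _](_ : m - o = \sum_i w i *: (p i - o)).
        by rewrite dot_suml; apply: eq_bigr => i _; rewrite dotZl.
      by under eq_bigr do rewrite scalerBr; rewrite sumrB -scaler_suml w1 scale1r.
    by rewrite mulr_sumr; apply: eq_bigr => i _; rewrite mulrCA.
  by rewrite /norm2; lra.
rewrite -subr_ge0 -e; apply: sumr_ge0 => i _; by rewrite mulr_ge0 ?norm2_ge0.
Qed.

Lemma conv_support S a k y : (forall x, S x -> dot a x <= k) -> conv S y -> dot a y <= k.
Proof.
move=> le [m [p [w [Sp [w0 [w1 ->]]]]]]; rewrite dotC dot_suml -[k]mul1r -w1 mulr_suml.
by apply: ler_sum => i _; rewrite dotZl dotC ler_wpM2l // le.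
Qed.

Lemma conv_face S a k y : (forall x, S x -> dot a x <= k) -> conv S y -> dot a y = k ->
  conv (S `&` [set x | dot a x = k]) y.
Proof.
move=> le [m [p [w [Sp [w0 [w1 ->]]]]]]; rewrite dotC dot_suml => e.
have tight i : w i != 0 -> dot a (p i) = k.
  move=> wi; have : \sum_i w i * (k - dot a (p i)) = 0.
    under eq_bigr do rewrite mulrBr; rewrite sumrB -mulr_suml w1 mul1r -[X in X - _]e.
    apply/eqP; rewrite subr_eq0; apply/eqP; apply: eq_bigr => j _.
    by rewrite dotZl (dotC a).
  move/eqP; rewrite psumr_eq0 => [/allP/(_ i)|j _]; last first.
    by rewrite mulr_ge0 ?subr_ge0 ?le.
  by rewrite mem_index_enum mulf_eq0 (negPf wi) subr_eq0 /= => /(_ isT)/eqP.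
have [i0 wi0] : exists i0, w i0 != 0.
  apply: contrapT => h; move: w1; rewrite big1 => [/esym/eqP|i _].
    by rewrite oner_eq0.
  by apply/eqP/negPn/negP => wi; apply: h; exists i.
(* Points of weight 0 need not lie on the face; [p i0], which does, replaces them. *)
exists m, (fun i => if w i == 0 then p i0 else p i), w; split=> [i|].
  by case: eqP => [_|/eqP wi]; split=> //=; apply: tight.
split=> //; split=> //; apply: eq_bigr => i _.
by case: eqP => // ->; rewrite !scale0r.
Qed.

End Dimension.

(** * Delaunay polytopes in integer coordinates, and laminae *)

Section Lattice.
Variables (R : realType) (n : nat).
Local Notation V := 'rV[R]_n.
Implicit Types (b c g Q : V -> R) (S T X : set V) (x y z : V).

Definition sqlen (B : 'M[R]_n) z := norm2 (z *m B).

Lemma affine_mulmx b (M : 'M[R]_n) : affine b -> affine (fun z => b (z *m M)).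
Proof. by move=> [a [k e]]; exists (a *m M^T), k => z; rewrite e dot_mulmxl. Qed.

Lemma sqlen_shift B v : affine (fun z => sqlen B (z + v) - sqlen B z).
Proof.
have h := affineD (affineZ 2 (affine_mulmx B (affine_dot (v *m B)))) (affine_cst (sqlen B v)).
by apply: (eq_affine h) => z; rewrite /sqlen mulmxDl norm2D; ring.
Qed.

Variable B : 'M[R]_n.
Hypothesis uB : B \in unitmx.
Let q := sqlen B.

Lemma quad_sphere Q : quad q Q ->
  exists o r, forall z, Q z = norm2 (z *m B - o) - r.
Proof.
move=> [a [k e]]; pose o := (- 2^-1) *: (a *m (invmx B)^T).
exists o, (norm2 o - k) => z.
have -> : Q z = q z + (dot z a + k) by rewrite -e addrC subrK.
rewrite norm2B /o dotZr dot_mulmxl -mulmxA -trmx_mul mulmxV // trmx1 mulmx1.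
by rewrite /q /sqlen; field.
Qed.

Lemma sphere_quad o r : quad q (fun z => norm2 (z *m B - o) - r).
Proof.
have h := affineD (affineZ (-2) (affine_mulmx B (affine_dot o))) (affine_cst (norm2 o - r)).
by apply: (eq_affine h) => z; rewrite /q /sqlen norm2B; ring.
Qed.

Lemma kills_full (I : set V) S : affine_hull S = affine_hull [set z *m B | z in I] ->
  full I [set z | S (z *m B)].
Proof.
move=> e b hb kb z Iz.
have hb' := affine_mulmx (invmx B) hb.
have : affine_hull S (z *m B) by rewrite e; apply: sub_hull; exists z.
move=> /hullP /(_ _ hb'); rewrite mulmxK //; apply => y Sy.
by apply: kb; rewrite /= mulmxKV.
Qed.

Lemma full_hull (I : set V) S : full I [set z | S (z *m B)] ->
  affine_hull [set z *m B | z in I] `<=` affine_hull S.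
Proof.
move=> fS x /hullP hx; apply/hullP => b hb kb; apply: hx => // y [z Iz <-].
by apply: (fS (fun z => b (z *m B))) => //; [exact: affine_mulmx|move=> w; apply: kb].
Qed.

Lemma hull_lattice : affine_hull (lattice_of B) = setT.
Proof.
apply/seteqP; split=> x //= _; apply/hullP => b hb kb.
have := @in_span_integral R n (x *m invmx B) _ (affine_mulmx B hb).
by rewrite mulmxKV //; apply => z iz; apply: kb; exists z.
Qed.

Lemma lattice_image : lattice_of B = [set z *m B | z in @integral R n].
Proof. by apply/seteqP; split=> x [z]; [move=> [iz ->]; exists z|move=> iz <-; exists z]. Qed.

Lemma latticeP z : lattice_of B (z *m B) <-> integral z.
Proof.
split=> [[y [iy e]]|iz]; last by exists z.
by rewrite -(mulmxK uB z) e mulmxK.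
Qed.

Lemma sphere_affdim_full o r : 
  affdim (lattice_of B `&` [set v | norm2 (v - o) = r]) n <->
  full (@integral R n) (zeros (@integral R n) (fun z => norm2 (z *m B - o) - r)).
Proof.
have zE : zeros (@integral R n) (fun z => norm2 (z *m B - o) - r) =
    [set z | (lattice_of B `&` [set v | norm2 (v - o) = r]) (z *m B)].
  apply/seteqP; split=> z [].
    by move=> iz /eqP; rewrite subr_eq0 => /eqP e; split=> //; apply/latticeP.
  by move=> /latticeP iz /= e; split=> //; rewrite e subrr.
rewrite affdim_full zE; split=> [e|f].
  by apply: kills_full; rewrite e -lattice_image hull_lattice.
have := full_hull f; rewrite -lattice_image hull_lattice => sub.
by apply/seteqP; split.
Qed.

Lemma delaunay_full P : delaunay_in setT (lattice_of B) n P <->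
  exists o r, cell q (@integral R n) (fun z => norm2 (z *m B - o) - r) /\
    P = conv (lattice_of B `&` [set v | norm2 (v - o) = r]).
Proof.
split=> [[o [r [_ [le [-> /sphere_affdim_full f]]]]]|[o [r [[_ s /sphere_affdim_full f] ->]]]].
  exists o, r; split=> //; split=> // [|z iz]; first exact: sphere_quad.
  by rewrite subr_ge0; apply: le; apply/latticeP.
exists o, r; split=> //; split=> // v [z [iz ->]].
by have := s z iz; rewrite subr_ge0.
Qed.

Variable e : V.
Hypothesis ne : norm2 e = 1.
Let h := e *m B^T.
Let H := [set x : V | dot x e = 0].
Hypothesis hull_H : affine_hull (lattice_of B `&` H) = H.

Lemma dot_height z : dot z h = dot (z *m B) e.
Proof. by rewrite dot_mulmxl. Qed.

Lemma height_neq0 : h != 0.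
Proof.
apply/eqP => h0; have : norm2 e = 0; last by move/eqP; rewrite ne oner_eq0.
by rewrite /norm2 -{1}(mulmxKV uB e) -dot_height h0 dot0r.
Qed.

Lemma layer_image : lattice_of B `&` H = [set z *m B | z in layer h].
Proof.
apply/seteqP; split=> x.
  by move=> [[z [iz ->]] /= l]; exists z => //; split=> //; rewrite dot_height.
by move=> [z [iz l] <-]; split; [apply/latticeP|rewrite /H /= -dot_height].
Qed.

Lemma span_height x : dot x h = 0 -> in_span (layer h) x.
Proof.
rewrite dot_height => xH b hb kb; have : H (x *m B) by [].
rewrite -hull_H => /hullP /(_ _ (affine_mulmx (invmx B) hb)); rewrite mulmxK //.
by apply; rewrite layer_image => _ [z lz <-]; rewrite mulmxK //; apply: kb.
Qed.

Lemma hyperplane_rank : \rank (kermx e^T) = n.-1.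
Proof.
rewrite mxrank_ker mxrank_tr (_ : \rank e = 1%N) ?subn1 //.
rewrite rank_rV; case: eqP => // e0; move: ne; rewrite e0 /norm2 dot0l.
by move/esym/eqP; rewrite oner_eq0.
Qed.

Lemma hyperplane_ker : H = [set x | (x - 0 <= kermx e^T)%MS].
Proof.
apply/seteqP; split=> x; rewrite /H /= subr0 sub_kermx /dot => xe.
  by apply/eqP/rowP => i; rewrite ord1 xe mxE.
by rewrite (eqP xe) mxE.
Qed.

Lemma affdim_hyperplane S : S `<=` H -> affdim S n.-1 <-> affine_hull S = H.
Proof.
move=> SH; split=> [[p [w [free hE]]]|hS]; last first.
  apply/(@affdim_rank _ _ S 0 _ (kermx e^T)); last exact: hyperplane_rank.
  by rewrite hS hyperplane_ker.
have hSH : affine_hull S `<=` H.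
  by move=> x /hullP /(_ _ (affine_dot e)); apply => y /SH.
pose W := \matrix_i w i.
have hEW : affine_hull S = [set x | (x - p <= W)%MS].
  have WE t : \sum_i t i *: w i = (\row_i t i) *m W.
    by rewrite mulmx_sum_row; apply: eq_bigr => i _; rewrite rowK mxE.
  rewrite hE; apply/seteqP; split=> x /=.
    by move=> [t ->]; rewrite addrAC subrr add0r WE submxMl.
  move/submxP=> [t xt]; exists (fun i => t 0 i); rewrite WE -[LHS](subrK p) xt addrC.
  by congr (_ + _ *m _); apply/rowP => j; rewrite mxE.
have rW : \rank W = n.-1.
  apply/(affdim_rank n.-1 hEW); by exists p, w.
have pH : (p <= kermx e^T)%MS.
  have : H p by apply: hSH; rewrite hEW /= subrr sub0mx.
  by rewrite hyperplane_ker /= subr0.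
have WH : (W <= kermx e^T)%MS.
  apply/row_subP => i; have : H (p + row i W).
    by apply: hSH; rewrite hEW /= addrAC subrr add0r row_sub.
  rewrite hyperplane_ker /= subr0 => hi.
  have -> : row i W = (p + row i W) + (-1) *: p by rewrite scaleN1r addrAC subrr add0r.
  by rewrite addmx_sub // scalemx_sub.
have HW : (kermx e^T <= W)%MS.
  have [_ eq] := mxrank_leqif_sup WH; rewrite -eq rW hyperplane_rank //.
apply/seteqP; split=> // x; rewrite hyperplane_ker hEW /= subr0 => xH.
have -> : x - p = x + (-1) *: p by rewrite scaleN1r.
by apply: submx_trans HW; rewrite addmx_sub // scalemx_sub.
Qed.

Lemma sphere_affdim_layer o r :
  affdim (lattice_of B `&` H `&` [set v | norm2 (v - o) = r]) n.-1 <->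
  full (layer h) (zeros (layer h) (fun z => norm2 (z *m B - o) - r)).
Proof.
set S := _ `&` [set v | _].
have zE : zeros (layer h) (fun z => norm2 (z *m B - o) - r) = [set z | S (z *m B)].
  rewrite /S layer_image; apply/seteqP; split=> z [].
    by move=> lz /eqP; rewrite subr_eq0 => /eqP e1; split=> //; exists z.
  move=> [y ly yz] /= e1; split; last by rewrite e1 subrr.
  by rewrite -(mulmxK uB z) -yz mulmxK.
have SH : S `<=` H by move=> x [[]].
rewrite affdim_hyperplane // zE; split=> [e1|f].
  by apply: kills_full; rewrite e1 -layer_image hull_H.
have := full_hull f; rewrite -layer_image hull_H => sub.
by apply/seteqP; split=> // x /hullP /(_ _ (affine_dot e)); apply => y /SH.
Qed.

(** A facet in the hyperplane [H] means that the Delaunay polytope lies on one side of [H], as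
    [good_side] requires; conversely [tip] builds a polytope on top of a good cell. *)
Lemma lamina_allgood : is_lamina (lattice_of B) H <-> allgood q h.
Proof.
have cq : coercive q := coercive_norm2 uB.
have [iI i0 iB] := @sublattice_integral R n.
split=> [lam Q cQ|ag P [o [r [oH [le [-> dimT]]]]]].
  have [qQ sQ fQ] := cQ.
  have [o [r oE]] := quad_sphere qQ.
  (* [delaunay_in] asks for a center in [H]: projecting [o] to [H] lowers the squared radius by
     [k ^+ 2] and keeps the section of the sphere by [H]. *)
  pose k := dot o e; pose o' := o - k *: e.
  have o'H : H o' by rewrite /H /= dotBl dotZl -/(norm2 e) ne mulr1 subrr.
  have onH z : dot z h = 0 -> norm2 (z *m B - o') - (r - k ^+ 2) = Q z.
    rewrite dot_height oE /o' => zH.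
    have ke2 : norm2 (k *: e) = k ^+ 2.
      by rewrite /norm2 dotZl dotZr -/(norm2 e) ne mulr1 expr2.
    by rewrite opprB addrA addrAC norm2D ke2 dotZr dotBl zH -/k; ring.
  set T := lattice_of B `&` H `&` [set v | norm2 (v - o') = r - k ^+ 2].
  have [|D [/delaunay_full [o2 [r2 [cD ->]]] [[a [c [face PE]]] _]]] := lam (conv T).
    exists o', (r - k ^+ 2); split=> //; split=> [v|].
      rewrite layer_image => -[z lz <-]; have := sQ z lz.
      by rewrite -onH ?subr_ge0 //; case: lz.
    split=> //; apply/sphere_affdim_layer => b hb kb; apply: fQ => // z [lz Qz].
    by apply: kb; split=> //; rewrite onH //; case: lz.
  set Q2 := fun z => norm2 (z *m B - o2) - r2 in cD; have [qQ2 sQ2 fQ2] := cD.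
  have zT z : zeros (layer h) Q z -> T (z *m B).
    move=> [lz Qz]; split; first by rewrite layer_image; exists z.
    by apply/eqP; rewrite -subr_eq0; apply/eqP; rewrite onH //; case: lz.
  have TD x : T x -> conv (lattice_of B `&` [set v | norm2 (v - o2) = r2]) x /\ dot a x = c.
    by move=> Tx; have := conv_self Tx; rewrite PE => -[].
  have haff : affine (fun z => dot (z *m B) a - c).
    exact: affineB (affine_mulmx B (affine_dot a)) (affine_cst c).
  have [t tE] : exists t, forall z, dot (z *m B) a - c = t * dot z h.
    apply: (affine_layer height_neq0 span_height haff).
    by apply: fQ => // z /zT /TD [_]; rewrite dotC => ->; rewrite subrr.
  have side z : zeros (@integral R n) Q2 z -> t * dot z h <= 0.
    move=> [iz Qz]; rewrite -tE subr_le0 dotC; apply: face; apply: conv_self.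
    split; first exact/latticeP.
    by apply/eqP; rewrite -subr_eq0; apply/eqP.
  (* Were [t] zero, all vertices of the Delaunay polytope would lie in [conv T], hence in [H],
     against fullness. *)
  have t0 : t != 0.
    apply/eqP => t0; have [w iw] := exists_above height_neq0.
    suff -> : dot w h = 0 by rewrite ltxx.
    apply: (fQ2 _ (affine_dot h)) => // z [iz Qz].
    have : conv T (z *m B).
      rewrite PE; split; last first.
        by apply/eqP; rewrite /= -subr_eq0 dotC tE t0 mul0r.
      apply: conv_self; split; first exact/latticeP.
      by apply/eqP; rewrite -subr_eq0; apply/eqP.
    move=> /conv_sub_hull /hullP /(_ _ (affine_dot e)); rewrite dot_height; apply.
    by move=> x [[]].
  (* A point in the hull of vertices on the sphere lies in the ball, and emptiness puts lattice
     points of the ball on the sphere. *)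
  have zQ2 z : zeros (layer h) Q z -> Q2 z = 0.
    move=> zz; have [[iz _] _] := zz; apply/eqP; rewrite eq_le sQ2 // andbT subr_le0.
    have [+ _] := TD _ (zT z zz); apply: conv_ball => v []; by [].
  have [k2 k2E] : exists k, forall z, Q2 z - Q z = k * dot z h.
    apply: (affine_layer height_neq0 span_height (quadB qQ2 qQ)).
    apply: fQ; first exact: quadB qQ2 qQ.
    by move=> z zz; rewrite zQ2 // (proj2 zz) subrr.
  have [||k3 [s3 z3]] := @good_side _ _ q h Q2 (- t) cq qQ2 sQ2.
  - by rewrite oppr_eq0.
  - by move=> z iz Qz; rewrite mulNr oppr_ge0; apply: side.
  have eE z : Q z + (k2 + k3) * dot z h = Q2 z + k3 * dot z h.
    by rewrite mulrDl -k2E; ring.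
  by exists (k2 + k3); split=> z iz; rewrite eE; [apply: s3|apply: z3].
set T := _ `&` [set v | _] in dimT *.
pose Q z := norm2 (z *m B - o) - r.
have qQ : quad q Q by apply: sphere_quad.
have fQ := proj1 (sphere_affdim_layer o r) dimT.
have cQ : cell q (layer h) Q.
  split=> // z lz; rewrite subr_ge0; apply: le; rewrite layer_image; by exists z.
have [k [sk zk]] := ag Q cQ.
pose Q1 z := Q z + k * dot z h.
have qQ1 : quad q Q1 by apply: quadDZ qQ _; apply: affine_dot.
have zl : zeros (layer h) Q `<=` zeros (layer h) Q1.
  by move=> z [lz Qz]; split=> //; rewrite /Q1 Qz (proj2 lz) mulr0 addr0.
have [|t t0 [c2 side]] := tip height_neq0 span_height cq qQ1 sk _ zk.
  by move=> b hb kb; apply: fQ => // z /zl; apply: kb.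
have [qQ2 sQ2 fQ2] := c2; have [o2 [r2 oE]] := quad_sphere qQ2.
set S := lattice_of B `&` [set v | norm2 (v - o2) = r2].
have SE z : S (z *m B) <-> integral z /\ Q1 z - t * dot z h = 0.
  rewrite oE; split=> [[/latticeP iz /= ->]|[iz /eqP]]; first by rewrite subrr.
  by rewrite subr_eq0 => /eqP; split=> //; apply/latticeP.
have Sup x : S x -> dot (- e) x <= 0.
  move=> Sx; have [[z [iz xz]] _] := Sx; rewrite xz in Sx *.
  rewrite dotNl oppr_le0 dotC -dot_height; apply: side => //; by case/SE: Sx.
have TS x : T x <-> (S `&` [set x | dot (- e) x = 0]) x.
  split=> [[[[z [iz ->]] xH] xr]|[Sx]].
    split; last by rewrite /= dotNl dotC xH oppr0.
    have lz : dot z h = 0 by rewrite dot_height.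
    apply/SE; split=> //; rewrite /Q1 lz !mulr0 addr0 subr0 /Q xr subrr //.
  rewrite /= dotNl => /eqP; rewrite oppr_eq0 dotC => /eqP xH.
  have [[z [iz xz]] _] := Sx; rewrite xz in Sx xH *.
  have lz : dot z h = 0 by rewrite dot_height.
  move/SE: Sx => [_]; rewrite /Q1 lz !mulr0 addr0 subr0 => /eqP.
  by rewrite /Q subr_eq0 => /eqP; split=> //; split=> //; apply/latticeP.
have TE : T = S `&` [set x | dot (- e) x = 0] by apply/seteqP; split=> x /TS.
exists (conv S); split.
  apply/delaunay_full; exists o2, r2; split=> //.
  by apply: eq_cell c2 (sphere_quad _ _) _ => z _; rewrite oE.
split; last by apply: eq_affdim dimT; rewrite hull_conv.
exists (- e), 0; split=> [x|]; first exact: conv_support.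
apply/seteqP; split=> x.
  move=> xT; split; first by apply: conv_mono xT => y /TS [].
  rewrite /= dotC; move/conv_sub_hull/hullP: xT => /(_ _ (affine_dot (- e))); apply.
  by move=> y /TS [_] /=; rewrite dotC.
by move=> [xS x0]; rewrite TE; apply: conv_face.
Qed.

End Lattice.

(** * Faces of the Voronoi polytope through tight lattice vectors *)

Section Voronoi.
Variables (R : realType) (n : nat).
Local Notation V := 'rV[R]_n.
Implicit Types (b c g Q : V -> R) (S T X F G : set V) (x y z : V) (B : 'M[R]_n).

(** This is [norm2 (z *m B - x) - norm2 x], the function vanishing at 0 that belongs to the point
    [x]; it is affine in [x]. *)
Definition power B x z := sqlen B z - 2 * dot (z *m B) x.

(** Coordinates of the lattice points as far from [x] as 0 is. *)
Definition tight B x := zeros (@integral R n) (power B x).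

Lemma power0 B x : power B x 0 = 0.
Proof. by rewrite /power /sqlen mul0mx /norm2 !dot0l mulr0 subr0. Qed.

Lemma power_line B x y t z : power B (x + t *: y) z = power B x z + t * (- 2 * dot (z *m B) y).
Proof. by rewrite /power dotDr dotZr; ring. Qed.

Lemma power_mid B s x y z :
  power B ((1 - s) *: x + s *: y) z = (1 - s) * power B x z + s * power B y z.
Proof. by rewrite /power dotDr !dotZr; ring. Qed.

Lemma voronoiP B x : voronoi (lattice_of B) x <-> supports (@integral R n) (power B x).
Proof.
have e z : norm2 (x - z *m B) = norm2 x + power B x z.
  by rewrite norm2B dotC /power /sqlen; ring.
split=> [vx z iz|sx v [z [iz ->]]]; last by rewrite e lerDl sx.
have := vx (z *m B); rewrite e lerDl; apply; by exists z.
Qed.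

Lemma voronoi_mid B s x y : 0 <= s <= 1 -> voronoi (lattice_of B) x ->
  voronoi (lattice_of B) y -> voronoi (lattice_of B) ((1 - s) *: x + s *: y).
Proof.
rewrite -(subr_ge0 s) => /andP[s0 s1] /voronoiP sx /voronoiP sy; apply/voronoiP => z iz.
by rewrite power_mid; apply: addr_ge0; apply: mulr_ge0; rewrite ?sx ?sy.
Qed.

Lemma integral0 : @integral R n 0.
Proof. by case: (@sublattice_integral R n). Qed.

Lemma tight0 B x : tight B x 0.
Proof. by split; [exact: integral0|exact: power0]. Qed.

Lemma tight_mid B s x y : 0 < s < 1 -> voronoi (lattice_of B) x ->
  voronoi (lattice_of B) y ->
  tight B ((1 - s) *: x + s *: y) = tight B x `&` tight B y.
Proof.
rewrite -(subr_gt0 s) => /andP[s0 s1] /voronoiP sx /voronoiP sy; apply/seteqP; split=> z.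
  move=> [iz /eqP]; rewrite power_mid paddr_eq0 ?mulr_ge0 ?sx ?sy ?(ltW s0) ?(ltW s1) //.
  by rewrite !mulf_eq0 (gt_eqF s0) (gt_eqF s1) => /= /andP[/eqP e1 /eqP e2].
by move=> [[iz e1] [_ e2]]; split=> //; rewrite power_mid e1 e2 !mulr0 addr0.
Qed.

Lemma power_quad B x : quad (sqlen B) (power B x).
Proof.
apply: (eq_affine (affineZ (-2) (affine_mulmx B (affine_dot x)))) => z.
by rewrite /power; ring.
Qed.

Lemma affine_power B b : B \in unitmx -> affine b -> b 0 = 0 ->
  exists y, forall z, b z = - 2 * dot (z *m B) y.
Proof.
move=> uB [a [c e]]; rewrite e dot0l add0r => c0.
exists ((- 2^-1) *: (a *m (invmx B)^T)) => z.
rewrite e c0 addr0 dotZr dot_mulmxl -mulmxA -trmx_mul mulmxV // trmx1 mulmx1.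
by field.
Qed.

Lemma quad_power B Q : B \in unitmx -> quad (sqlen B) Q -> Q 0 = 0 ->
  exists x, forall z, Q z = power B x z.
Proof.
move=> uB qQ Q0; have [|y ey] := affine_power uB qQ.
  by rewrite Q0 sub0r /sqlen mul0mx /norm2 dot0l oppr0.
exists y => z; rewrite /power; have := ey z; lra.
Qed.

Lemma tight_seq B x : B \in unitmx -> exists s : seq V, forall z, z \in s <-> tight B x z.
Proof.
move=> uB; apply: (zeros_seq (coercive_norm2 uB)) => //; exact: power_quad.
Qed.

Lemma face_mid P F s x y : is_face P F -> P ((1 - s) *: x + s *: y) -> F x -> F y ->
  F ((1 - s) *: x + s *: y).
Proof.
move=> [a [c [_ ->]]] Pm [_ /= ax] [_ /= ay]; split=> //=.
by rewrite dotDr !dotZr ax ay; ring.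
Qed.

Lemma face_voronoi B F x : is_face (voronoi (lattice_of B)) F -> F x ->
  voronoi (lattice_of B) x.
Proof. by move=> [a [c [_ ->]]] []. Qed.

Lemma face0 P : is_face P (set0 : set V).
Proof.
exists 0, 1; split=> [x _|]; first by rewrite dot0l ler01.
by apply/seteqP; split=> // x [_ /=]; rewrite dot0l => /esym/eqP; rewrite oner_eq0.
Qed.

(* From [x0] one can move slightly beyond it, away from [x]. *)
Lemma face_tight B F x0 x : B \in unitmx -> is_face (voronoi (lattice_of B)) F -> F x0 ->
  voronoi (lattice_of B) x -> tight B x0 `<=` tight B x -> F x.
Proof.
move=> uB [a [c [le ->]]] [/[dup] Vx0 /voronoiP s0 /= ax0] Vx sub; split=> //=.
have hg : affine (fun z => - 2 * dot (z *m B) (x0 - x)).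
  exact: affineZ (affine_mulmx B (affine_dot _)).
have [||t t0 /(_ t)[|st _]] := @perturb R n (@integral R n) _
    (fun z => - 2 * dot (z *m B) (x0 - x)) s0.
- exact: quad_sublevel (coercive_norm2 uB) (power_quad B x0) hg.
- move=> z iz z0; have [_] : tight B x z by apply: sub.
  by rewrite dotBr; move: z0; rewrite /power; lra.
- by rewrite t0 lexx.
have /le : voronoi (lattice_of B) (x0 + t *: (x0 - x)).
  by apply/voronoiP => z iz; rewrite power_line; apply: st.
rewrite dotDr dotZr dotBr ax0 gerDl pmulr_rle0 // subr_le0 => h.
by apply/eqP; rewrite eq_le h le.
Qed.

Definition tight_face B (K : set V) : set V :=
  [set x | voronoi (lattice_of B) x /\ K `<=` tight B x].

(** The sum of the powers over [K] is affine in [x], nonnegative on the polytope, and vanishes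
    exactly where every term does. *)
Lemma tight_faceP B K (s : seq V) : (forall z, z \in s <-> K z) -> K `<=` @integral R n ->
  is_face (voronoi (lattice_of B)) (tight_face B K).
Proof.
move=> sK Ki.
have e x : \sum_(z <- s) power B x z =
    \sum_(z <- s) sqlen B z - dot (2 *: \sum_(z <- s) z *m B) x.
  by rewrite dotZl dot_suml mulr_sumr -sumrB.
have pos x : voronoi (lattice_of B) x -> forall z, z \in s -> 0 <= power B x z.
  by move=> /voronoiP sx z /sK /Ki; apply: sx.
exists (2 *: \sum_(z <- s) z *m B), (\sum_(z <- s) sqlen B z); split=> [x Vx|].
  by rewrite -subr_ge0 -e big_seq sumr_ge0 //; apply: pos.
apply/seteqP; split=> x [Vx].
  move=> sub; split=> //=; apply/esym/eqP; rewrite -subr_eq0 -e big_seq big1 //.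
  by move=> z /sK /sub [].
move=> /= h; split=> // z Kz; split; first exact: Ki.
have : \sum_(z <- s) power B x z = 0 by rewrite e h subrr.
rewrite big_seq => /eqP; rewrite psumr_eq0; last by move=> y /(pos x Vx).
by move=> /allP /(_ z (proj2 (sK z) Kz)); rewrite (proj2 (sK z) Kz) => /eqP.
Qed.

Lemma tight_face_is_face B x : B \in unitmx ->
  is_face (voronoi (lattice_of B)) (tight_face B (tight B x)).
Proof. by move=> uB; have [s hs] := tight_seq x uB; apply: tight_faceP hs _ => z []. Qed.

(** A point of [F] with the fewest tight vectors will do: its midpoint with [y] has only the common
    tight vectors, so none can be lost. *)
Lemma face_relint B F x : B \in unitmx -> is_face (voronoi (lattice_of B)) F -> F x ->
  exists2 x0, F x0 & forall y, F y -> tight B x0 `<=` tight B y.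
Proof.
move=> uB fF Fx.
pose P k := `[< exists y (s : seq V), [/\ F y, forall z, z \in s <-> tight B y z & size s = k] >].
have ex : exists k, P k.
  by have [s hs] := tight_seq x uB; exists (size s); apply/asboolP; exists x, s.
case: (ex_minnP ex) => k /asboolP [x0 [s [Fx0 hs sk]]] kmin.
exists x0 => // y Fy z zx0; apply: contrapT => nzy.
have half : (0 : R) < (2^-1 : R) < 1 by rewrite invr_gt0 ltr0n invf_lt1 ?ltr1n ?ltr0n.
have Vx0 := face_voronoi fF Fx0; have Vy := face_voronoi fF Fy.
have Vm : voronoi (lattice_of B) ((1 - 2^-1) *: x0 + 2^-1 *: y).
  by apply: voronoi_mid => //; case/andP: half => /ltW -> /ltW ->.
have : P (size [seq w <- s | `[< tight B y w >]]).
  apply/asboolP; exists ((1 - 2^-1) *: x0 + 2^-1 *: y), [seq w <- s | `[< tight B y w >]].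
  split=> // [|w]; first exact: face_mid fF Vm Fx0 Fy.
  rewrite tight_mid // mem_filter; split=> [/andP[/asboolP ? /hs]|[/hs -> /asboolP ->]] //.
move/kmin; rewrite -sk leqNgt size_filter; apply/negP/negPn.
rewrite ltn_neqAle count_size andbT -all_count; apply/negP => /allP /(_ z).
by move=> /(_ (proj2 (hs z) zx0)) /asboolP.
Qed.

(** The tight set of [x] is an intersection of cells at 0, since [walk_slack] provides a cell
    avoiding any given further vector. The cells being common to both lattices, averaging their
    functions for [B2] gives a point with the same tight set. *)
Lemma tight_transfer B1 B2 x : B1 \in unitmx -> B2 \in unitmx ->
  del (sqlen B1) = del (sqlen B2) -> voronoi (lattice_of B1) x ->
  exists2 y, voronoi (lattice_of B2) y & tight B2 y = tight B1 x.
Proof.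
move=> u1 u2 dE /voronoiP sx.
have cq1 := coercive_norm2 u1; have cq2 := coercive_norm2 u2.
have sI := @sublattice_integral R n; have qx := power_quad B1 x.
have ne : exists z, tight B1 x z by exists 0; apply: tight0.
have transfer Q : cell (sqlen B1) (@integral R n) Q ->
    exists2 Q', cell (sqlen B2) (@integral R n) Q' & zeros (@integral R n) Q = zeros (@integral R n) Q'.
  move=> cQ; have : del (sqlen B1) (zeros (@integral R n) Q) by exists Q.
  by rewrite dE => -[Q' cQ' e]; exists Q'.
have [Q1 cQ1 sub1] := walk_cell cq1 sI qx sx ne.
have [Q0 cQ0 z01] := transfer Q1 cQ1; have [qQ0 sQ0 _] := cQ0.
have [s hs] := zeros_seq cq2 (let: And3 h _ _ := sI in h) qQ0.
have [Q [qQ sQ TQ Q0Q slack]] : exists Q, [/\ quad (sqlen B2) Q, supports (@integral R n) Q,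
    tight B1 x `<=` zeros (@integral R n) Q,
    zeros (@integral R n) Q `<=` zeros (@integral R n) Q0 &
    forall z, z \in s -> ~ tight B1 x z -> integral z -> 0 < Q z].
  elim: s {hs} => [|z s [Q [qQ sQ TQ Q0Q slack]]].
    by exists Q0; split=> //; rewrite -z01.
  have [[ntz iz]|tz] := pselect (~ tight B1 x z /\ integral z); last first.
    exists Q; split=> // w; rewrite inE => /orP[/eqP->|]; last exact: slack.
    by move=> h1 h2; case: tz.
  have pz : 0 < power B1 x z.
    by rewrite lt_neqAle sx // andbT; apply/eqP => /esym h; apply: ntz.
  have [Q2 [cQ2 sub2 Q2z]] := walk_slack cq1 sI qx sx ne pz.
  have [Q3 [qQ3 sQ3 _] z23] := transfer Q2 cQ2.
  have avg w : 2^-1 * Q w + 2^-1 * Q3 w = Q w + 2^-1 * (Q3 w - Q w) by field.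
  have h2 : (0 : R) < 2^-1 by rewrite invr_gt0.
  exists (fun w => 2^-1 * Q w + 2^-1 * Q3 w); split.
  - by apply: (eq_affine (quadDZ 2^-1 qQ (quadB qQ3 qQ))) => w; rewrite avg.
  - by move=> w iw; rewrite addr_ge0 // mulr_ge0 ?(ltW h2) ?sQ ?sQ3.
  - move=> w tw; have [iw Qw] := TQ w tw; split=> //.
    have [_ Q3w] : zeros (@integral R n) Q3 w by rewrite -z23; apply: sub2.
    by rewrite Qw Q3w !mulr0 addr0.
  - move=> w [iw /eqP]; rewrite paddr_eq0 ?mulr_ge0 ?(ltW h2) ?sQ ?sQ3 //.
    rewrite mulf_eq0 (gt_eqF h2) /= => /andP[/eqP Qw _]; by apply: Q0Q.
  - move=> w; rewrite inE => /orP[/eqP->|ws] ntw iw.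
      rewrite ltr_wpDl ?mulr_ge0 ?(ltW h2) ?sQ // pmulr_rgt0 // lt_neqAle sQ3 // andbT.
      apply/eqP => /esym Q3z; have [_ Q2z0] : zeros (@integral R n) Q2 z by rewrite z23.
      by rewrite Q2z0 ltxx in Q2z.
    by rewrite ltr_pwDl ?mulr_ge0 ?(ltW h2) ?sQ3 // pmulr_rgt0 // slack.
have TE : zeros (@integral R n) Q = tight B1 x.
  apply/seteqP; split=> // z zQ; apply: contrapT => ntz.
  have zs : z \in s by apply/hs/Q0Q.
  by have := slack z zs ntz (proj1 zQ); rewrite (proj2 zQ) ltxx.
have [_ Q00] : zeros (@integral R n) Q 0 by apply/TQ/tight0.
have [y yE] := quad_power u2 qQ Q00.
exists y; first by apply/voronoiP => z iz; rewrite -yE sQ.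
by rewrite -TE; apply/seteqP; split=> z [iz]; [rewrite -yE|rewrite yE]; split.
Qed.

Lemma same_Ltype_of_del B1 B2 : B1 \in unitmx -> B2 \in unitmx ->
  del (sqlen B1) = del (sqlen B2) -> same_Ltype (lattice_of B1) (lattice_of B2).
Proof.
move=> u1 u2 dE.
(* The vectors tight on all of [F] determine it; asking [F] to be nonempty sends the empty face to
   itself. *)
pose phi F : set V := [set y | [/\ exists x, F x, voronoi (lattice_of B2) y &
  \bigcap_(x in F) tight B1 x `<=` tight B2 y]].
have phi0 : phi set0 = set0 by apply/seteqP; split=> y // [[]].
have emptyE F : ~ (exists x, F x) -> F = set0.
  by move=> h; apply/seteqP; split=> x // Fx; apply: h; exists x.
have phiE F x0 : F x0 -> (forall y, F y -> tight B1 x0 `<=` tight B1 y) ->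
    phi F = tight_face B2 (tight B1 x0).
  move=> Fx0 rel; apply/seteqP; split=> y.
    by move=> [_ Vy sub]; split=> // z zx; apply: sub => x /rel; apply.
  by move=> [Vy sub]; split=> // [|z zF]; [exists x0|apply/sub/zF].
exists phi; split=> [F fF|]; [|split=> [G fG|F1 F2 fF1 fF2]].
- have [[x Fx]|/emptyE ->] := pselect (exists x, F x); last by rewrite phi0; apply: face0.
  have [x0 Fx0 rel] := face_relint u1 fF Fx.
  have [y Vy yE] := tight_transfer u1 u2 dE (face_voronoi fF Fx0).
  by rewrite (phiE F x0) // -yE; apply: tight_face_is_face.
- have [[x Gx]|/emptyE ->] := pselect (exists x, G x); last first.
    by exists set0; split; [exact: face0|exact: phi0].
  have [y Gy rel] := face_relint u2 fG Gx.
  have [x0 Vx0 x0E] := tight_transfer u2 u1 (esym dE) (face_voronoi fG Gy).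
  exists (tight_face B1 (tight B1 x0)); split; first exact: tight_face_is_face.
  rewrite (phiE _ x0); [|by split|by move=> w []].
  rewrite x0E; apply/seteqP; split=> w.
    by move=> [Vw sub]; apply: face_tight fG Gy Vw sub.
  by move=> Gw; split; [exact: face_voronoi fG Gw|apply: rel].
- split=> [sub y [[x F1x] Vy suby]|sub x F1x].
    split=> //; first by exists x; apply: sub.
    by move=> z zF; apply: suby => w /sub; apply: zF.
  have [x1 F1x1 rel1] := face_relint u1 fF1 F1x.
  have [y Vy yE] := tight_transfer u1 u2 dE (face_voronoi fF1 F1x1).
  have : phi F1 y by rewrite (phiE F1 x1) //; split=> //; rewrite yE.
  move/sub => [[w F2w] _ suby].
  have [x2 F2x2 rel2] := face_relint u1 fF2 F2w.
  apply: (face_tight u1 fF2 F2x2 (face_voronoi fF1 F1x)) => z zx2.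
  apply: (rel1 x F1x); rewrite -yE; apply: suby => v /rel2; by apply.
Qed.

End Voronoi.

(** * Zone edges as good cells of the layer *)

Section Zones.
Variables (R : realType) (n : nat).
Local Notation V := 'rV[R]_n.
Implicit Types (b c g Q : V -> R) (S T X F G E : set V) (x y z : V).
Variables (B : 'M[R]_n) (e : V).
Hypothesis uB : B \in unitmx.
Hypothesis ne : norm2 e = 1.
Let L := lattice_of B.
Let h := e *m B^T.
Let q := sqlen B.
Hypothesis hull_H : affine_hull (L `&` [set x | dot x e = 0]) = [set x | dot x e = 0].

Let cq : coercive q. Proof. exact: coercive_norm2. Qed.
Let h0 : h != 0. Proof. exact: height_neq0. Qed.
Let span_h x : dot x h = 0 -> in_span (layer h) x. Proof. exact: span_height. Qed.

Lemma dir_neq0 : e != 0.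
Proof. by rewrite -norm2_eq0 ne oner_neq0. Qed.

Lemma layer0 : layer h 0.
Proof. by split; [exact: integral0|rewrite dot0l]. Qed.

Lemma power_layer_eq x y : kills (layer h) (fun z => power B x z - power B y z) ->
  exists s, x = y + s *: e.
Proof.
move=> k; have [t tE] := affine_layer h0 span_h (quadB (power_quad B x) (power_quad B y)) k.
exists (- t / 2); apply/eqP; rewrite -subr_eq0 -norm2_eq0; apply/eqP.
set d := x - _; rewrite /norm2 -{1}(mulmxKV uB d).
set z := d *m invmx B; have := tE z; rewrite /power dot_height /d dotBr dotDr dotZr; lra.
Qed.

Lemma power_dir x s z : power B (x + s *: e) z = power B x z - 2 * s * dot z h.
Proof. by rewrite power_line dot_height; ring. Qed.

(** Vectors tight at [x] are orthogonal to [v] and do not obstruct the ray; the first new tight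
    vector stops it. *)
Lemma ray_end x v : voronoi L x -> (forall z, tight B x z -> dot (z *m B) v = 0) ->
  (exists2 z, integral z & 0 < dot (z *m B) v) ->
  exists t, [/\ 0 < t, voronoi L (x + t *: v) & forall r, voronoi L (x + r *: v) -> r <= t].
Proof.
move=> /voronoiP sx flat [w iw vw].
have hg : affine (fun z => - 2 * dot (z *m B) v).
  exact: affineZ (affine_mulmx B (affine_dot _)).
have [||t [t0 st [z iz [vz zt]]]] := @hit R n (@integral R n) _ (fun z => - 2 * dot (z *m B) v) sx.
- by move=> t _; apply: quad_sublevel cq (power_quad B x) _; apply: affineZ.
- by exists w => //; lra.
have vz' : 0 < dot (z *m B) v by lra.
exists t; split.
- rewrite lt_neqAle t0 andbT; apply/eqP => t00; move: zt; rewrite -t00 mul0r addr0 => xz.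
  by move: vz'; rewrite flat ?ltxx.
- by apply/voronoiP => y iy; rewrite power_line; apply: st.
- move=> r /voronoiP /(_ z iz); rewrite power_line => rz.
  rewrite leNgt; apply/negP => tr.
  have : 0 < (r - t) * dot (z *m B) v by rewrite mulr_gt0 // subr_gt0.
  set d := dot _ _ in rz zt *; have -> : (r - t) * d =
    2^-1 * ((power B x z + t * (- 2 * d)) - (power B x z + r * (- 2 * d))) by field.
  by rewrite zt sub0r mulrN oppr_gt0 pmulr_rlt0 ?invr_gt0 // ltNge rz.
Qed.

(* [x] is a relative interior point of an edge of the Voronoi polytope parallel to [e]. *)
Definition vertical x :=
  [/\ voronoi L x, full (layer h) (tight B x) & forall z, tight B x z -> dot z h = 0].

Lemma vertical_cell x : vertical x -> cell q (layer h) (power B x).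
Proof.
move=> [/voronoiP sx fx flat]; split; [exact: power_quad|by move=> z [iz _]; apply: sx|].
by move=> b hb kb; apply: fx => // z tz; apply: kb; split; [split; [case: tz|exact: flat]|case: tz].
Qed.

Lemma vertical_tight x : vertical x -> tight B x = zeros (layer h) (power B x).
Proof.
move=> [_ _ flat]; apply/seteqP; split=> z; last by move=> [[iz _] xz].
by move=> tz; split; [split; [case: tz|exact: flat]|case: tz].
Qed.

(** Take the midpoint of the edge. Its tight vectors are tight at both ends, and along [e] the power
    changes by a multiple of the height, so they lie in the layer. They span it: a function
    vanishing on them moves the midpoint within the edge, hence along [e], and so vanishes on the
    layer. *)
Lemma zone_vertical E : zone (voronoi L) e E ->
  exists x, [/\ vertical x, E x & E = tight_face B (tight B x)].
Proof.
move=> [[fE _] [p [p' [t [npp [Es pt]]]]]].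
have Ep : E p by rewrite Es; exists 0; rewrite lexx ler01 subr0 scale1r scale0r addr0.
have Ep' : E p' by rewrite Es; exists 1; rewrite lexx ler01 subrr scale1r scale0r add0r.
have Vp := face_voronoi fE Ep; have Vp' := face_voronoi fE Ep'.
have half : (0 : R) < (2^-1 : R) < 1 by rewrite invr_gt0 ltr0n invf_lt1 ?ltr1n ?ltr0n.
have halfw : (0 : R) <= (2^-1 : R) <= 1 by case/andP: half => /ltW -> /ltW ->.
pose x := (1 - 2^-1) *: p + 2^-1 *: p'.
have Vx : voronoi L x := voronoi_mid halfw Vp Vp'.
have Ex : E x := face_mid fE Vx Ep Ep'.
have tx : tight B x = tight B p `&` tight B p' := tight_mid half Vp Vp'.
have t0 : t != 0.
  by apply: contra_neq npp => t0; move: pt; rewrite t0 scale0r => /subr0_eq.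
have p'E : p' = p + t *: e by rewrite -pt addrC subrK.
have flat z : tight B x z -> dot z h = 0.
  rewrite tx => -[[_ z1] [_]]; rewrite p'E power_dir z1 sub0r => /eqP.
  by rewrite oppr_eq0 !mulf_eq0 (negPf t0) pnatr_eq0 /= => /eqP.
exists x; split=> //; first split=> //.
  move=> b hb kb z [iz lz].
  have [y yE] := affine_power uB hb (kb 0 (tight0 B x)).
  have [||s s0 /(_ s)[|st _]] := @perturb R n (@integral R n) _ b (proj1 (voronoiP B x) Vx).
  - exact: quad_sublevel cq (power_quad B x) hb.
  - by move=> w iw wx; rewrite kb.
  - by rewrite s0 lexx.
  have Vy : voronoi L (x + s *: y).
    by apply/voronoiP => w iw; rewrite power_line -yE; apply: st.
  have : E (x + s *: y).
    apply: (face_tight uB fE Ex Vy) => w [iw wx]; split=> //.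
    by rewrite power_line -yE kb // wx mulr0 addr0.
  rewrite Es => -[u [_ ]].
  have -> : x = p + (2^-1 * t) *: e.
    by rewrite /x p'E scalerDr addrA -scalerDl subrK scale1r scalerA.
  rewrite p'E scalerDr addrA -scalerDl subrK scale1r scalerA -addrA => /addrI.
  move/(canRL (addKr _)); rewrite -scaleNr -scalerDl => sy.
  by have := yE z; rewrite -[y](scalerK (lt0r_neq0 s0)) sy !dotZr -dot_height lz !mulr0 => ->.
apply/seteqP; split=> w.
  rewrite Es => -[u [/andP[u0 u1] ->]].
  split; first by apply: voronoi_mid => //; rewrite u0.
  move=> z; rewrite tx => -[[iz z1] [_ z2]]; split=> //.
  by rewrite power_mid z1 z2 !mulr0 addr0.
by move=> [Vw sub]; apply: face_tight uB fE Ex Vw sub.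
Qed.

Lemma vertical_face x w : vertical x -> tight_face B (tight B x) w -> exists s, w = x + s *: e.
Proof.
move=> [Vx fx flat] [Vw sub]; apply: power_layer_eq.
apply: fx; first exact: quadB (power_quad B w) (power_quad B x).
by move=> z tz; rewrite (proj2 (sub z tz)) (proj2 tz) subrr.
Qed.

Lemma vertical_zone x : vertical x -> zone (voronoi L) e (tight_face B (tight B x)).
Proof.
move=> vx; have [Vx fx flat] := vx.
have fE : is_face (voronoi L) (tight_face B (tight B x)) by apply: tight_face_is_face.
have Ex : tight_face B (tight B x) x by split.
have on_line s : voronoi L (x + s *: e) -> tight_face B (tight B x) (x + s *: e).
  move=> V1; split=> // z tz; split; first by case: tz.
  by rewrite power_dir flat // mulr0 subr0; case: tz.
have [w iw lw] := exists_above h0.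
have [||t1 [t1_gt0 V1 max1]] := ray_end (v := e) Vx.
- by move=> z /flat; rewrite dot_height.
- by exists w => //; rewrite -dot_height.
have [||t2 [t2_gt0 V2 max2]] := ray_end (v := - e) Vx.
- by move=> z /flat; rewrite dotNr -dot_height => ->; rewrite oppr0.
- exists (- w); first exact: sublatticeN (@sublattice_integral R n) iw.
  by rewrite dotNr -dot_height dotNl opprK.
have nE r : r *: - e = (- r) *: e by rewrite scalerN scaleNr.
rewrite nE in V2.
pose p := x + (- t2) *: e; pose p' := x + t1 *: e.
have d0 : 0 < t1 + t2 by rewrite addr_gt0.
have midE u : (1 - u) *: p + u *: p' = x + ((1 - u) * - t2 + u * t1) *: e.
  by rewrite /p /p' !scalerDr !scalerA addrACA -!scalerDl subrK scale1r.
have pp : p' - p = (t1 + t2) *: e.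
  by rewrite /p /p' opprD addrACA subrr add0r scaleNr opprK scalerDl.
have npp : p != p'.
  apply/eqP => pp'; move: pp; rewrite pp' subrr => /esym/eqP.
  by rewrite scaler_eq0 (gt_eqF d0) (negPf dir_neq0).
have Es : tight_face B (tight B x) = segment p p'.
  apply/seteqP; split=> y.
    move=> Ey; have [s ys] := vertical_face vx Ey.
    have Vy := proj1 Ey; rewrite ys in Vy *.
    have s1 := max1 s Vy; have : - s <= t2 by apply: max2; rewrite nE opprK.
    move=> s2; exists ((s + t2) / (t1 + t2)); split.
      rewrite divr_ge0 ?(ltW d0) /= ?ler_pdivrMr // ?mul1r ?lerD2r //; lra.
    by rewrite midE; congr (_ + _ *: _); field; exact: lt0r_neq0.
  move=> [u [/andP[u0 u1] ->]].
  have u01 : 0 <= u <= 1 by rewrite u0.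
  by apply: (face_mid fE (voronoi_mid u01 V2 V1)); apply: on_line.
split; first by split=> //; exists p, p'.
by exists p, p', (t1 + t2).
Qed.

Lemma vertical_of_good Q : cell q (layer h) Q -> Q 0 = 0 -> good h Q ->
  exists2 x, vertical x & forall z, layer h z -> power B x z = Q z.
Proof.
move=> cQ Q0 [k [sk zk]]; have [qQ sQ fQ] := cQ.
have [||x xE] := @quad_power R n B (fun z => Q z + k * dot z h) uB.
- exact: quadDZ qQ (affine_dot h).
- by rewrite Q0 dot0l mulr0 addr0.
exists x; last by move=> z [iz lz]; rewrite -xE lz mulr0 addr0.
split.
- by apply/voronoiP => z iz; rewrite -xE; apply: sk.
- move=> b hb kb; apply: fQ => // z [[iz lz] Qz]; apply: kb; split=> //.
  by rewrite -xE lz Qz mulr0 addr0.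
- by move=> z [iz]; rewrite -xE; apply: zk.
Qed.

Lemma vertical_good x : vertical x -> good h (power B x).
Proof.
move=> [/voronoiP sx _ flat]; exists 0; split=> z iz; rewrite mul0r addr0; first exact: sx.
by move=> z0; apply: flat; split.
Qed.

Lemma vertical_edge_eq x y : vertical x -> vertical y ->
  (forall z, layer h z -> power B x z = power B y z) ->
  tight_face B (tight B x) = tight_face B (tight B y).
Proof.
move=> vx vy xy; suff -> : tight B x = tight B y by [].
rewrite !vertical_tight //; apply/seteqP; split=> z [lz]; first by rewrite xy.
by rewrite -xy.
Qed.

Lemma affdim2_off_line G x v : affdim G 2 -> exists2 y, G y & forall s, y <> x + s *: v.
Proof.
move=> [p [w [free hG]]]; apply: contrapT => no.
have Gl y : G y -> exists s, y = x + s *: v.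
  by move=> Gy; apply: contrapT => ns; apply: no; exists y => // s ys; apply: ns; exists s.
have hl y : affine_hull G y -> exists s, y = x + s *: v.
  move=> [k [pt [a [Gp [a1 ->]]]]].
  have /boolp.choice [s sE] : forall i, exists s, pt i = x + s *: v by move=> i; apply: Gl.
  exists (\sum_i a i * s i); rewrite scaler_suml -[x in RHS]scale1r -a1 scaler_suml -big_split.
  by apply: eq_bigr => i _; rewrite /= sE scalerDr scalerA.
have hp t : exists s, p + \sum_(i < 2) t i *: w i = x + s *: v.
  by apply: hl; rewrite hG; exists t.
have sum2 (t : 'I_2 -> R) : \sum_(i < 2) t i *: w i = t 0 *: w 0 + t 1 *: w 1.
  rewrite big_ord_recl big_ord1; congr (_ + t _ *: w _); exact/val_inj.
have [s0 E0] := hp (fun=> 0); have [s1 E1] := hp (fun i => (i == 0)%:R).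
have [s2 E2] := hp (fun i => (i == 1)%:R).
rewrite sum2 !scale0r !addr0 in E0.
rewrite sum2 /= scale1r scale0r addr0 E0 -addrA in E1.
rewrite sum2 /= scale1r scale0r add0r E0 -addrA in E2.
have w0 : w 0 = (s1 - s0) *: v.
  by move/addrI: E1 => /(canRL (addKr _)) ->; rewrite -scaleNr -scalerDl addrC.
have w1 : w 1 = (s2 - s0) *: v.
  by move/addrI: E2 => /(canRL (addKr _)) ->; rewrite -scaleNr -scalerDl addrC.
have rel := free (fun i => if i == 0 then s2 - s0 else - (s1 - s0)).
have : \sum_(i < 2) (if i == 0 then s2 - s0 else - (s1 - s0)) *: w i = 0.
  by rewrite sum2 /= w0 w1 !scalerA mulNr scaleNr mulrC subrr.
move/rel => z; have z1 := z 1; have z0 := z 0; rewrite /= in z0 z1.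
have := free (fun i => (i == 0)%:R); rewrite sum2 /= scale1r scale0r addr0 w0.
have -> : s1 - s0 = 0 by rewrite -[LHS]opprK z1 oppr0.
rewrite scale0r => /(_ erefl 0) /= /eqP; by rewrite oner_eq0.
Qed.

(** Three vectors in a plane are dependent, and [v != 0] keeps the relation from involving [v]
    alone. So modulo [v] the face lies on a line. *)
Lemma affdim2_dependent G x y0 y1 v : affdim G 2 -> G x -> G y0 -> G y1 -> v != 0 ->
  (exists2 s, s != 0 & G (x + s *: v)) ->
  exists a0 a1 k, ((a0 != 0) || (a1 != 0)) /\ a0 *: (y0 - x) + a1 *: (y1 - x) = k *: v.
Proof.
move=> [p [w [_ hG]]] Gx Gy0 Gy1 v0 [s s0 Gs].
have coord y : G y -> exists t : 'I_2 -> R, y = p + \sum_(i < 2) t i *: w i.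
  by move=> /sub_hull; rewrite hG.
have diff y : G y -> exists u : 'rV[R]_2, y - x = u *m \matrix_i w i.
  move=> /coord [t ->]; have [t' ->] := coord x Gx.
  exists (\row_i (t i - t' i)); rewrite mulmx_sum_row opprD addrACA subrr add0r -sumrB.
  by apply: eq_bigr => i _; rewrite rowK mxE scalerBl.
have [u0 E0] := diff _ Gy0; have [u1 E1] := diff _ Gy1; have [u2 E2] := diff _ Gs.
pose C : 'M[R]_(1 + (1 + 1), 2) := col_mx u0 (col_mx u1 u2).
have : kermx C != 0.
  rewrite -mxrank_eq0 mxrank_ker subn_eq0 -ltnNge.
  by rewrite ltnS rank_leq_col.
case/rowV0Pn => r /sub_kermxP; rewrite -[r]hsubmxK -[rsubmx r]hsubmxK.
move: (lsubmx r) (lsubmx (rsubmx r)) (rsubmx (rsubmx r)) => r0 r1 r2.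
rewrite /C !mul_row_col (mx11_scalar r0) (mx11_scalar r1) (mx11_scalar r2) !mul_scalar_mx.
move: (r0 0 0) (r1 0 0) (r2 0 0) => a0 a1 a2 eq nz.
have : a0 *: (y0 - x) + (a1 *: (y1 - x) + a2 *: (x + s *: v - x)) = 0.
  by rewrite E0 E1 E2 !scalemxAl -!mulmxDl eq mul0mx.
rewrite addrAC subrr add0r addrA scalerA => /eqP; rewrite addr_eq0 -scaleNr => /eqP rel.
exists a0, a1, (- (a2 * s)); split=> //; apply: contra_neqT nz.
rewrite negb_or !negbK => /andP[/eqP z0 /eqP z1].
move: rel; rewrite z0 z1 !scale0r addr0 => /esym/eqP.
rewrite scaler_eq0 (negPf v0) orbF oppr_eq0 mulf_eq0 (negPf s0) orbF => /eqP ->.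
by rewrite !raddf0 !row_mx0.
Qed.

(** Cells are extreme: where [Q2] vanishes so do both supporting functions, and a cell is determined
    by its zeros. *)
Lemma cell_between X Q0 Q1 Q2 a0 a1 a2 : cell q X Q2 -> supports X Q0 -> supports X Q1 ->
  quad q Q0 -> 0 < a0 -> 0 < a1 ->
  (forall z, X z -> a0 * Q0 z + a1 * Q1 z + a2 * Q2 z = 0) ->
  forall z, X z -> Q2 z = Q0 z.
Proof.
move=> c2 s0 s1 q0 a00 a10 rel; apply: (cell_unique c2 q0) => z [Xz Q2z]; split=> //.
have /eqP := rel z Xz; rewrite Q2z mulr0 addr0 paddr_eq0; last 2 first.
- by rewrite mulr_ge0 ?s0 ?ltW.
- by rewrite mulr_ge0 ?s1 ?ltW.
by rewrite mulf_eq0 (gt_eqF a00) => /andP[/eqP].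
Qed.

(** A segment has only two ends: of three distinct collinear functions one would lie between the
    others, which [cell_between] excludes. *)
Lemma cells_collinear X Q0 Q1 Q2 a1 a2 : cell q X Q0 -> cell q X Q1 -> cell q X Q2 ->
  (a1 != 0) || (a2 != 0) ->
  (forall z, X z -> a1 * (Q1 z - Q0 z) + a2 * (Q2 z - Q0 z) = 0) ->
  [\/ forall z, X z -> Q0 z = Q1 z, forall z, X z -> Q0 z = Q2 z |
      forall z, X z -> Q1 z = Q2 z].
Proof.
move=> c0 c1 c2 nz rel; have [q0 s0 _] := c0; have [q1 s1 _] := c1; have [q2 s2 _] := c2.
pose a0 := - (a1 + a2).
have relE z : X z -> a0 * Q0 z + a1 * Q1 z + a2 * Q2 z = 0.
  by move=> /rel <-; rewrite /a0; ring.
have [z1|n1] := eqVneq a1 0.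
  move: nz; rewrite z1 eqxx /= => n2; apply: Or32 => z /rel /eqP.
  by rewrite z1 mul0r add0r mulf_eq0 (negPf n2) subr_eq0 => /eqP.
have [z2|n2] := eqVneq a2 0.
  apply: Or31 => z /rel /eqP.
  by rewrite z2 mul0r addr0 mulf_eq0 (negPf n1) subr_eq0 => /eqP.
have [z0|n0] := eqVneq a0 0.
  apply: Or33 => z Xz; have := relE z Xz; rewrite z0 mul0r add0r.
  have -> : a2 = - a1 by move: z0; rewrite /a0; lra.
  by rewrite mulNr -mulrBr => /eqP; rewrite mulf_eq0 (negPf n1) subr_eq0 => /eqP.
have neg z : X z -> - a0 * Q0 z + - a1 * Q1 z + - a2 * Q2 z = 0.
  by move=> /relE h1; rewrite -[RHS]oppr0 -h1; ring.
have sum0 : a0 + a1 + a2 = 0 by rewrite /a0; ring.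
(* As the coefficients sum to 0, one has the sign opposite to the other two; its cell lies between
   theirs. *)
case: (ltgtP a1 0) n1 => [l1|g1|//] _; case: (ltgtP a2 0) n2 => [l2|g2|//] _;
  case: (ltgtP a0 0) n0 => [l0|g0|//] _.
- by lra.
- by apply: Or31 => z Xz; apply: (cell_between c0 s1 s2 q1 (a0 := - a1) (a1 := - a2) (a2 := - a0));
    rewrite ?oppr_gt0 // => w Xw; rewrite -[RHS](neg w Xw); ring.
- by apply: Or32 => z Xz; apply/esym; apply: (cell_between c2 s0 s1 q0 (a0 := - a0) (a1 := - a1) (a2 := - a2));
    rewrite ?oppr_gt0 // => w Xw; rewrite -[RHS](neg w Xw); ring.
- by apply: Or31 => z Xz; apply/esym; apply: (cell_between c1 s0 s2 q0 (a0 := a0) (a1 := a2) (a2 := a1));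
    rewrite // => w Xw; rewrite -[RHS](relE w Xw); ring.
- by apply: Or31 => z Xz; apply/esym; apply: (cell_between c1 s0 s2 q0 (a0 := - a0) (a1 := - a2) (a2 := - a1));
    rewrite ?oppr_gt0 // => w Xw; rewrite -[RHS](neg w Xw); ring.
- by apply: Or32 => z Xz; apply/esym; apply: (cell_between c2 s0 s1 q0 (a0 := a0) (a1 := a1) (a2 := a2));
    rewrite // => w Xw; rewrite -[RHS](relE w Xw); ring.
- by apply: Or31 => z Xz; apply: (cell_between c0 s1 s2 q1 (a0 := a1) (a1 := a2) (a2 := a0));
    rewrite // => w Xw; rewrite -[RHS](relE w Xw); ring.
- by lra.
Qed.

Lemma allgood_closed_zone : allgood q h -> has_closed_zone (voronoi L) e.
Proof.
move=> ag; have sL := sublattice_layer h.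
split.
  have s0 : supports (layer h) (power B 0).
    by move=> z _; rewrite /power dot0r mulr0 subr0 norm2_ge0.
  have [|Q cQ sub] := walk_cell cq sL (power_quad B 0) s0.
    by exists 0; split; [exact: layer0|exact: power0].
  have [_ Q0] : zeros (layer h) Q 0 by apply: sub; split; [exact: layer0|exact: power0].
  have [x vx _] := vertical_of_good cQ Q0 (ag Q cQ).
  by exists (tight_face B (tight B x)); apply: vertical_zone.
move=> G [fG dG].
have [[E ZE EG]|no] := pselect (exists2 E, zone (voronoi L) e E & E `<=` G); last first.
  by left=> E ZE EG; apply: no; exists E.
right; have [x [vx Ex EE]] := zone_vertical ZE.
have Gx := EG x Ex; have [Vx fx flatx] := vx.
have [y Gy yoff] := affdim2_off_line x e dG.
have Vy := face_voronoi fG Gy.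
(* [v] is tight along [E] but not at [y]; keeping its power positive makes the second edge differ
   from [E]. *)
have [v tv yv] : exists2 v, tight B x v & 0 < power B y v.
  apply: contrapT => nv.
  have [|s ys] := @power_layer_eq y x; last exact: yoff ys.
  apply: fx; first exact: quadB (power_quad B y) (power_quad B x).
  move=> z tz; rewrite (proj2 tz) subr0; apply/eqP; rewrite eq_le.
  move/voronoiP: Vy => /(_ z (proj1 tz)) ->; rewrite andbT leNgt; apply/negP => yz.
  by apply: nv; exists z.
have sy : supports (layer h) (power B y) by move=> z [iz _]; move/voronoiP: Vy; apply.
have zy : zeros (layer h) (power B y) 0 by split; [exact: layer0|exact: power0].
have [Q [cQ subQ Qv]] := walk_slack cq sL (power_quad B y) sy (ex_intro _ _ zy) yv.
have [x' vx' x'Q] := vertical_of_good cQ (proj2 (subQ _ zy)) (ag Q cQ).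
have [g Gg rel] := face_relint uB fG Gx.
(* A vector tight on all of [G] is tight at [x], so it lies in the layer, and at [y], so [Q]
   vanishes there. This puts the second edge inside [G]. *)
have zero_tight z : tight B g z -> tight B x' z.
  move=> gz; have xz := rel x Gx z gz; have yz := rel y Gy z gz.
  have lz : layer h z by split; [case: gz|exact: flatx].
  by split; [case: gz|rewrite x'Q //; apply: (proj2 (subQ z _)); split; [|case: yz]].
pose E' := tight_face B (tight B x').
have E'G : E' `<=` G.
  by move=> w [Vw sub]; apply: (face_tight uB fG Gg Vw) => z /zero_tight; apply: sub.
have E'x' : E' x' by split=> //; case: vx'.
have lv : layer h v by split; [case: tv|exact: flatx].
have nEE' : E <> E'.
  move=> EE'; have : E x' by rewrite EE'.
  by rewrite EE => -[_ /(_ v tv) [_]]; rewrite x'Q // => Qv0; rewrite Qv0 ltxx in Qv.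
have [s s0 Gs] : exists2 s, s != 0 & G (x + s *: e).
  have [||s [s_gt0 Vs _]] := ray_end (v := e) Vx.
  - by move=> z /flatx; rewrite dot_height.
  - by have [w iw lw] := exists_above h0; exists w => //; rewrite -dot_height.
  exists s; first exact: lt0r_neq0.
  apply: (face_tight uB fG Gx Vs) => z xz; split; first by case: xz.
  by rewrite power_dir flatx // mulr0 subr0; case: xz.
exists E, E'; split=> // E2; split; last first.
  by move=> [->|->]; split=> //; apply: vertical_zone.
move=> [ZE2 E2G]; have [x2 [vx2 E2x2 E2E]] := zone_vertical ZE2.
have Gx' := E'G x' E'x'; have Gx2 := E2G x2 E2x2.
have [a1 [a2 [c [nz lin]]]] :=
  affdim2_dependent dG Gx Gx' Gx2 dir_neq0 (ex_intro2 _ _ s s0 Gs).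
have [|e1|e1|e1] := cells_collinear (vertical_cell vx) (vertical_cell vx') (vertical_cell vx2) nz.
- move=> z [iz lz].
  have d y0 : power B y0 z - power B x z = - 2 * dot (z *m B) (y0 - x).
    by rewrite dotBr /power; ring.
  have : dot (z *m B) (a1 *: (x' - x) + a2 *: (x2 - x)) = 0.
    by rewrite lin dotZr -dot_height lz mulr0.
  rewrite dotDr !dotZr !d => l0.
  by rewrite !mulrA !(mulrC _ (- 2)) -!mulrA -mulrDr l0 mulr0.
- by case: nEE'; rewrite EE; apply: vertical_edge_eq.
- by left; rewrite E2E EE; apply: vertical_edge_eq => // z lz; rewrite e1.
- by right; rewrite E2E; apply: vertical_edge_eq => // z lz; rewrite e1.
Qed.

End Zones.

(** * From a closed zone to the goodness of all cells *)

Section ClosedZone.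
Variables (R : realType) (n : nat).
Local Notation V := 'rV[R]_n.
Implicit Types (b c g Q : V -> R) (S T X F G E : set V) (x y z : V).
Variables (B : 'M[R]_n) (e : V).
Hypothesis uB : B \in unitmx.
Hypothesis ne : norm2 e = 1.
Let L := lattice_of B.
Let h := e *m B^T.
Let q := sqlen B.
Hypothesis hull_H : affine_hull (L `&` [set x | dot x e = 0]) = [set x | dot x e = 0].

Let cq : coercive q. Proof. exact: coercive_norm2. Qed.
Let h0 : h != 0. Proof. exact: height_neq0. Qed.
Let span_h x : dot x h = 0 -> in_span (layer h) x. Proof. exact: span_height. Qed.

Lemma good_shift Q p : layer h p -> good h (fun z => Q (z + p)) -> good h Q.
Proof.
move=> [ip lp] [k [sk zk]]; exists k.
have iB z : integral z -> integral (z - p).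
  by move=> iz; case: (@sublattice_integral R n) => _ _; apply.
have lz z : dot (z - p) h = dot z h by rewrite dotBl lp subr0.
split=> z iz; first by have := sk _ (iB z iz); rewrite subrK lz.
by have := zk _ (iB z iz); rewrite subrK lz.
Qed.

Lemma cell_shift Q p : layer h p -> cell q (layer h) Q -> cell q (layer h) (fun z => Q (z + p)).
Proof.
have sL := sublattice_layer h; move=> lp [qQ sQ fQ]; split.
- exact: quad_shift (sqlen_shift B) _ _ qQ.
- by move=> z lz; apply: sQ; apply: sublatticeD.
- move=> b hb kb z lz.
  have := @fQ (fun z => b (z - p)) (affine_shift (- p) hb) _ (z + p).
  rewrite addrK; apply; last exact: sublatticeD.
  move=> w [lw Qw]; apply: kb; split; last by rewrite subrK.
  by case: sL => _ _; apply.
Qed.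

(* [b'] spans an extreme ray of the cone of the affine functions that vanish at 0 and are
   nonnegative on the zeros of [Q]; it is reached from [b] with the sum over [s] fixed. *)
Lemma extreme_ray X Q b (s : seq V) : quad q Q -> X `<=` @integral R n ->
  affine b -> b 0 = 0 -> zeros X Q 0 -> supports (zeros X Q) b ->
  exists b', [/\ affine b', b' 0 = 0, supports (zeros X Q) b',
    \sum_(p <- s) b' p = \sum_(p <- s) b p &
    forall c, affine c -> kills (zeros (zeros X Q) b') c -> \sum_(p <- s) c p = 0 ->
      kills (zeros X Q) c].
Proof.
move=> qQ Xi hb b0 Q0 sb; have [l hl] := zeros_seq cq Xi qQ.
have [||| b' [[hb' b'0 sb' e'] stop _]] := @walk R n (zeros X Q)
    (fun b' => [/\ affine b', b' 0 = 0, supports (zeros X Q) b' &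
      \sum_(p <- s) b' p = \sum_(p <- s) b p])
    (fun b' => forall c, affine c -> kills (zeros (zeros X Q) b') c ->
      \sum_(p <- s) c p = 0 -> kills (zeros X Q) c) _ _ b; last by exists b'.
- move=> b' [_ _ sb' _]; split=> // c _; exists l => z /hl //.
- move=> b' [hb' b'0 sb' e'].
  have [st|nst] := pselect (forall c, affine c -> kills (zeros (zeros X Q) b') c ->
      \sum_(p <- s) c p = 0 -> kills (zeros X Q) c); [by left|right].
  have [c [hc kc sc [z zz cz]]] : exists c, [/\ affine c, kills (zeros (zeros X Q) b') c,
      \sum_(p <- s) c p = 0 & exists2 z, zeros X Q z & c z < 0].
    apply: contrapT => no; apply: nst => c hc kc sc z zz; apply/eqP.
    rewrite eq_le !leNgt; apply/andP; split; apply/negP => cz; apply: no; last first.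
      by exists c; split=> //; exists z.
    exists (fun z => - c z); split; first exact: affineN.
    - by move=> w zw; rewrite kc // oppr0.
    - by rewrite sumrN sc oppr0.
    - by exists z; rewrite ?oppr_lt0.
  exists c; split=> //; first by exists z.
  move=> t t0 st; split=> //.
  + exact: affineD hb' (affineZ t hc).
  + by rewrite b'0 kc ?mulr0 ?addr0 //; split.
  + by rewrite big_split /= -mulr_sumr sc mulr0 addr0.
- by split.
Qed.

Lemma tight_face_affdim2 K x y r s : r != 0 -> s != 0 ->
  tight_face B K x -> tight_face B K (x + r *: y) -> tight_face B K (x + s *: e) ->
  (forall t, y <> t *: e) ->
  (forall w, tight_face B K w -> exists a k, w = x + (a *: y + k *: e)) ->
  affdim (tight_face B K) 2.
Proof.
move=> r0 s0 Gx Gy Ge ind span; exists x, (fun i : 'I_2 => if i == 0 then y else e).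
have sum2 (t : 'I_2 -> R) :
    \sum_(i < 2) t i *: (if i == 0 then y else e) = t 0 *: y + t 1 *: e.
  rewrite big_ord_recl big_ord1 /=; congr (_ + t _ *: _); exact/val_inj.
split=> [t|].
  rewrite sum2 => rel; have t0 : t 0 = 0.
    apply/eqP; apply: contrapT => /negP n0; apply: (ind (- (t 0)^-1 * t 1)).
    rewrite -[LHS](scalerK n0) -scalerA scaleNr -scalerN; congr (_ *: _).
    by move/eqP: rel; rewrite addr_eq0 => /eqP.
  move: rel; rewrite t0 scale0r add0r => /eqP; rewrite scaler_eq0 (negPf (dir_neq0 ne)) orbF.
  move=> /eqP t1; case=> [[|[|//]]] lt; first by rewrite -[RHS]t0; congr t; apply: val_inj.
  by rewrite -[RHS]t1; congr t; apply: val_inj.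
apply/seteqP; split=> w.
  move=> [m [p [a [Gp [a1 ->]]]]].
  have /boolp.choice [f fE] : forall i, exists ak : R * R, p i = x + (ak.1 *: y + ak.2 *: e).
    by move=> i; have [u [k pE]] := span _ (Gp i); exists (u, k).
  exists (fun i => if i == 0 then \sum_j a j * (f j).1 else \sum_j a j * (f j).2).
  rewrite sum2 /= !scaler_suml -big_split -[x in RHS]scale1r -a1 scaler_suml -big_split.
  by apply: eq_bigr => i _ /=; rewrite fE !scalerDr !scalerA.
move=> [t ->]; rewrite sum2; apply/hullP => b [a [c bE]] kb.
have bx := kb _ Gx; have by' := kb _ Gy; have be := kb _ Ge.
move: bx by' be; rewrite !bE !dotDl !dotZl => bx by' be.
have ya : dot y a = 0.
  apply/eqP; move: by'; rewrite addrAC bx add0r => /eqP.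
  by rewrite mulf_eq0 (negPf r0).
have ea : dot e a = 0.
  apply/eqP; move: be; rewrite addrAC bx add0r => /eqP.
  by rewrite mulf_eq0 (negPf s0).
by rewrite ya ea !mulr0 !addr0.
Qed.

(** [Qs] is the given cell of the layer, translated to contain 0 so that it competes with functions
    of points of the Voronoi polytope; [P] is the good cell at 0 with the least sum over the zeros
    of [Qs]. *)
Lemma closed_zone_allgood : has_closed_zone (voronoi L) e -> allgood q h.
Proof.
move=> [[E0 ZE0] closed] Q1 cQ1; have sL := sublattice_layer h; have [Li L0 LB] := sL.
have [p [lp Q1p]] := zeros_neq0 L0 cQ1.
apply: (good_shift lp); pose Qs z := Q1 (z + p).
have cQs : cell q (layer h) Qs by apply: cell_shift.
have Qs0 : Qs 0 = 0 by rewrite /Qs add0r.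
have [qQs sQs fQs] := cQs.
have [s hs] := zeros_seq cq Li qQs.
have sum_s Q : supports (layer h) Q -> \sum_(z <- s) Q z = \sum_(z <- s) `|Q z|.
  by move=> sQ; apply: eq_big_seq => z /hs [lz _]; rewrite ger0_norm // sQ.
have [x0 [vx0 _ _]] := zone_vertical uB ZE0.
have [P [cP P0 gP] minP] : exists2 P, [/\ cell q (layer h) P, P 0 = 0 & good h P] &
    forall P', [/\ cell q (layer h) P', P' 0 = 0 & good h P'] ->
      \sum_(z <- s) P z <= \sum_(z <- s) P' z.
  apply: (min_cell (p := 0) (Inv := fun P => [/\ cell q (layer h) P, P 0 = 0 & good h P])
    (f := fun P => \sum_(z <- s) P z) cq sL).
  - exact: in_span_self.
  - move=> Q [cQ Q0 _]; split=> //; rewrite Q0 sum_s ?sumr_ge0 //; by case: cQ.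
  - by move=> Q Q' eQ _ _; apply: eq_big_seq => z /hs [lz _]; apply: eQ.
  - exists (power B x0); split; [exact: vertical_cell vx0|exact: power0|exact: vertical_good vx0].
have [qP sP fP] := cP.
(* With sum 0, [P] vanishes on the zeros of [Qs]; the two then agree on the layer and [Qs] is
   good. *)
have [neg|le0] := ltP 0 (\sum_(z <- s) P z); last first.
  have sub : zeros (layer h) Qs `<=` zeros (layer h) P.
    move=> z zz; split; first by case: zz.
    apply/eqP; rewrite -normr_le0; apply: le_trans le0; rewrite sum_s //.
    by apply: (@sum_gt_term R _ s (fun z => `|P z|)) => //; apply/hs.
  have eQ := cell_unique cQs qP sub.
  have [k kE] : exists k, forall z, Qs z - P z = k * dot z h.
    apply: (affine_layer h0 span_h (quadB qQs qP)) => z lz; by rewrite eQ // subrr.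
  have [k' [sk zk]] := gP.
  have eE z : Qs z + (k' - k) * dot z h = P z + k' * dot z h by rewrite mulrBl -kE; ring.
  by exists (k' - k); split=> z iz; rewrite eE; [apply: sk|apply: zk].
exfalso.
have zP0 : zeros (layer h) P 0 by split.
have sumb : \sum_(z <- s) (Qs z - P z) = - \sum_(z <- s) P z.
  by rewrite -sumrN; apply: eq_big_seq => z /hs [_ ->]; rewrite sub0r.
(* The direction from [P] to [Qs] may lead into a face of larger dimension; an extreme ray with the
   same sum over [s] leads into a 2-face. *)
have [||b [hb b0 sb bsum ext]] := extreme_ray s qP Li (quadB qQs qP) _ zP0.
- by rewrite Qs0 P0 subrr.
- by move=> z [lz Pz]; rewrite Pz subr0; apply: sQs.
rewrite sumb in bsum.
have bneg : \sum_(z <- s) b z != 0 by rewrite bsum oppr_eq0 gt_eqF.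
have not_killed : ~ kills (layer h) b.
  by move=> kb; move/eqP: bneg; apply; rewrite big_seq big1 // => z /hs [lz _]; apply: kb.
have [x vx xP] := vertical_of_good uB cP P0 gP.
have tx : tight B x = zeros (layer h) P.
  rewrite (vertical_tight vx); apply/seteqP; split=> z [lz zz]; split=> //.
    by rewrite -xP.
  by rewrite xP.
have [Vx _ flat] := vx.
pose K := zeros (zeros (layer h) P) b.
have Ktx : K `<=` tight B x by move=> z [zP _]; rewrite tx.
have [y yE] := affine_power uB hb b0.
have [r r_gt0 [Vxy txy]] : exists2 r, 0 < r & voronoi L (x + r *: y) /\ tight B (x + r *: y) = K.
  have [||r r0 /(_ r)[|st zz]] := @perturb R n (@integral R n) _ b (proj1 (voronoiP B x) Vx).
  - exact: quad_sublevel cq (power_quad B x) hb.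
  - move=> z iz xz; apply: sb; rewrite -tx; by split.
  - by rewrite r0 lexx.
  have pE z : power B (x + r *: y) z = power B x z + r * b z by rewrite power_line yE.
  exists r => //; split; first by apply/voronoiP => z iz; rewrite pE; apply: st.
  apply/seteqP; split=> z.
    by move=> [iz]; rewrite pE => /(zz z iz)[xz bz]; split=> //; rewrite -tx.
  by move=> [zP bz]; move: zP; rewrite -tx => -[iz xz]; split=> //; rewrite pE xz bz mulr0 addr0.
pose G := tight_face B K.
have Gx : G x by [].
have fG : is_face (voronoi L) G.
  by rewrite /G -txy; apply: tight_face_is_face.
have [t [t_gt0 Vt _]] : exists t, [/\ 0 < t, voronoi L (x + t *: e) &
    forall r, voronoi L (x + r *: e) -> r <= t].
  apply: (ray_end uB) => // [z /flat|]; first by rewrite dot_height.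
  by have [w iw lw] := exists_above h0; exists w => //; rewrite -dot_height.
(* Modulo the direction of the zone, the face G lies on a line. *)
have along w : G w -> exists a k, forall z, power B w z - power B x z = a * b z + k * dot z h.
  move=> [Vw sub].
  pose c z := power B w z - power B x z.
  have hc : affine c := quadB (power_quad B w) (power_quad B x).
  pose a := (\sum_(z <- s) c z) / (\sum_(z <- s) b z).
  have hd : affine (fun z => c z - a * b z) := affineB hc (affineZ a hb).
  have [k kE] : exists k, forall z, c z - a * b z = k * dot z h.
    apply: (affine_layer h0 span_h hd); apply: fP => //.
    apply: ext => //; last by rewrite sumrB -mulr_sumr divfK // subrr.
    move=> z Kz; have [_ bz] := Kz.
    by rewrite /c (proj2 (sub z Kz)) (proj2 (Ktx z Kz)) bz mulr0 !subr0.
  by exists a, k => z; rewrite -kE -/(c z); ring.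
have dG : affdim G 2.
  apply: (@tight_face_affdim2 K x y r t) => //; try exact: lt0r_neq0.
  - by split=> //; rewrite txy.
  - split=> // z Kz; have [iz xz] := Ktx z Kz; split=> //.
    by rewrite power_dir flat ?mulr0 ?subr0 //; apply: Ktx.
  - move=> a ya; apply: not_killed => z [iz lz].
    by rewrite yE ya dotZr -dot_height lz !mulr0.
  - move=> w /along [a [k rel]]; exists a, (- k / 2); apply/eqP.
    rewrite -subr_eq0 -norm2_eq0; apply/eqP; set d := w - _.
    rewrite /norm2 -{1}(mulmxKV uB d); set z := d *m invmx B.
    have := rel z; rewrite yE /power dot_height /d dotBr !dotDr !dotZr; lra.
have EG x' : K `<=` tight B x' -> tight_face B (tight B x') `<=` G.
  by move=> sub w [Vw tw]; split=> // z /sub; apply: tw.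
have ZE := vertical_zone uB ne hull_H vx.
have EGx := EG x Ktx.
case: (closed G (conj fG dG)) => [no|[E1 [E2 [n12 allE]]]].
  exact: no _ ZE EGx.
have [E' [ZE' E'G nE']] : exists E', [/\ zone (voronoi L) e E', E' `<=` G &
    E' <> tight_face B (tight B x)].
  have [e1|n1] := pselect (E1 = tight_face B (tight B x)).
    have [Z2 G2] := proj2 (allE E2) (or_intror erefl).
    by exists E2; split=> // e2; apply: n12; rewrite e1 e2.
  by have [Z1 G1] := proj2 (allE E1) (or_introl erefl); exists E1.
have [x' [vx' E'x' E'E]] := zone_vertical uB ZE'.
have [a [k rel]] := along x' (E'G x' E'x').
have onl z : layer h z -> power B x' z = P z + a * b z.
  by move=> lz; rewrite -(xP z lz); have := rel z; rewrite (proj2 lz) mulr0 addr0 => <-; ring.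
have [u zu bu] : exists2 u, zeros (layer h) P u & 0 < b u.
  apply: contrapT => no; apply: not_killed; apply: fP => // z zz; apply/eqP.
  by rewrite eq_le sb // andbT leNgt; apply/negP => bz; apply: no; exists z.
(* Nonzero since the edges differ, nonnegative since [P] vanishes and [b] is positive at [u]. As [b]
   has negative sum over [s], [P + a b] has a smaller sum than [P]. *)
have a_gt0 : 0 < a.
  rewrite lt_neqAle; apply/andP; split.
    apply/eqP => a0; apply: nE'; rewrite E'E; apply: (vertical_edge_eq vx' vx) => z lz.
    by rewrite onl // -a0 mul0r addr0 xP.
  have [lu Pu] := zu; have [Vx' _ _] := vx'.
  by move/voronoiP: Vx' => /(_ u (Li u lu)); rewrite onl // Pu add0r pmulr_lge0.
have /minP : [/\ cell q (layer h) (power B x'), power B x' 0 = 0 & good h (power B x')].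
  by split; [exact: vertical_cell vx'|exact: power0|exact: vertical_good vx'].
apply/negP; rewrite -ltNge.
rewrite (eq_big_seq (fun z => P z + a * b z)); last by move=> z /hs [lz _]; apply: onl.
rewrite big_split /= -mulr_sumr bsum gtrDl mulrN oppr_lt0 mulr_gt0 //.
Qed.

End ClosedZone.

(** * Counting the cells at 0 *)

Section Counting.
Variables (R : realType) (n : nat).
Local Notation V := 'rV[R]_n.

Lemma same_Ltype_sym (L1 L2 : set V) : same_Ltype L1 L2 -> same_Ltype L2 L1.
Proof.
move=> [phi [pf [ps po]]].
have /boolp.choice [psi psiP] : forall G, exists F, is_face (voronoi L2) G ->
    is_face (voronoi L1) F /\ phi F = G.
  move=> G; have [fG|nG] := pselect (is_face (voronoi L2) G); last by exists G.
  by have [F [fF e]] := ps G fG; exists F.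
exists psi; split=> [F /psiP []//|]; split=> [F fF|F1 F2 f1 f2].
  exists (phi F); split; first exact: pf.
  have [f e] := psiP _ (pf F fF).
  by apply/seteqP; split; apply/po => //; rewrite e.
have [g1 e1] := psiP _ f1; have [g2 e2] := psiP _ f2.
by rewrite (po _ _ g1 g2) e1 e2.
Qed.

(** The vertices of the Voronoi polytope, described by inclusions of faces so that poset
    isomorphisms respect them. *)
Definition atom (P F : set V) := [/\ is_face P F, exists x, F x &
  forall F', is_face P F' -> (exists x, F' x) -> F' `<=` F -> F `<=` F'].

(** The iterates of [x0] would be pairwise distinct, but their codes lie in a finite type. *)
Lemma no_shift_inj (T : Type) (M : finType) (A : set T) (code : T -> M) (f : T -> T) x0 :
  (forall x y, A x -> A y -> code x = code y -> x = y) -> (forall x, A x -> A (f x)) ->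
  (forall x y, A x -> A y -> f x = f y -> x = y) -> A x0 ->
  (forall x, A x -> f x <> x0) -> False.
Proof.
move=> inj fA finj A0 out.
have Ai i : A (iter i f x0) by elim: i => //= i; apply: fA.
have it i : forall j, iter i f x0 = iter j f x0 -> i = j.
  elim: i => [[|j]//= e|i IH [|j] /= e]; first by case: (out _ (Ai j)).
    by case: (out _ (Ai i)).
  by congr _.+1; apply/IH/finj.
have /leq_card : injective (fun i : 'I_#|M|.+1 => code (iter i f x0)).
  by move=> i j /inj e; apply/val_inj/it/e.
by rewrite card_ord ltnn.
Qed.

Lemma finite_small (I : finType) (P : I -> R -> Prop) :
  (forall i, exists2 t0, 0 < t0 & forall t, 0 < t <= t0 -> P i t) ->
  exists2 t0, 0 < t0 & forall i t, 0 < t <= t0 -> P i t.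
Proof.
move=> ex; suff [t0 t0_gt0 h] : exists2 t0, 0 < t0 &
    forall i, i \in enum I -> forall t, 0 < t <= t0 -> P i t.
  by exists t0 => // i; apply: h; rewrite mem_enum.
elim: (enum I) => [|i s [t0 t00 h]]; first by exists 1.
have [t1 t10 h1] := ex i; exists (Num.min t0 t1); first by rewrite lt_min t00.
move=> j; rewrite inE => js t /andP[t_gt0]; rewrite le_min => /andP[le0 le1].
by case/orP: js => [/eqP->|js]; [apply: h1|apply: h]; rewrite ?t_gt0.
Qed.

Definition star q : set (set V) := [set S | del q S /\ S 0].

Lemma star_code q : coercive q -> exists (M : finType) (code : set V -> M),
  forall S S', star q S -> star q S' -> code S = code S' -> S = S'.
Proof.
move=> cq; have sI := @sublattice_integral R n.
have [s hs] := zeros_bounded 0 cq sI (in_span_self (@integral0 R n)).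
exists {ffun 'I_(size s) -> bool}, (fun S => [ffun i => `[< S (nth 0 s (val i)) >]]).
have sub S z : star q S -> S z -> z \in s.
  by move=> [[Q [qQ sQ fQ] ->] [_ Q0]] /(hs Q qQ sQ); rewrite Q0 lexx; apply.
have half S S' : star q S -> [ffun i : 'I_(size s) => `[< S (nth 0 s (val i)) >]] =
    [ffun i => `[< S' (nth 0 s (val i)) >]] -> S `<=` S'.
  move=> SS /ffunP e z Sz; have zs := sub S z SS Sz.
  have si : (index z s < size s)%N by rewrite index_mem.
  have := e (Ordinal si); rewrite !ffunE /= nth_index // => eb.
  by apply/asboolP; rewrite -eb; apply/asboolP.
by move=> S S' SS SS' e; apply/seteqP; split; apply: half.
Qed.

Lemma star_vertex B S : B \in unitmx -> star (sqlen B) S ->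
  exists x, [/\ voronoi (lattice_of B) x, tight B x = S & tight_face B S = [set x]].
Proof.
move=> uB [[Q cQ ->] [_ Q0]]; have [qQ sQ fQ] := cQ.
have [x xE] := quad_power uB qQ Q0.
have Qx : Q = power B x by apply/funext.
have Vx : voronoi (lattice_of B) x by apply/voronoiP; rewrite -Qx.
exists x; split=> //; first by rewrite /tight -Qx.
apply/seteqP; split=> y; last by move=> ->; split=> // z; rewrite /tight -Qx.
move=> [Vy sub]; have e := cell_unique cQ (power_quad B y) sub.
have k : kills (@integral R n) (fun z => power B y z - power B x z).
  by move=> z iz; rewrite -e // -xE subrr.
have hd := quadB (power_quad B y) (power_quad B x).
apply/eqP; rewrite -subr_eq0 -norm2_eq0 /norm2 -{1}(mulmxKV uB (y - x)); apply/eqP.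
set z := _ *m invmx B; have := in_span_integral z hd k.
by rewrite /power dotBr; lra.
Qed.

Lemma star_atom B S : B \in unitmx -> star (sqlen B) S ->
  atom (voronoi (lattice_of B)) (tight_face B S).
Proof.
move=> uB sS; have [x [Vx tx e]] := star_vertex uB sS; split.
- by rewrite -tx; apply: tight_face_is_face.
- by exists x; rewrite e.
- by rewrite e => F' _ [y F'y] sub w ->; rewrite -(sub y F'y).
Qed.

(** Walking from the function of a point of [F] to a cell keeps the tight vectors, so it ends at a
    vertex of the same face. *)
Lemma atom_star B F : B \in unitmx -> atom (voronoi (lattice_of B)) F ->
  exists2 S, star (sqlen B) S & F = tight_face B S.
Proof.
move=> uB [fF [x Fx] min]; have cq := coercive_norm2 uB.
have Vx := face_voronoi fF Fx.
have [Q cQ sub] := walk_cell cq (@sublattice_integral R n) (power_quad B x)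
  (proj1 (voronoiP B x) Vx) (ex_intro _ _ (tight0 B x)).
pose S := zeros (@integral R n) Q.
have sS : star (sqlen B) S by split; [exists Q|apply: sub; apply: tight0].
have [y [Vy ty e]] := star_vertex uB sS.
exists S => //; have Fy : F y by apply: (face_tight uB fF Fx Vy); rewrite ty.
have [fS _ _] := star_atom uB sS.
apply/seteqP; split; last by rewrite e => w ->.
apply: min => //; first by exists y; rewrite e.
by rewrite e => w ->.
Qed.

Lemma same_Ltype_star B1 B2 : B1 \in unitmx -> B2 \in unitmx ->
  same_Ltype (lattice_of B1) (lattice_of B2) ->
  exists f, (forall S, star (sqlen B1) S -> star (sqlen B2) (f S)) /\
    forall S S', star (sqlen B1) S -> star (sqlen B1) S' -> f S = f S' -> S = S'.
Proof.
move=> u1 u2 [phi [pf [ps po]]].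
have f01 := face0 (voronoi (lattice_of B1)); have f02 := face0 (voronoi (lattice_of B2)).
have phi_atom F : atom (voronoi (lattice_of B1)) F -> atom (voronoi (lattice_of B2)) (phi F).
  move=> [fF [x Fx] min]; split; first exact: pf.
    (* [phi] is not given to preserve the empty face: if [phi F] were empty, it would lie in
       [phi set0], and [F] in the empty face. *)
    apply: contrapT => no; have [F0 [fF0 e0]] := ps _ f02.
    have [y] : exists y, phi set0 y.
      have /(_ x Fx) // : F `<=` set0.
      apply/(po _ _ fF f01) => z Fz; by case: no; exists z.
    move=> p0y; have : phi set0 `<=` phi F by apply/(po _ _ f01 fF).
    by move/(_ y p0y) => Fy; case: no; exists y.
  move=> G fG [y Gy]; have [F2 [fF2 e2]] := ps G fG.
  rewrite -e2 => /(po _ _ fF2 fF) sub; apply/(po _ _ fF fF2).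
  apply: min => //; apply: contrapT => no.
  have [F0 [fF0 e0]] := ps _ f02.
  have : phi F2 `<=` phi F0 by apply/(po _ _ fF2 fF0) => z F2z; case: no; exists z.
  by rewrite e2 e0 => /(_ y Gy).
have /boolp.choice [f fP] : forall S, exists S', star (sqlen B1) S ->
    star (sqlen B2) S' /\ phi (tight_face B1 S) = tight_face B2 S'.
  move=> S; have [sS|nS] := pselect (star (sqlen B1) S); last by exists S.
  by have [S' sS' e] := atom_star u2 (phi_atom _ (star_atom u1 sS)); exists S'.
exists f; split=> [S /fP []//|S S' sS sS' e].
have [_ p1] := fP S sS; have [_ p2] := fP S' sS'.
have [fS _ _] := star_atom u1 sS; have [fS' _ _] := star_atom u1 sS'.
have [x [Vx tx ex]] := star_vertex u1 sS; have [x' [Vx' tx' ex']] := star_vertex u1 sS'.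
have : tight_face B1 S `<=` tight_face B1 S' by apply/(po _ _ fS fS'); rewrite p1 p2 e.
by rewrite ex ex' -tx -tx' => /(_ x erefl) ->.
Qed.

Section Pieces.
Variables (q : V -> R) (h : V).
Hypothesis cq : coercive q.
Hypothesis shift_q : forall v, affine (fun z => q (z + v) - q z).
Let cells := zeros (@integral R n).

(** A piece is a lower face of the graph of the squared height over the vertices of the cell; the
    pieces subdivide the cell when [q] is slightly stretched. *)
Definition piece Q (g : V -> R) := [/\ affine (fun z => g z - dot z h ^+ 2),
  supports (cells Q) g & full (cells Q) (zeros (cells Q) g)].

Lemma walk_piece Q g : quad q Q -> affine (fun z => g z - dot z h ^+ 2) ->
  supports (cells Q) g -> exists2 g', piece Q g' & zeros (cells Q) g `<=` zeros (cells Q) g'.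
Proof.
move=> qQ hg sg; have [l hl] := zeros_seq cq (let: And3 x _ _ := @sublattice_integral R n in x) qQ.
have [|||g' [[hg' sg'] fg' sub]] := @walk R n (cells Q)
  (fun g => affine (fun z => g z - dot z h ^+ 2) /\ supports (cells Q) g)
  (fun g => full (cells Q) (zeros (cells Q) g)) _ _ g; last by exists g'.
- by move=> g1 [_ s1]; split=> // b _; exists l => z /hl.
- move=> g1 [h1 s1].
  have [f1|nf] := pselect (full (cells Q) (zeros (cells Q) g1)); [by left|right].
  have [b [hb kb [z Dz bz]]] : exists b, [/\ affine b, kills (zeros (cells Q) g1) b &
      exists2 z, cells Q z & b z < 0].
    apply: contrapT => no; apply: nf => b hb kb z Dz; apply/eqP.
    rewrite eq_le !leNgt; apply/andP; split; apply/negP => bz; apply: no; last first.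
      by exists b; split=> //; exists z.
    exists (fun z => - b z); split; first exact: affineN.
    - by move=> w zw; rewrite kb // oppr0.
    - by exists z; rewrite ?oppr_lt0.
  exists b; split=> //; first by exists z.
  move=> t t0 st; split=> //.
  by apply: (eq_affine (affineD h1 (affineZ t hb))) => w; ring.
- by split.
Qed.

(** For small [t], [Q + t g] supports the lattice by [perturb] and vanishes exactly at the common
    zeros of [Q] and [g]. *)
Lemma piece_star Q g : cell q (@integral R n) Q -> Q 0 = 0 -> piece Q g -> g 0 = 0 ->
  exists2 t0, 0 < t0 & forall t, 0 < t <= t0 -> star (stretch q h t) (zeros (cells Q) g).
Proof.
move=> [qQ sQ fQ] Q0 [hg sg fg] g0.
have [||t0 t00 ht] := @perturb R n (@integral R n) Q g sQ.
- apply: sublevel_finite_le (quad_sublevel cq qQ hg) => z _.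
  by rewrite lerD2l gerBl sqr_ge0.
- by move=> z iz Qz; apply: sg.
exists t0 => // t /[dup] /andP[t_gt0 _] /ht [st zt].
have zE : zeros (cells Q) g = cells (fun z => Q z + t * g z).
  apply/seteqP; split=> z.
    by move=> [[iz Qz] gz]; split=> //; rewrite Qz gz mulr0 addr0.
  by move=> [iz /(zt z iz)[]]; split.
split; last by split=> //; split=> //; apply: integral0.
exists (fun z => Q z + t * g z) => //; split=> //.
  apply: (eq_affine (affineD qQ (affineZ t hg))) => z; by rewrite /stretch; ring.
by move=> b hb kb; apply: fQ => //; apply: fg => //; rewrite zE.
Qed.

Definition flat Q := exists2 a, affine a & forall z, cells Q z -> dot z h ^+ 2 + a z = 0.

(* A second piece adjacent to the piece of [g], at a zero [p] of [g] that is extreme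
   in the direction of the tangent to the parabola at a point where [g] is positive. *)
Lemma two_pieces Q : cell q (@integral R n) Q -> ~ flat Q -> exists Q' g g',
  [/\ cell q (@integral R n) Q', Q' 0 = 0, piece Q' g /\ g 0 = 0, piece Q' g' /\ g' 0 = 0 &
      zeros (cells Q') g <> zeros (cells Q') g'].
Proof.
move=> cQ nf; have sI := @sublattice_integral R n; have [qQ sQ fQ] := cQ.
have [iI i0 iB] := sI; have [s hs] := zeros_seq cq iI qQ.
pose tangent v z := (dot z h - dot v h) ^+ 2.
have htan v : affine (fun z => tangent v z - dot z h ^+ 2).
  apply: (eq_affine (affineD (affineZ (- 2 * dot v h) (affine_dot h)) (affine_cst (dot v h ^+ 2)))).
  by move=> z; rewrite /tangent; ring.
have stan v : supports (cells Q) (tangent v) by move=> z _; apply: sqr_ge0.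
have [x0 Dx0] := zeros_neq0 i0 cQ.
have [g pg subg] := walk_piece qQ (htan x0) (stan x0); have [hg sg fg] := pg.
have [_ gx0] : zeros (cells Q) g x0.
  by apply: subg; split=> //; rewrite /tangent subrr expr0n.
have [v Dv gv] : exists2 v, cells Q v & 0 < g v.
  apply: contrapT => no; apply: nf; exists (fun z => g z - dot z h ^+ 2) => // z Dz.
  rewrite addrC subrK; apply/eqP; rewrite eq_le sg // andbT leNgt; apply/negP => gz.
  by apply: no; exists z.
pose k z := tangent v z - g z.
have hk : affine k by apply: (eq_affine (affineB (htan v) hg)) => z; rewrite /k; ring.
have [|p [ps gp pmin]] := @seq_min R _ s (fun z => g z = 0) k.
  by exists x0 => //; apply/hs.
have Dp : cells Q p by apply/hs.
(* [k'] vanishes at [p], is nonnegative at the zeros of [g] and negative at [v], so adding a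
   multiple of it keeps the zero [p] and creates a zero [u] where [g] is positive. *)
pose k' z := k z - k p; have hk' : affine k' := affineB hk (affine_cst (k p)).
have k'p : k' p = 0 by rewrite /k' subrr.
have k'g z : cells Q z -> g z = 0 -> 0 <= k' z.
  by move=> /hs zs gz; rewrite subr_ge0 pmin.
have kp : 0 <= k p by rewrite /k gp subr0 sqr_ge0.
have kv : k v = - g v by rewrite /k /tangent subrr expr0n sub0r.
have k'v : k' v < 0 by rewrite /k' kv subr_lt0 (lt_le_trans _ kp) // oppr_lt0.
have [||t [t0 st [u Du [k'u gu]]]] := @hit R n (cells Q) g k' sg.
- by move=> t _; exists s => z /hs.
- by exists v.
have [|g' pg' subg'] := walk_piece qQ (g := fun z => g z + t * k' z) _ st.
  by apply: (eq_affine (affineD hg (affineZ t hk'))) => z; ring.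
have [_ g'p] : zeros (cells Q) g' p.
  by apply: subg'; split=> //; rewrite gp k'p mulr0 addr0.
have [_ g'u] : zeros (cells Q) g' u by apply: subg'.
have gu0 : g u <> 0 by move=> gu0; have := k'g u Du gu0; rewrite leNgt k'u.
have ip : integral p by case: Dp.
(* Translating [p] to 0 brings both pieces into the star. *)
pose Q' z := Q (z + p).
have DE z : cells Q' z <-> cells Q (z + p).
  split=> [[iz Qz]|[izp Qz]]; split=> //; first exact: (sublatticeD sI).
  by rewrite -[z](addrK p); apply: iB.
have shift_piece f : piece Q f -> piece Q' (fun z => f (z + p)).
  move=> [hf sf ff]; split.
  - apply: (eq_affine (affineD (affine_shift p hf) (affineD (affineZ (2 * dot p h) (affine_dot h))
      (affine_cst (dot p h ^+ 2))))) => z; by rewrite dotDl; ring.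
  - by move=> z /DE; apply: sf.
  - move=> b hb kb z /DE Dz.
    have := ff (fun z => b (z - p)) (affine_shift (- p) hb) _ _ Dz.
    rewrite addrK; apply=> w [Dw fw]; apply: kb.
    by split; [apply/DE; rewrite subrK|rewrite subrK].
exists Q', (fun z => g (z + p)), (fun z => g' (z + p)); split.
- split; first exact: quad_shift.
    by move=> z iz; apply: sQ; apply: (sublatticeD sI).
  move=> b hb kb z iz.
  have := fQ (fun z => b (z - p)) (affine_shift (- p) hb) _ (z + p) (sublatticeD sI iz ip).
  rewrite addrK; apply=> w Dw; apply: kb; apply/DE; by rewrite subrK.
- by rewrite /Q' add0r; case: Dp.
- by split; [exact: shift_piece|rewrite add0r].
- by split; [exact: shift_piece|rewrite add0r].
- move=> e; have : zeros (cells Q') (fun z => g' (z + p)) (u - p).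
    by split; [apply/DE; rewrite subrK|rewrite subrK].
  by rewrite -e => -[_]; rewrite subrK.
Qed.

(* Each cell of the star keeps at least one piece, and the cell of [two_pieces] two. *)
Lemma star_grows Q : cell q (@integral R n) Q -> ~ flat Q ->
  exists t f S', [/\ 0 < t, (forall S, star q S -> star (stretch q h t) (f S)),
    (forall S S', star q S -> star q S' -> f S = f S' -> S = S'),
    star (stretch q h t) S' & forall S, star q S -> f S <> S'].
Proof.
move=> cQ nf; have [Q' [g [g' [cQ' Q'0 [pg g0] [pg' g'0] ngg']]]] := two_pieces cQ nf.
have sI := @sublattice_integral R n.
have [M [code codeP]] := star_code cq.
have [t1 t10 h1] := piece_star cQ' Q'0 pg g0.
have [t2 t20 h2] := piece_star cQ' Q'0 pg' g'0.
(* Each cell at 0 has a piece containing 0, where the squared height vanishes; the bounds on [t]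
   become uniform over the finitely many codes. *)
have [t3 t30 h3] : exists2 t0, 0 < t0 & forall m t, 0 < t <= t0 ->
    forall S, star q S -> code S = m -> exists2 S', star (stretch q h t) S' & S' `<=` S.
  apply: finite_small => m.
  have [[S [sS Sm]]|no] := pselect (exists S, star q S /\ code S = m); last first.
    by exists 1 => // t _ S sS Sm; case: no; exists S.
  have [[Q1 cQ1 SE] S0] := sS.
  have [_ Q10] : zeros (@integral R n) Q1 0 by rewrite -SE.
  have [qQ1 _ _] := cQ1.
  have [||g1 pg1 sub1] := @walk_piece Q1 (fun z => dot z h ^+ 2) qQ1.
  - by apply: (eq_affine (affine_cst 0)) => z; rewrite subrr.
  - by move=> z _; apply: sqr_ge0.
  have [_ g10] : zeros (cells Q1) g1 0.
    by apply: sub1; split; [rewrite /cells -SE|rewrite dot0l expr0n].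
  have [t0 t00 h0] := piece_star cQ1 Q10 pg1 g10; exists t0 => // t ht S1 sS1 S1m.
  have -> : S1 = S by apply: codeP => //; rewrite S1m.
  exists (zeros (cells Q1) g1); first exact: h0.
  by rewrite SE => z [].
pose t := Num.min t1 (Num.min t2 t3).
have t_gt0 : 0 < t by rewrite !lt_min t10 t20.
have le1 : 0 < t <= t1 by rewrite t_gt0 ge_min lexx.
have le2 : 0 < t <= t2 by rewrite t_gt0 !ge_min lexx orbT.
have le3 : 0 < t <= t3 by rewrite t_gt0 !ge_min lexx !orbT.
have /boolp.choice [f fP] : forall S, exists S', star q S ->
    star (stretch q h t) S' /\ S' `<=` S.
  move=> S; have [sS|nS] := pselect (star q S); last by exists S.
  by have [S' sS' sub] := h3 _ t le3 S sS erefl; exists S'.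
(* A cell of the stretched form is full, so it lies in at most one cell of [q]. *)
have common S1 S2 T : star q S1 -> star q S2 -> star (stretch q h t) T ->
    T `<=` S1 -> T `<=` S2 -> S1 = S2.
  move=> [[Q1 [q1 _ _] ->] _] [[Q2 [q2 _ _] ->] _] [[QT [_ _ fT] TE] _] sub1 sub2.
  have e z : integral z -> Q1 z = Q2 z.
    move=> iz; apply/eqP; rewrite -subr_eq0; apply/eqP.
    apply: (fT _ (quadB q1 q2)) => // w; rewrite -TE => Tw.
    by rewrite (proj2 (sub1 w Tw)) (proj2 (sub2 w Tw)) subrr.
  by apply/seteqP; split=> z [iz]; [rewrite e|rewrite -e].
pose D := cells Q'; have sD : star q D.
  by split; [exists Q'|split=> //; apply: integral0].
have out T : star (stretch q h t) T -> T `<=` D -> f D <> T -> forall S, star q S -> f S <> T.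
  move=> sT TD nT S sS fS; have [_ sub] := fP S sS; rewrite fS in sub.
  by apply: nT; rewrite -fS; congr f; apply: common sub.
have inj S1 S2 : star q S1 -> star q S2 -> f S1 = f S2 -> S1 = S2.
  move=> s1 s2 e; have [sf1 sub1] := fP S1 s1; have [_ sub2] := fP S2 s2.
  by apply: (common _ _ (f S1)) => //; rewrite e.
(* [f D] is at most one of the two pieces of [D]; the other is missed by [f]. *)
have [e|ne] := pselect (f D = zeros (cells Q') g).
  exists t, f, (zeros (cells Q') g'); split=> // [S /fP []//||].
    exact: h2.
  by apply: out; [exact: h2|move=> z []|rewrite e].
exists t, f, (zeros (cells Q') g); split=> // [S /fP []//||].
  exact: h1.
by apply: out; [exact: h1|move=> z []|].
Qed.

End Pieces.

(** With l the height, were l^2 + a negative at a lattice point, some Q + t (l^2 + a) would gain a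
    zero [u] with that sign while keeping the zeros of Q. It is a cell of the form stretched by [t];
    flatness there gives an affine function equal to a by fullness, so l^2 + a vanishes at [u], a
    contradiction. *)
Lemma flat_parabolic q h : coercive q ->
  (forall lam, 0 <= lam -> forall Q, cell (stretch q h lam) (@integral R n) Q -> flat h Q) ->
  forall Q, cell q (@integral R n) Q -> parabolic h Q.
Proof.
move=> cq fl Q cQ; have [qQ sQ fQ] := cQ.
have c0 : cell (stretch q h 0) (@integral R n) Q.
  by split=> //; apply: (eq_affine qQ) => z; rewrite /stretch mul0r addr0.
have [a ha az] := fl 0 (lexx 0) Q c0.
exists a => //; split; last by move=> z iz Qz; apply: az; split.
move=> z iz; rewrite leNgt; apply/negP => neg.
have [||t [t0 st [u iu [au Qu]]]] := @hit R n (@integral R n) Q (fun z => dot z h ^+ 2 + a z) sQ.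
- move=> t t0; apply: sublevel_finite_le (quad_sublevel cq qQ (affineZ t ha)) => w _.
  by rewrite lerD2l ler_wpM2l // lerDr sqr_ge0.
- by exists z.
pose Q' z := Q z + t * (dot z h ^+ 2 + a z).
have sub : zeros (@integral R n) Q `<=` zeros (@integral R n) Q'.
  by move=> w zw; split; [case: zw|rewrite /Q' az // (proj2 zw) mulr0 addr0].
have cQ' : cell (stretch q h t) (@integral R n) Q'.
  split=> //; last by move=> b hb kb; apply: fQ => // w /sub; apply: kb.
  by apply: (eq_affine (affineD qQ (affineZ t ha))) => w; rewrite /stretch /Q'; ring.
have [a' ha' a'z] := fl t t0 Q' cQ'.
have : a u - a' u = 0.
  apply: (fQ _ (affineB ha ha')) => // w zw.
  by have := az w zw; have := a'z w (sub w zw); lra.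
have : dot u h ^+ 2 + a' u = 0 by apply: a'z; split.
by lra.
Qed.

End Counting.

(** * Extended lattices and the L-type domain *)

Section Extension.
Variables (R : realType) (n : nat).
Local Notation V := 'rV[R]_n.
Implicit Types (B : 'M[R]_n) (e z : V) (lam eps : R).

Lemma stretchD (q : V -> R) h lam eps :
  stretch (stretch q h lam) h eps = stretch q h (lam + eps).
Proof. by apply/funext => z; rewrite /stretch; ring. Qed.

Lemma sqlen_ext B e eps : norm2 e = 1 ->
  sqlen (B *m ext_mx e eps) = stretch (sqlen B) (e *m B^T) (eps * (2 + eps)).
Proof.
move=> ne; apply/funext => z; rewrite /stretch dot_height /sqlen.
have -> : z *m (B *m ext_mx e eps) = z *m B + (eps * dot (z *m B) e) *: e.
  rewrite mulmxA /ext_mx mulmxDr mulmx1 -scalemxAr mulmxA -scalerA; congr (_ + _ *: _).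
  by rewrite (mx11_scalar (z *m B *m e^T)) mul_scalar_mx.
by rewrite norm2D /norm2 dotZl !dotZr -/(norm2 e) ne; ring.
Qed.

Lemma sqlen_gt0 B z : B \in unitmx -> z != 0 -> 0 < sqlen B z.
Proof.
move=> uB z0; rewrite lt_neqAle norm2_ge0 andbT eq_sym norm2_eq0.
by apply: contra_neq z0 => zB; rewrite -(mulmxK uB z) zB mul0mx.
Qed.

Lemma ext_unitmx B e eps : B \in unitmx -> norm2 e = 1 -> 0 <= eps ->
  B *m ext_mx e eps \in unitmx.
Proof.
move=> uB ne eps0; rewrite -row_free_unit; apply: inj_row_free => v v0; apply/eqP.
apply: contraT => /(sqlen_gt0 uB) lt.
have : sqlen (B *m ext_mx e eps) v = 0 by rewrite /sqlen v0 /norm2 dot0l.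
rewrite sqlen_ext // /stretch.
have := mulr_ge0 (mulr_ge0 eps0 (addr_ge0 (ler0n R 2) eps0)) (sqr_ge0 (dot v (e *m B^T))).
lra.
Qed.

(** For [lam >= 0], [Num.sqrt (1 + lam) - 1] is the nonnegative root of [eps * (2 + eps) = lam]. *)
Definition ext_basis B e lam := B *m ext_mx e (Num.sqrt (1 + lam) - 1).

Lemma ext_factor_ge0 lam : 0 <= lam -> 0 <= Num.sqrt (1 + lam) - 1.
Proof. by move=> l0; rewrite subr_ge0 -[leLHS]sqrtr1 ler_wsqrtr // lerDl. Qed.

Lemma ext_factor_gt0 lam : 0 < lam -> 0 < Num.sqrt (1 + lam) - 1.
Proof.
by move=> l0; rewrite subr_gt0 -[ltLHS]sqrtr1 ltr_sqrt ?ltrDl // ltr_pwDl // ltW.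
Qed.

Lemma ext_basis_unit B e lam : B \in unitmx -> norm2 e = 1 -> 0 <= lam ->
  ext_basis B e lam \in unitmx.
Proof. by move=> uB ne l0; apply: ext_unitmx => //; apply: ext_factor_ge0. Qed.

Lemma sqlen_ext_basis B e lam : norm2 e = 1 -> 0 <= lam ->
  sqlen (ext_basis B e lam) = stretch (sqlen B) (e *m B^T) lam.
Proof.
move=> ne l0; rewrite sqlen_ext //; congr stretch.
have h : 0 <= 1 + lam by rewrite addr_ge0.
have -> : (Num.sqrt (1 + lam) - 1) * (2 + (Num.sqrt (1 + lam) - 1)) =
  Num.sqrt (1 + lam) ^+ 2 - 1 by ring.
by rewrite sqr_sqrtr //; ring.
Qed.

Lemma del_setsE (G B : 'M[R]_n) : B \in unitmx -> (forall x, qf G x = sqlen B x) ->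
  del_sets G = del (sqlen B).
Proof.
move=> uB GE; rewrite /del_sets (_ : qf G = sqlen B); last exact/funext.
have full_affdim S : affdim S n <-> full (@integral R n) S.
  rewrite affdim_full; split=> [hS b hb kb z iz|fS].
    have : affine_hull S z by rewrite hS.
    by move=> /hullP; apply.
  apply/seteqP; split=> // x _; apply/hullP => b hb kb.
  by apply: in_span_integral => //; apply: fS.
have sub c z : sqlen B (z - c) = norm2 (z *m B - c *m B) by rewrite /sqlen mulmxBl.
apply/seteqP; split=> S.
  move=> [c [r [le [SE /full_affdim fS]]]].
  have zE : S = zeros (@integral R n) (fun z => norm2 (z *m B - c *m B) - r).
    rewrite SE; apply/seteqP; split=> z [iz] /=; rewrite ?sub.
      by move=> zr; split=> //; rewrite zr subrr.
    by move=> /eqP; rewrite subr_eq0 => /eqP; split.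
  exists (fun z => norm2 (z *m B - c *m B) - r) => //.
  split; [exact: sphere_quad|by move=> z iz; rewrite subr_ge0 -sub; apply: le|].
  by rewrite -zE.
move=> [Q [qQ sQ fQ] SE]; have [o [r oE]] := quad_sphere uB qQ.
have oE' z : Q z = sqlen B (z - o *m invmx B) - r by rewrite oE sub mulmxKV.
exists (o *m invmx B), r; split; first by move=> z iz; rewrite -subr_ge0 -oE'; apply: sQ.
split; last by apply/full_affdim; rewrite SE.
rewrite SE; apply/seteqP; split=> z [iz].
  by rewrite oE' => /eqP; rewrite subr_eq0 => /eqP; split.
by move=> zr; split=> //; rewrite oE' zr subrr.
Qed.

Lemma qf_gram B x : qf (B *m B^T) x = sqlen B x.
Proof. by rewrite /qf /sqlen /norm2 /dot trmx_mul !mulmxA. Qed.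

(** The second matrix defines the squared length in the extended basis, so its symmetry and
    positivity are automatic and only the cells matter. *)
Lemma Ldomain_ext B e lam : B \in unitmx -> norm2 e = 1 -> 0 <= lam ->
  Ldomain (B *m B^T) (B *m B^T + lam *: ((B *m e^T) *m (B *m e^T)^T)) <->
  del (stretch (sqlen B) (e *m B^T) lam) = del (sqlen B).
Proof.
move=> uB ne l0; set G := _ + _.
have uL := ext_basis_unit uB ne l0.
have GE x : qf G x = sqlen (ext_basis B e lam) x.
  rewrite sqlen_ext_basis // /stretch -qf_gram /qf mulmxDr mulmxDl mxE; congr (_ + _).
  rewrite -scalemxAr -scalemxAl mxE; congr (_ * _).
  rewrite dot_height /dot -[x *m B *m e^T]mulmxA; move: (B *m e^T) => u.
  have -> : x *m (u *m u^T) *m x^T = (x *m u) *m (x *m u)^T by rewrite trmx_mul !mulmxA.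
  by rewrite mxE big_ord1 [X in _ * X]mxE expr2.
have dG := del_setsE uL GE; have dF := del_setsE uB (@qf_gram B).
rewrite sqlen_ext_basis // in dG.
split=> [[_ [_]]|dE]; first by rewrite dG dF.
split; first by rewrite /G linearD linearZ /= !trmx_mul !trmxK.
split; last by rewrite dG dF.
by move=> x x0; rewrite GE; apply: sqlen_gt0.
Qed.

(* Were some cell not flat, stretching a little more would enlarge the star at 0, hence
   the number of vertices of the Voronoi polytope. *)
Lemma same_Ltype_parabolic B e : B \in unitmx -> norm2 e = 1 ->
  (forall eps, 0 < eps -> same_Ltype (lattice_of B) (lattice_of (B *m ext_mx e eps))) ->
  forall Q, cell (sqlen B) (@integral R n) Q -> parabolic (e *m B^T) Q.
Proof.
move=> uB ne same; have cq := coercive_norm2 uB; set h := e *m B^T.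
have inj lam : 0 <= lam -> exists f,
    (forall S, star (sqlen B) S -> star (stretch (sqlen B) h lam) (f S)) /\
    forall S S', star (sqlen B) S -> star (sqlen B) S' -> f S = f S' -> S = S'.
  rewrite le_eqVlt => /orP[/eqP <-|l0].
    exists id; split=> // S.
    by rewrite (_ : stretch _ _ _ = sqlen B) //; apply/funext => z; rewrite /stretch mul0r addr0.
  rewrite -sqlen_ext_basis ?ltW //; apply: same_Ltype_star => //.
    by apply: ext_basis_unit => //; apply: ltW.
  by apply: same; apply: ext_factor_gt0.
have inj' lam : 0 < lam -> exists f,
    (forall S, star (stretch (sqlen B) h lam) S -> star (sqlen B) (f S)) /\
    forall S S', star (stretch (sqlen B) h lam) S -> star (stretch (sqlen B) h lam) S' ->
      f S = f S' -> S = S'.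
  move=> l0; rewrite -sqlen_ext_basis ?ltW //; apply: same_Ltype_star => //.
    by apply: ext_basis_unit => //; apply: ltW.
  by apply: same_Ltype_sym; apply: same; apply: ext_factor_gt0.
apply: flat_parabolic => // lam l0 Q cQ; apply: contrapT => nf.
have cl := stretch_coercive h l0 cq.
have sl v : affine (fun z => stretch (sqlen B) h lam (z + v) - stretch (sqlen B) h lam z).
  by rewrite -sqlen_ext_basis //; apply: sqlen_shift.
have [t [f [S' [t0 ff finj sS' out]]]] := star_grows cl sl cQ nf.
rewrite stretchD in ff sS'.
have lt0 : 0 < lam + t by rewrite ltr_wpDl.
(* Going from [lam + t] to 0, to [lam] and back to [lam + t] maps the last star injectively into
   itself and misses [S']. *)
have [g [gf ginj]] := inj' _ lt0; have [k [kf kinj]] := inj _ l0.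
have [M [code codeP]] := star_code (stretch_coercive h (ltW lt0) cq).
apply: (@no_shift_inj _ M (star (stretch (sqlen B) h (lam + t))) code
  (fun S => f (k (g S))) S') => //.
- by move=> S sS; apply/ff/kf/gf.
- move=> S1 S2 s1 s2 /(finj _ _ (kf _ (gf _ s1)) (kf _ (gf _ s2))).
  by move=> /(kinj _ _ (gf _ s1) (gf _ s2)); apply: ginj.
- by move=> S sS; apply: out; apply/kf/gf.
Qed.

End Extension.

(** * Equivalence of the four assertions *)

Theorem theorem1 (R : realType) (n : nat) (B : 'M[R]_n)
    (H : set 'rV[R]_n) (e : 'rV[R]_n) :
  B \in unitmx ->
  norm2 e = 1 ->
  H = [set x | dot x e = 0] ->
  affine_hull (lattice_of B `&` H) = H ->
  [/\ is_lamina (lattice_of B) H <-> has_closed_zone (voronoi (lattice_of B)) e,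
      has_closed_zone (voronoi (lattice_of B)) e <->
        (forall eps : R, 0 < eps ->
           same_Ltype (lattice_of B) (lattice_of (B *m ext_mx e eps)))
    & (forall eps : R, 0 < eps ->
           same_Ltype (lattice_of B) (lattice_of (B *m ext_mx e eps))) <->
        (forall lam : R, 0 <= lam ->
           Ldomain (B *m B^T)
             (B *m B^T + lam *: ((B *m e^T) *m (B *m e^T)^T)))].
Proof.
move=> uB ne -> hull_H; have cq := coercive_norm2 uB.
pose q := sqlen B; pose h := e *m B^T.
have h0 : h != 0 by apply: height_neq0.
have span := span_height uB hull_H.
have lam_good := lamina_allgood uB ne hull_H.
have zone_good : has_closed_zone (voronoi (lattice_of B)) e <-> allgood q h.
  by split; [apply: closed_zone_allgood|apply: allgood_closed_zone].
have par_del : (forall Q, cell q (@integral R n) Q -> parabolic h Q) ->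
    forall lam, 0 <= lam -> del (stretch q h lam) = del q.
  by move=> par lam l0; apply: del_stretch.
have good_del : allgood q h <-> forall lam, 0 <= lam -> del (stretch q h lam) = del q.
  split=> [ag|]; last exact: del_stretch_allgood.
  by apply: par_del => Q; apply: allgood_parabolic => //; apply: sqlen_shift.
have same_del : (forall eps : R, 0 < eps ->
      same_Ltype (lattice_of B) (lattice_of (B *m ext_mx e eps))) <->
    forall lam, 0 <= lam -> del (stretch q h lam) = del q.
  split=> [same|dE eps eps0]; first exact/par_del/same_Ltype_parabolic.
  apply: same_Ltype_of_del => //; first by apply: ext_unitmx => //; apply: ltW.
  rewrite sqlen_ext // dE // mulr_ge0 ?addr_ge0 //; exact: ltW.
have ldom_del : (forall lam : R, 0 <= lam ->
      Ldomain (B *m B^T) (B *m B^T + lam *: ((B *m e^T) *m (B *m e^T)^T))) <->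
    forall lam, 0 <= lam -> del (stretch q h lam) = del q.
  by split=> D lam l0; have := D lam l0; rewrite Ldomain_ext.
split.
- by rewrite lam_good zone_good.
- by rewrite zone_good good_del same_del.
- by rewrite same_del ldom_del.
Qed.
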